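(* Let $\mathfrak{g}$ be a quadratic Lie algebra. There is a commutative diagram $$\begin{array}{ccc}W\mathfrak{g}&\xrightarrow{\ \mathcal{Q}_\mathfrak{g}\ }&\mathcal{W}\mathfrak{g}\\ \uparrow&&\uparrow\\ S\mathfrak{g}&\longrightarrow&U\mathfrak{g}\end{array}$$ in which the upper horizontal map is the symmetrization map $\mathcal{Q}_\mathfrak{g}$, the vertical maps are injective algebra homomorphisms (namely the ones sending $\zeta\in\mathfrak{g}$ to $\widehat\zeta\in W\mathfrak{g}$, respectively to $\widehat\zeta\in\mathcal{W}\mathfrak{g}$), and the horizontal maps are vector space isomorphisms. The lower horizontal map restricts to an algebra isomorphism $(S\mathfrak{g})_{\mathrm{inv}}\to(U\mathfrak{g})_{\mathrm{inv}}$ on $\mathfrak{g}$-invariants.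
   Context: $\mathbb{F}$ is a field of characteristic $0$. A quadratic Lie algebra is a finite-dimensional Lie algebra $\mathfrak{g}$ over $\mathbb{F}$ with an invariant non-degenerate symmetric bilinear form $B$. $S\mathfrak{g}$, $U\mathfrak{g}$ are the symmetric and enveloping algebras. $\mathcal{W}\mathfrak{g}$ is the super algebra generated by odd elements $\xi$ and even elements $\overline\xi$ (linear in $\xi\in\mathfrak{g}$) with relations $\overline\xi\,\overline{\xi'}-\overline{\xi'}\,\overline\xi=\overline{[\xi,\xi']}$, $\overline\xi\xi'-\xi'\overline\xi=[\xi,\xi']$ (an odd generator), $\xi\xi'+\xi'\xi=B(\xi,\xi')$. $W\mathfrak{g}$ is the Weil algebra, which, using $B$ to identify $\mathfrak{g}^*\cong\mathfrak{g}$, is the free super-commutative algebra on odd generators $\xi$ and even generators $\overline\xi$, $\xi\in\mathfrak{g}$. The symmetrization map $\mathcal{Q}_\mathfrak{g}:W\mathfrak{g}\to\mathcal{W}\mathfrak{g}$ is $$v_1\cdots v_k\mapsto\frac1{k!}\sum_{\sigma\in\mathfrak{S}_k}(-1)^{N_\sigma}v_{\sigma^{-1}(1)}\cdots v_{\sigma^{-1}(k)}$$ for generators $v_i$ of the form $\xi$ or $\overline\xi$, where $N_\sigma$ is the number of pairs $i<j$ with $v_i,v_j$ odd and $\sigma^{-1}(i)>\sigma^{-1}(j)$. Let $e_a$ be a basis of $\mathfrak{g}$ and $e^a$ the $B$-dual basis. In $W\mathfrak{g}$ put $\lambda(\zeta)=\frac12\sum_a[\zeta,e_a]\,e^a$ (product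 of odd generators) and $\widehat\zeta=\overline\zeta-\lambda(\zeta)$. In $\mathcal{W}\mathfrak{g}$ put $\gamma(\zeta)=\frac12\sum_a[\zeta,e_a]\,e^a$ (product of odd generators) and $\widehat\zeta=\overline\zeta-\gamma(\zeta)$.
   Formalization: The sign exponent N_σ counts pairs i<j with v_{σ^{-1}(i)}, v_{σ^{-1}(j)} odd (instead of v_i, v_j odd) and σ^{-1}(i)>σ^{-1}(j); with the printed rule the symmetrization map is not well defined on words mixing odd and even generators. *)

(* Defs.v *)
(* MathComp; boolp is used to form quotients by Prop-valued relations. *)
From HB Require Import structures.
From mathcomp Require Import all_boot all_order perm all_algebra.
From mathcomp Require Import boolp classical_sets functions.

Set Implicit Arguments.
Unset Strict Implicit.
Unset Printing Implicit Defensive.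

Import GRing.Theory.
Local Open Scope ring_scope.
Local Open Scope quotient_scope.

HB.mixin Record Vector_isLie (F : fieldType) g of Vector F g := {
  lie_bracket : {bilinear g -> g -> g};
  lie_alternating : forall x : g, lie_bracket x x = 0;
  lie_jacobi : forall x y z : g,
    lie_bracket x (lie_bracket y z) + lie_bracket y (lie_bracket z x)
      + lie_bracket z (lie_bracket x y) = 0
}.

#[short(type="lieAlgType")]
HB.structure Definition LieAlgebra (F : fieldType) :=
  { g of Vector_isLie F g & Vector F g }.

HB.mixin Record Lie_isQuadratic (F : fieldType) g of LieAlgebra F g := {
  quad_form : {symmetric g};
  quad_invariant : forall x y z : g,
    quad_form (lie_bracket x y) z = quad_form x (lie_bracket y z);
  quad_nondegenerate : nondegenerate quad_form
}.

#[short(type="quadLieAlgType")]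
HB.structure Definition QuadraticLie (F : fieldType) :=
  { g of Lie_isQuadratic F g & LieAlgebra F g }.

(* Associative unital F-algebras presented by generators X and relations R.
   Elements are formal expressions, with scalars as constants, modulo the
   congruence generated by the algebra axioms and R.  A presented algebra may
   be trivial, hence it is only a pzRingType and an lmodType, not an algType. *)

Inductive pterm (F X : Type) : Type :=
| PGen of X
| PConst of F
| PAdd of pterm F X & pterm F X
| PMul of pterm F X & pterm F X.
Arguments PGen {F X} _.
Arguments PConst {F X} _.

Declare Scope pterm_scope.
Delimit Scope pterm_scope with P.
Bind Scope pterm_scope with pterm.
Notation "s + t" := (PAdd s t) : pterm_scope.
Notation "s * t" := (PMul s t) : pterm_scope.
Notation "s - t" := (PAdd s (PMul (PConst (-1)%R) t)) : pterm_scope.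

Inductive pcong (F : fieldType) (X : Type)
    (R : pterm F X -> pterm F X -> Prop) : pterm F X -> pterm F X -> Prop :=
| pcong_rel s t : R s t -> pcong R s t
| pcong_refl s : pcong R s s
| pcong_sym s t : pcong R s t -> pcong R t s
| pcong_trans t s u : pcong R s t -> pcong R t u -> pcong R s u
| pcong_add s s' t t' :
    pcong R s s' -> pcong R t t' -> pcong R (s + t) (s' + t')
| pcong_mul s s' t t' :
    pcong R s s' -> pcong R t t' -> pcong R (s * t) (s' * t')
| pcong_constD a b : pcong R (PConst (a + b)%R) (PConst a + PConst b)
| pcong_constM a b : pcong R (PConst (a * b)%R) (PConst a * PConst b)
| pcong_constC a t : pcong R (PConst a * t) (t * PConst a)
| pcong_addA s t u : pcong R (s + (t + u)) (s + t + u)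
| pcong_addC s t : pcong R (s + t) (t + s)
| pcong_add0 t : pcong R (PConst 0%R + t) t
| pcong_mulA s t u : pcong R (s * (t * u)) (s * t * u)
| pcong_mul1 t : pcong R (PConst 1%R * t) t
| pcong_mul0 t : pcong R (PConst 0%R * t) (PConst 0%R)
| pcong_mulDl s t u : pcong R ((s + t) * u) (s * u + t * u)
| pcong_mulDr s t u : pcong R (u * (s + t)) (u * s + u * t).

Section PresentedAlgebra.
Variables (F : fieldType) (X : Type) (R : pterm F X -> pterm F X -> Prop).

Definition pcongb (s t : {classic pterm F X}) : bool := `[< pcong R s t >].

Lemma pcongb_equiv : equiv_class_of pcongb.
Proof.
split=> [s|s t|t s u].
- exact/asboolP/pcong_refl.
- by apply/asboolP/asboolP; apply: pcong_sym.
- by move=> /asboolP st /asboolP tu; apply/asboolP/(pcong_trans st tu).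
Qed.

Canonical pcong_equiv := EquivRelPack pcongb_equiv.

Definition palg : Type := {eq_quot pcong_equiv}.
HB.instance Definition _ := Choice.on palg.
HB.instance Definition _ := EqQuotient.on palg.

Definition pclass (t : pterm F X) : palg := \pi_palg (t : {classic pterm F X}).
Definition prepr (x : palg) : pterm F X := generic_quotient.repr x.

Lemma preprK x : pclass (prepr x) = x. Proof. exact: reprK. Qed.

Lemma pclassP s t : pclass s = pclass t <-> pcong R s t.
Proof.
by split=> [/eqP|st]; [rewrite eqmodE => /asboolP|apply/eqP; rewrite eqmodE; apply/asboolP].
Qed.

Lemma prepr_pclass t : pcong R (prepr (pclass t)) t.
Proof. by apply/pclassP; rewrite preprK. Qed.

Definition pgen (x : X) : palg := pclass (PGen x).
Definition pconst (a : F) : palg := pclass (PConst a).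
Definition padd (x y : palg) : palg := pclass (prepr x + prepr y).
Definition pmul (x y : palg) : palg := pclass (prepr x * prepr y).

Lemma paddE s t : padd (pclass s) (pclass t) = pclass (s + t).
Proof. by apply/pclassP/pcong_add; apply: prepr_pclass. Qed.

Lemma pmulE s t : pmul (pclass s) (pclass t) = pclass (s * t).
Proof. by apply/pclassP/pcong_mul; apply: prepr_pclass. Qed.

Lemma pclassW (P : palg -> Prop) : (forall t, P (pclass t)) -> forall x, P x.
Proof. by move=> Pc x; rewrite -(preprK x). Qed.

Fact paddA : associative padd.
Proof.
elim/pclassW=> s; elim/pclassW=> t; elim/pclassW=> u.
by rewrite !paddE; apply/pclassP/pcong_addA.
Qed.
Fact paddC : commutative padd.
Proof.
by elim/pclassW=> s; elim/pclassW=> t; rewrite !paddE; apply/pclassP/pcong_addC.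
Qed.
Fact padd0 : left_id (pconst 0) padd.
Proof. by elim/pclassW=> s; rewrite paddE; apply/pclassP/pcong_add0. Qed.
Fact pmulA : associative pmul.
Proof.
elim/pclassW=> s; elim/pclassW=> t; elim/pclassW=> u.
by rewrite !pmulE; apply/pclassP/pcong_mulA.
Qed.
Fact pmul1l : left_id (pconst 1) pmul.
Proof. by elim/pclassW=> s; rewrite pmulE; apply/pclassP/pcong_mul1. Qed.
Fact pconstC a x : pmul (pconst a) x = pmul x (pconst a).
Proof. by elim/pclassW: x => s; rewrite !pmulE; apply/pclassP/pcong_constC. Qed.
Fact pmul1r : right_id (pconst 1) pmul.
Proof. by move=> x; rewrite -pconstC pmul1l. Qed.
Fact pmulDl : left_distributive pmul padd.
Proof.
elim/pclassW=> s; elim/pclassW=> t; elim/pclassW=> u.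
by rewrite !(paddE, pmulE); apply/pclassP/pcong_mulDl.
Qed.
Fact pmulDr : right_distributive pmul padd.
Proof.
elim/pclassW=> s; elim/pclassW=> t; elim/pclassW=> u.
by rewrite !(paddE, pmulE); apply/pclassP/pcong_mulDr.
Qed.
Fact pconst_add a b : pconst (a + b) = padd (pconst a) (pconst b).
Proof. by rewrite paddE; apply/pclassP/pcong_constD. Qed.
Fact pconst_mul a b : pconst (a * b) = pmul (pconst a) (pconst b).
Proof. by rewrite pmulE; apply/pclassP/pcong_constM. Qed.
Fact pmul0l x : pmul (pconst 0) x = pconst 0.
Proof. by elim/pclassW: x => s; rewrite pmulE; apply/pclassP/pcong_mul0. Qed.
Definition popp (x : palg) : palg := pmul (pconst (-1)) x.
Fact paddN : left_inverse (pconst 0) popp padd.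
Proof.
by move=> x; rewrite -{2}[x]pmul1l -pmulDl -pconst_add addNr pmul0l.
Qed.

HB.instance Definition _ := GRing.isZmodule.Build palg paddA paddC padd0 paddN.
HB.instance Definition _ :=
  GRing.Zmodule_isPzRing.Build palg pmulA pmul1l pmul1r pmulDl pmulDr.

Definition pscale (a : F) (x : palg) : palg := pconst a * x.

Fact pscaleA a b x : pscale a (pscale b x) = pscale (a * b) x.
Proof. by rewrite /pscale mulrA -[pconst a * pconst b]pconst_mul. Qed.
Fact pscale1 : left_id 1 pscale. Proof. exact: mul1r. Qed.
Fact pscaleDr : right_distributive pscale +%R.
Proof. by move=> a; apply: mulrDr. Qed.
Fact pscaleDl x : {morph pscale^~ x : a b / a + b}.
Proof. by move=> a b; rewrite /pscale -mulrDl -[pconst a + _]pconst_add. Qed.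

HB.instance Definition _ :=
  GRing.Zmodule_isLmodule.Build F palg pscaleA pscale1 pscaleDr pscaleDl.

Lemma palg_scaleAl (a : F) (x y : palg) : a *: (x * y) = a *: x * y.
Proof. exact: mulrA. Qed.

Lemma palg_scaleAr (a : F) (x y : palg) : a *: (x * y) = x * (a *: y).
Proof.
by rewrite palg_scaleAl [a *: x]pconstC -[pmul _ _]/(x * pconst a) -mulrA.
Qed.

Lemma pconstE a : pconst a = a *: (1 : palg).
Proof. by rewrite [RHS]mulr1. Qed.

Lemma pclassD s t : pclass (s + t) = pclass s + pclass t.
Proof. exact/esym/paddE. Qed.

Lemma pclassM s t : pclass (s * t) = pclass s * pclass t.
Proof. exact/esym/pmulE. Qed.

Lemma palg_ind (P : palg -> Prop) :
  (forall x, P (pgen x)) -> (forall a, P (a *: (1 : palg))) ->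
  (forall x y, P x -> P y -> P (x + y)) ->
  (forall x y, P x -> P y -> P (x * y)) -> forall x, P x.
Proof.
move=> Pg Pc Pa Pm; elim/pclassW; elim=> [x|a|s Ps t Pt|s Ps t Pt].
- exact: Pg.
- by rewrite -[pclass _]/(pconst a) pconstE.
- by rewrite pclassD; apply: Pa.
- by rewrite pclassM; apply: Pm.
Qed.

Lemma palg_linear_eq (V : lmodType F) (f h : palg -> V) :
  linear f -> linear h ->
  (forall k (v : 'I_k -> X),
    f (\prod_(i < k) pgen (v i)) = h (\prod_(i < k) pgen (v i))) ->
  f =1 h.
Proof.
move=> linf linh fh.
have fD x y : f x = h x -> f y = h y -> f (x + y) = h (x + y).
  by move=> Ex Ey; rewrite -[x]scale1r linf linh Ex Ey.
have f0 : f 0 = h 0.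
  have := linf (-1) 0 0; rewrite scaler0 addr0 scaleN1r addNr => ->.
  by have := linh (-1) 0 0; rewrite scaler0 addr0 scaleN1r addNr => ->.
have fZ a x : f x = h x -> f (a *: x) = h (a *: x).
  by move=> Ex; rewrite -[a *: x]addr0 linf linh Ex f0.
pose word (u : seq X) : palg := \prod_(x <- u) pgen x.
pose good y := forall u, f (word u * y) = h (word u * y).
have good1 : good 1.
  move=> u; rewrite mulr1 /word; have -> : u = in_tuple u by [].
  by rewrite big_tuple fh.
suff goodM x y : good y -> good (x * y).
  by move=> x; have := goodM x 1 good1 nil; rewrite mulr1 /word big_nil mul1r.
elim/palg_ind: x y => [x|a|x1 x2 IH1 IH2|x1 x2 IH1 IH2] y gy u.
- by have := gy (rcons u x); rewrite /word -cats1 big_cat big_seq1 /= !mulrA.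
- by rewrite -palg_scaleAl mul1r -palg_scaleAr; apply/fZ/gy.
- by rewrite mulrDl mulrDr; apply: fD; [apply: IH1|apply: IH2].
- by rewrite -mulrA; apply/IH1/IH2.
Qed.

(* The F-algebra structure on the target is given by a central morphism c, so
   that the target may itself be a presented algebra. *)
Section Lift.
Variables (B : pzRingType) (c : {rmorphism F -> B}) (h : X -> B).

Fixpoint peval (t : pterm F X) : B :=
  match t with
  | PGen x => h x
  | PConst a => c a
  | PAdd s t => peval s + peval t
  | PMul s t => peval s * peval t
  end.

Definition palg_lift (x : palg) : B := peval (prepr x).

Hypothesis c_central : forall a b, c a * b = b * c a.
Hypothesis h_rel : forall s t, R s t -> peval s = peval t.

Lemma peval_cong s t : pcong R s t -> peval s = peval t.
Proof.
elim=> //=.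
- by move=> > _ -> _ ->.
- by move=> > _ -> _ ->.
- by move=> > _ -> _ ->.
- by move=> *; rewrite rmorphD.
- by move=> *; rewrite rmorphM.
- by move=> *; rewrite addrA.
- by move=> *; rewrite addrC.
- by move=> *; rewrite rmorph0 add0r.
- by move=> *; rewrite mulrA.
- by move=> *; rewrite rmorph1 mul1r.
- by move=> *; rewrite rmorph0 mul0r.
- by move=> *; rewrite mulrDl.
- by move=> *; rewrite mulrDr.
Qed.

Lemma palg_lift_class t : palg_lift (pclass t) = peval t.
Proof. exact/peval_cong/prepr_pclass. Qed.

Lemma palg_lift_gen x : palg_lift (pgen x) = h x.
Proof. exact: palg_lift_class. Qed.

Lemma palg_liftD x y : palg_lift (x + y) = palg_lift x + palg_lift y.
Proof.
by elim/pclassW: x => s; elim/pclassW: y => t; rewrite -pclassD !palg_lift_class.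
Qed.

Lemma palg_liftM x y : palg_lift (x * y) = palg_lift x * palg_lift y.
Proof.
by elim/pclassW: x => s; elim/pclassW: y => t; rewrite -pclassM !palg_lift_class.
Qed.

Lemma palg_liftZ a x : palg_lift (a *: x) = c a * palg_lift x.
Proof. by rewrite palg_liftM palg_lift_class. Qed.

Lemma palg_lift1 : palg_lift 1 = 1.
Proof. by rewrite palg_lift_class /= rmorph1. Qed.

End Lift.

(* The derivation extending a map d of the generators: it is computed on a
   representative, and meaningful when d preserves the relations. *)
Section Derivation.
Variable d : X -> X.

Fixpoint pterm_der (t : pterm F X) : pterm F X :=
  match t with
  | PGen x => PGen (d x)
  | PConst _ => PConst 0%R
  | PAdd s t => pterm_der s + pterm_der t
  | PMul s t => pterm_der s * t + s * pterm_der t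
  end%P.

Definition palg_der (x : palg) : palg := pclass (pterm_der (prepr x)).

Hypothesis d_rel : forall s t, R s t -> pcong R (pterm_der s) (pterm_der t).

Lemma pterm_der_cong s t :
  pcong R s t -> pclass (pterm_der s) = pclass (pterm_der t).
Proof.
have p0 : pclass (PConst 0) = 0 by [].
have p1 : pclass (PConst 1) = 1 by [].
elim=> //=.
- by move=> ?? /d_rel /pclassP.
- by move=> > _ -> _ ->.
- by move=> > _ Est _ Etu; rewrite !pclassD Est Etu.
- by move=> > /pclassP Es IHs /pclassP Et IHt; rewrite !(pclassD, pclassM) Es Et IHs IHt.
- by move=> *; rewrite pclassD p0 addr0.
- by move=> *; rewrite !(pclassD, pclassM) p0 mul0r mulr0 addr0.
- move=> a t'; rewrite !(pclassD, pclassM) p0 mul0r mulr0 addr0 add0r.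
  exact: pconstC.
- by move=> *; rewrite !pclassD addrA.
- by move=> *; rewrite !pclassD addrC.
- by move=> *; rewrite !pclassD p0 add0r.
- by move=> *; rewrite !(pclassD, pclassM) mulrDl mulrDr !mulrA addrA.
- by move=> *; rewrite !(pclassD, pclassM) p0 p1 mul0r mul1r add0r.
- by move=> *; rewrite !(pclassD, pclassM) p0 !mul0r addr0.
- by move=> *; rewrite !(pclassD, pclassM) !mulrDl addrACA.
- by move=> *; rewrite !(pclassD, pclassM) !mulrDr addrACA.
Qed.

Lemma palg_der_class t : palg_der (pclass t) = pclass (pterm_der t).
Proof. exact/pterm_der_cong/prepr_pclass. Qed.

Lemma palg_der_gen x : palg_der (pgen x) = pgen (d x).
Proof. exact: palg_der_class. Qed.

Lemma palg_derM x y : palg_der (x * y) = palg_der x * y + x * palg_der y.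
Proof.
elim/pclassW: x => s; elim/pclassW: y => t.
by rewrite -pclassM !palg_der_class /= pclassD !pclassM.
Qed.

Lemma palg_der_linear : linear palg_der.
Proof.
move=> a; elim/pclassW=> s; elim/pclassW=> t.
rewrite -[a *: _]pclassM -pclassD !palg_der_class /=.
by rewrite !(pclassD, pclassM) -[pclass (PConst 0)]/(0 : palg) mul0r add0r.
Qed.

End Derivation.
End PresentedAlgebra.

Arguments pgen {F X} R x.

Inductive sym_rel (F : fieldType) (g : vectType F) :
    pterm F g -> pterm F g -> Prop :=
| SymLinear a (x y : g) :
    sym_rel (PGen (a *: x + y)%R) (PConst a * PGen x + PGen y)
| SymComm (x y : g) : sym_rel (PGen x * PGen y) (PGen y * PGen x).

Inductive env_rel (F : fieldType) (g : lieAlgType F) :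
    pterm F g -> pterm F g -> Prop :=
| EnvLinear a (x y : g) :
    env_rel (PGen (a *: x + y)%R) (PConst a * PGen x + PGen y)
| EnvBracket (x y : g) :
    env_rel (PGen x * PGen y - PGen y * PGen x) (PGen (lie_bracket x y)).

(* WOdd x is the odd generator x, WEven x is the even generator \overline{x} *)
Inductive weil_gen (V : Type) : Type := WOdd of V | WEven of V.

Definition is_odd (V : Type) (w : weil_gen V) : bool :=
  if w is WOdd _ then true else false.

Inductive weil_rel (F : fieldType) (g : vectType F) :
    pterm F (weil_gen g) -> pterm F (weil_gen g) -> Prop :=
| WeilOddLinear a (x y : g) :
    weil_rel (PGen (WOdd (a *: x + y)%R))
             (PConst a * PGen (WOdd x) + PGen (WOdd y))
| WeilEvenLinear a (x y : g) :
    weil_rel (PGen (WEven (a *: x + y)%R))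
             (PConst a * PGen (WEven x) + PGen (WEven y))
| WeilEvenEven (x y : g) :
    weil_rel (PGen (WEven x) * PGen (WEven y) - PGen (WEven y) * PGen (WEven x))
             (PConst 0%R)
| WeilEvenOdd (x y : g) :
    weil_rel (PGen (WEven x) * PGen (WOdd y) - PGen (WOdd y) * PGen (WEven x))
             (PConst 0%R)
| WeilOddOdd (x y : g) :
    weil_rel (PGen (WOdd x) * PGen (WOdd y) + PGen (WOdd y) * PGen (WOdd x))
             (PConst 0%R).

Inductive ncweil_rel (F : fieldType) (g : quadLieAlgType F) :
    pterm F (weil_gen g) -> pterm F (weil_gen g) -> Prop :=
| NcWeilOddLinear a (x y : g) :
    ncweil_rel (PGen (WOdd (a *: x + y)%R))
               (PConst a * PGen (WOdd x) + PGen (WOdd y))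
| NcWeilEvenLinear a (x y : g) :
    ncweil_rel (PGen (WEven (a *: x + y)%R))
               (PConst a * PGen (WEven x) + PGen (WEven y))
| NcWeilEvenEven (x y : g) :
    ncweil_rel (PGen (WEven x) * PGen (WEven y) - PGen (WEven y) * PGen (WEven x))
               (PGen (WEven (lie_bracket x y)))
| NcWeilEvenOdd (x y : g) :
    ncweil_rel (PGen (WEven x) * PGen (WOdd y) - PGen (WOdd y) * PGen (WEven x))
               (PGen (WOdd (lie_bracket x y)))
| NcWeilOddOdd (x y : g) :
    ncweil_rel (PGen (WOdd x) * PGen (WOdd y) + PGen (WOdd y) * PGen (WOdd x))
               (PConst (quad_form x y)).

Notation symAlg g := (palg (@sym_rel _ g)).
Notation envAlg g := (palg (@env_rel _ g)).
Notation weilAlg g := (palg (@weil_rel _ g)).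
Notation ncWeilAlg g := (palg (@ncweil_rel _ g)).

Notation symGen := (pgen (@sym_rel _ _)).
Notation envGen := (pgen (@env_rel _ _)).
Notation weilGen := (pgen (@weil_rel _ _)).
Notation ncWeilGen := (pgen (@ncweil_rel _ _)).

Definition algebra_hom (F : fieldType) (X Y : Type)
    (R : pterm F X -> pterm F X -> Prop) (R' : pterm F Y -> pterm F Y -> Prop)
    (f : palg R -> palg R') : Prop :=
  linear f /\ monoid_morphism f.

Definition dual_bases (F : fieldType) (g : quadLieAlgType F)
    (e f : (\dim {:g}).-tuple g) : Prop :=
  basis_of fullv e /\
  (forall a b, quad_form (tnth e a) (tnth f b) = (a == b)%:R).

Section Hat.
Variables (F : fieldType) (g : quadLieAlgType F) (e f : (\dim {:g}).-tuple g).

Definition weil_lambda (z : g) : weilAlg g :=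
  2^-1 *: \sum_a weilGen (WOdd (lie_bracket z (tnth e a)))
               * weilGen (WOdd (tnth f a)).

Definition weil_hat (z : g) : weilAlg g :=
  weilGen (WEven z) - weil_lambda z.

Definition ncweil_gamma (z : g) : ncWeilAlg g :=
  2^-1 *: \sum_a ncWeilGen (WOdd (lie_bracket z (tnth e a)))
               * ncWeilGen (WOdd (tnth f a)).

Definition ncweil_hat (z : g) : ncWeilAlg g :=
  ncWeilGen (WEven z) - ncweil_gamma z.

End Hat.

(* Koszul exponent of the rearrangement v_{s^-1(1)} ... v_{s^-1(k)}: the number
   of pairs of odd letters of the rearranged word standing in reversed order.
   Parity is tested on the letters v_{s^-1(i)}, v_{s^-1(j)} in positions i < j;
   testing it on v_i, v_j instead would not give a map on the supercommutative
   algebra as soon as odd and even letters are mixed. *)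
Definition koszul (V : Type) (k : nat) (v : 'I_k -> weil_gen V) (s : 'S_k) : nat :=
  #|[set p : 'I_k * 'I_k |
      [&& (p.1 < p.2)%N, is_odd (v (s^-1%g p.1)), is_odd (v (s^-1%g p.2))
        & (s^-1%g p.2 < s^-1%g p.1)%N]]|.

Definition is_symmetrization (F : fieldType) (g : quadLieAlgType F)
    (Q : weilAlg g -> ncWeilAlg g) : Prop :=
  linear Q /\
  forall (k : nat) (v : 'I_k -> weil_gen g),
    Q (\prod_(i < k) weilGen (v i)) =
    (k`!%:R)^-1 *: \sum_(s : 'S_k)
      (-1) ^+ koszul v s *: \prod_(i < k) ncWeilGen (v (s^-1%g i)).

Lemma symmetrization_unique (F : fieldType) (g : quadLieAlgType F)
    (Q Q' : weilAlg g -> ncWeilAlg g) :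
  is_symmetrization Q -> is_symmetrization Q' -> Q =1 Q'.
Proof.
move=> [linQ QE] [linQ' Q'E]; apply: palg_linear_eq => // k v.
by rewrite QE Q'E.
Qed.

(* The g-actions by derivations extending the adjoint action on g. *)
Definition sym_ad (F : fieldType) (g : lieAlgType F) (z : g) :
  symAlg g -> symAlg g := palg_der (lie_bracket z).

Definition env_ad (F : fieldType) (g : lieAlgType F) (z : g) :
  envAlg g -> envAlg g := palg_der (lie_bracket z).

Section AdjointAction.
Variables (F : fieldType) (g : lieAlgType F) (z : g).

Lemma lie_antisym (x y : g) : lie_bracket x y = - lie_bracket y x.
Proof.
apply/eqP; rewrite -addr_eq0; have /eqP := lie_alternating (x + y).
by rewrite linearDl !linearDr /= !lie_alternating add0r addr0.
Qed.

Lemma lie_leibniz (x y : g) :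
  lie_bracket (lie_bracket z x) y + lie_bracket x (lie_bracket z y)
    = lie_bracket z (lie_bracket x y).
Proof.
have /eqP := lie_jacobi z x y; rewrite -addrA addr_eq0 => /eqP ->.
rewrite opprD addrC [lie_bracket z y]lie_antisym linearNr /=.
by rewrite [lie_bracket (_ z x) y]lie_antisym.
Qed.

Lemma sym_genP a (x y : g) :
  symGen (a *: x + y) = a *: symGen x + symGen y.
Proof.
apply: etrans; first exact/pclassP/pcong_rel/SymLinear.
by rewrite pclassD pclassM.
Qed.

Lemma sym_genC (x y : g) : symGen x * symGen y = symGen y * symGen x.
Proof. by rewrite -!pclassM; apply/pclassP/pcong_rel/SymComm. Qed.

Lemma env_genP a (x y : g) :
  envGen (a *: x + y) = a *: envGen x + envGen y.
Proof.
apply: etrans; first exact/pclassP/pcong_rel/EnvLinear.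
by rewrite pclassD pclassM.
Qed.

Lemma env_genB (x y : g) :
  envGen x * envGen y - envGen y * envGen x = envGen (lie_bracket x y).
Proof.
rewrite -[- _]mulN1r; apply: etrans; last exact/pclassP/pcong_rel/EnvBracket.
by rewrite !(pclassD, pclassM) -[pclass _ (PConst _)]/(pconst _ _) pconstE scaleN1r.
Qed.

Lemma sym_ad_rel s t : sym_rel s t ->
  pcong (@sym_rel F g) (pterm_der (lie_bracket z) s) (pterm_der (lie_bracket z) t).
Proof.
case=> [a x y|x y] /=; apply/pclassP; rewrite !(pclassD, pclassM).
  rewrite -[pclass _ (PConst 0)]/(0 : symAlg g) mul0r add0r linearPr /=.
  exact: sym_genP.
by rewrite addrC; congr (_ + _); apply: sym_genC.
Qed.

Lemma env_ad_rel s t : env_rel s t ->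
  pcong (@env_rel F g) (pterm_der (lie_bracket z) s) (pterm_der (lie_bracket z) t).
Proof.
case=> [a x y|x y] /=; apply/pclassP; rewrite !(pclassD, pclassM).
  rewrite -[pclass _ (PConst 0)]/(0 : envAlg g) mul0r add0r linearPr /=.
  exact: env_genP.
rewrite -[pclass _ (PConst 0)]/(0 : envAlg g) mul0r add0r.
rewrite -[pclass _ (PConst _)]/(pconst _ _) pconstE scaleN1r mulN1r.
rewrite -lie_leibniz -[pclass _ (PGen (_ + _))]/(envGen _).
have := env_genP 1 (lie_bracket (lie_bracket z x) y) (lie_bracket x (lie_bracket z y)).
rewrite !scale1r => ->.
rewrite -(env_genB (lie_bracket z x) y) -(env_genB x (lie_bracket z y)).
by rewrite [X in _ - X]addrC opprD addrACA.
Qed.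

Lemma sym_ad_gen x : sym_ad z (symGen x) = symGen (lie_bracket z x).
Proof. exact/palg_der_gen/sym_ad_rel. Qed.

Lemma sym_adM x y : sym_ad z (x * y) = sym_ad z x * y + x * sym_ad z y.
Proof. exact/palg_derM/sym_ad_rel. Qed.

Lemma sym_ad_linear : linear (@sym_ad F g z).
Proof. exact/palg_der_linear/sym_ad_rel. Qed.

Lemma env_ad_gen x : env_ad z (envGen x) = envGen (lie_bracket z x).
Proof. exact/palg_der_gen/env_ad_rel. Qed.

Lemma env_adM x y : env_ad z (x * y) = env_ad z x * y + x * env_ad z y.
Proof. exact/palg_derM/env_ad_rel. Qed.

Lemma env_ad_linear : linear (@env_ad F g z).
Proof. exact/palg_der_linear/env_ad_rel. Qed.

End AdjointAction.

Definition sym_inv (F : fieldType) (g : lieAlgType F) : set (symAlg g) :=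
  [set x | forall z : g, sym_ad z x = 0].

Definition env_inv (F : fieldType) (g : lieAlgType F) : set (envAlg g) :=
  [set x | forall z : g, env_ad z x = 0].
Arguments sym_inv {F} g.
Arguments env_inv {F} g.

(* Main.v *)
(** Both Weil algebras carry a parity, an odd differential [d], contractions
    [iota_z] and Lie derivatives [L_z = [iota_z, d]].  Symmetrization is the sum
    of [Phi_k / k!] where [Phi_0] is the augmentation and
    [Phi_(k+1) u = sum_A v_A Phi_k (d_A u)], the [v_A] being a basis of the
    generators and the [d_A] the dual derivations; in this form it visibly
    intertwines [d] and [iota_z], hence preserves horizontal elements (those
    killed by all contractions).  Horizontal elements are the images of [S g]
    and [U g], which gives the diagram.  Symmetrization is surjective by
    comparing leading terms; contractions lower degrees and preserve its kernel,
    so that it is injective as soon as it is on [S g], which follows from the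
    Poincare-Birkhoff-Witt theorem.

    Multiplicativity on invariants is the independence of the Chern-Weil map
    from the connection.  For an invariant [y], the map
    [Psi : a (x) b |-> Q a Q (b y)] on [W (x) W] intertwines [d] and [iota_z].
    The number operator [T] counting the generators
    [x (x) 1 - 1 (x) x] equals [[d, s]] for an odd derivation [s] that
    anticommutes with contractions.  If [u] is closed, even and horizontal, then
    [Psi (s u)] is odd and horizontal, hence zero because [U g] is even, so
    [Psi (T u) = 0].  Applied to the polynomials in [T] at
    [u = x (x) 1 - 1 (x) x], on which [T] only has positive eigenvalues, this
    gives [Psi u = 0], that is [Q x Q y = Q (x y)]. *)

(* All algebras are given by presentations, so their size is not known beforehand: spanning
   statements come from rewriting generators, while injectivity needs explicit modules or
   retractions. [S g] is recovered from the Weil algebra by killing the odd generators. In the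
   noncommutative Weil algebra the Clifford relation rules this out in general, and a Clifford
   module of functions takes its place. The Poincare-Birkhoff-Witt theorem is likewise obtained from
   an action of [U g] on functions on words.

   Odd generators weigh one and even generators two. Then the hatted elements are homogeneous,
   supercommutators lose weight, and contractions strictly lower weights, as the inductions on
   weight require.

   The exponential sum is built for the Weil algebra of any space [V] with a linear map to [g] and
   for any initial map: [V = g] with the augmentation gives [Q], and [g * g] with the first
   projection gives [Psi], so compatibility with [d] and contractions is proved once. Characteristic
   zero is used for the factorials, for the one half in $\gamma$ and for dividing by positive
   eigenvalues. *)
Require Import Defs.
From HB Require Import structures.
From mathcomp Require Import all_boot all_order perm all_algebra.
From mathcomp Require Import zify.
From mathcomp Require Import boolp classical_sets functions.

Set Implicit Arguments.
Unset Strict Implicit.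
Unset Printing Implicit Defensive.

Import GRing.Theory.
Local Open Scope ring_scope.

(** * Abelian group identities *)

(* Reflexive decision procedure for identities in abelian groups: [ring] does
   not apply to the noncommutative presented algebras. *)
Inductive zexp : Type :=
| ZVar of nat
| ZZero
| ZAdd of zexp & zexp
| ZOpp of zexp.

Section ZExp.
Variable V : zmodType.

Fixpoint zeval (env : seq V) (e : zexp) : V :=
  match e with
  | ZVar i => nth 0 env i
  | ZZero => 0
  | ZAdd a b => zeval env a + zeval env b
  | ZOpp a => - zeval env a
  end.

Fixpoint zcoef (e : zexp) (i : nat) : int :=
  match e with
  | ZVar j => if j == i then 1 else 0
  | ZZero => 0
  | ZAdd a b => zcoef a i + zcoef b i
  | ZOpp a => - zcoef a i
  end.

Lemma zevalE env e :
  zeval env e = \sum_(i < size env) nth 0 env i *~ zcoef e i.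
Proof.
elim: e => [j||a IHa b IHb|a IHa] /=; rewrite ?IHa ?IHb.
- have [ltj|lej] := ltnP j (size env).
    rewrite (bigD1 (Ordinal ltj)) //= eqxx mulr1z big1 ?addr0 // => i /eqP neq.
    by case: eqP => [E|_]; [case: neq; apply: val_inj|rewrite mulr0z].
  rewrite nth_default // big1 // => i _.
  by case: eqP => [E|_]; rewrite ?mulr0z // E leqNgt ltn_ord in lej.
- by rewrite big1 // => i _; rewrite mulr0z.
- by rewrite -big_split; apply: eq_bigr => i _; rewrite mulrzDr.
- by rewrite -sumrN; apply: eq_bigr => i _; rewrite mulrNz.
Qed.

Lemma zeval_eq env e1 e2 :
  all (fun i => zcoef e1 i == zcoef e2 i) (iota 0 (size env)) ->
  zeval env e1 = zeval env e2.
Proof.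
move/allP=> E; rewrite !zevalE; apply: eq_bigr => i _.
by rewrite (eqP (E i _)) // mem_iota /= ltn_ord.
Qed.
End ZExp.

Ltac zhead t := lazymatch t with ?g _ => zhead g | _ => t end.

(* Syntactic equality of atoms up to the canonical instances of the operations. *)
Ltac zsame x y :=
  first [ constr_eq x y
  | lazymatch x with
    | GRing.mul ?a ?b =>
      lazymatch y with GRing.mul ?c ?d => zsame a c; zsame b d end
    | GRing.scale ?a ?b =>
      lazymatch y with GRing.scale ?c ?d => zsame a c; zsame b d end
    | (?a + ?b)%R => lazymatch y with (?c + ?d)%R => zsame a c; zsame b d end
    | (- ?a)%R => lazymatch y with (- ?c)%R => zsame a c end
    | 1%R => lazymatch y with 1%R => idtac end
    | 0%R => lazymatch y with 0%R => idtac end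
    | ?g ?a =>
      let hx := zhead x in let hy := zhead y in constr_eq hx hy; unify x y
    end ].

(** Wrapping [zsame] in [match constr:(Set)] runs it for its success or failure in the middle of
    building a term; a failure falls through to the next branch. *)
Ltac zindex x env :=
  lazymatch env with
  | nil => constr:(O)
  | ?y :: ?env' =>
    match constr:(Set) with
    | _ => let _ := match constr:(Set) with _ => zsame x y end in constr:(O)
    | _ => let n := zindex x env' in constr:(S n)
    end
  end.

Ltac zenv_add x env :=
  let rec mem l :=
    lazymatch l with
    | nil => constr:(false)
    | ?y :: ?l' =>
      match constr:(Set) with
      | _ => let _ := match constr:(Set) with _ => zsame x y end in constr:(true)
      | _ => mem l'
      end
    end in
  let b := mem env in
  lazymatch b with
  | true => env
  | false => constr:(x :: env)
  end.

Ltac zatoms t env :=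
  lazymatch t with
  | (?a + ?b)%R => let e := zatoms a env in zatoms b e
  | (- ?a)%R => zatoms a env
  | 0%R => env
  | _ => zenv_add t env
  end.

Ltac zreify t env :=
  lazymatch t with
  | (?a + ?b)%R =>
    let a' := zreify a env in let b' := zreify b env in constr:(ZAdd a' b')
  | (- ?a)%R => let a' := zreify a env in constr:(ZOpp a')
  | 0%R => constr:(ZZero)
  | _ => let n := zindex t env in constr:(ZVar n)
  end.

Ltac abel :=
  lazymatch goal with
  | |- @eq ?T ?a ?b =>
    let env0 := zatoms a (@nil T) in
    let env := zatoms b env0 in
    let e1 := zreify a env in
    let e2 := zreify b env in
    refine (@zeval_eq _ env e1 e2 _); vm_compute; reflexivity
  end.

(** * Presented algebras: homomorphisms, derivations, actions, filtrations *)

Section RawLinear.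
Variables (F : fieldType) (U V : lmodType F) (h : U -> V).
Hypothesis lh : linear h.

Lemma lin0 : h 0 = 0.
Proof. by have := lh (-1) 0 0; rewrite scaler0 addr0 scaleN1r addNr. Qed.

Lemma linD x y : h (x + y) = h x + h y.
Proof. by rewrite -[x in LHS]scale1r lh scale1r. Qed.

Lemma linZ a x : h (a *: x) = a *: h x.
Proof. by rewrite -[a *: x]addr0 lh lin0 addr0. Qed.

Lemma linN x : h (- x) = - h x.
Proof. by rewrite -!scaleN1r linZ. Qed.

Lemma linB x y : h (x - y) = h x - h y.
Proof. by rewrite linD linN. Qed.

Lemma linP a x y : h (a *: x + y) = a *: h x + h y.
Proof. exact: lh. Qed.

Lemma lin_sum (I : Type) (r : seq I) (P : pred I) (E : I -> U) :
  h (\sum_(i <- r | P i) E i) = \sum_(i <- r | P i) h (E i).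
Proof. exact: (big_morph h linD lin0). Qed.

End RawLinear.

Lemma linear_comp (F : fieldType) (U V W : lmodType F) (h : V -> W) (k : U -> V) :
  linear h -> linear k -> linear (h \o k).
Proof. by move=> lh lk a x y; rewrite /= lk lh. Qed.

Section PresentedTools.
Variables (F : fieldType) (X : Type) (R : pterm F X -> pterm F X -> Prop).
Notation A := (palg R).

Lemma scalarl a (x : A) : a *: (1 : A) * x = a *: x.
Proof. by rewrite -palg_scaleAl mul1r. Qed.

Lemma scalarr a (x : A) : x * (a *: (1 : A)) = a *: x.
Proof. by rewrite -palg_scaleAr mulr1. Qed.

Lemma pclass_const a : pclass R (PConst a) = a *: (1 : A).
Proof. exact: pconstE. Qed.

Lemma pclassB s t : pclass R (s - t)%P = pclass R s - pclass R t.
Proof. by rewrite pclassD pclassM pclass_const scalarl scaleN1r. Qed.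

Lemma palg_rel s t : R s t -> pclass R s = pclass R t.
Proof. by move=> Rst; apply/pclassP/pcong_rel. Qed.

End PresentedTools.

Section PresentedHom.
Variables (F : fieldType) (X Y : Type).
Variables (R : pterm F X -> pterm F X -> Prop) (S : pterm F Y -> pterm F Y -> Prop).
Notation A := (palg R).
Notation B := (palg S).

Lemma pconst_nmod_morphism : nmod_morphism (@pconst F Y S).
Proof. by split=> // a b; rewrite pconst_add. Qed.
Lemma pconst_monoid_morphism : monoid_morphism (@pconst F Y S).
Proof. by split=> // a b; rewrite pconst_mul. Qed.
HB.instance Definition _ :=
  GRing.isNmodMorphism.Build F B (@pconst F Y S) pconst_nmod_morphism.
HB.instance Definition _ :=
  GRing.isMonoidMorphism.Build F B (@pconst F Y S) pconst_monoid_morphism.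

Definition phom (h : X -> B) : A -> B := palg_lift (@pconst F Y S) h.

Section PhomTheory.
Variable h : X -> B.
Hypothesis h_rel : forall s t, R s t -> peval (@pconst F Y S) h s = peval (@pconst F Y S) h t.

Let c_central (a : F) (b : B) : pconst S a * b = b * pconst S a.
Proof. by rewrite pconstE scalarl scalarr. Qed.

Lemma phom_gen x : phom h (pgen R x) = h x.
Proof. exact: palg_lift_gen. Qed.

Lemma phom_hom : algebra_hom (phom h).
Proof.
split; last by split=> [|x y]; [exact: palg_lift1|exact: palg_liftM].
by move=> a x y; rewrite /phom palg_liftD // palg_liftZ //= pconstE scalarl.
Qed.
End PhomTheory.

Section HomTheory.
Variables (k : A -> B) (hk : algebra_hom k).

Lemma homL : linear k. Proof. by case: hk. Qed.
Lemma hom1 : k 1 = 1. Proof. by case: hk => _ []. Qed.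
Lemma homM x y : k (x * y) = k x * k y. Proof. by case: hk => _ []. Qed.

End HomTheory.

Lemma hom_ext (k l : A -> B) : algebra_hom k -> algebra_hom l ->
  (forall x, k (pgen R x) = l (pgen R x)) -> k =1 l.
Proof.
move=> hk hl E; elim/palg_ind=> [//|a|x y IHx IHy|x y IHx IHy].
- by rewrite (linZ (homL hk)) (linZ (homL hl)) (hom1 hk) (hom1 hl).
- by rewrite (linD (homL hk)) (linD (homL hl)) IHx IHy.
- by rewrite (homM hk) (homM hl) IHx IHy.
Qed.
End PresentedHom.

Lemma hom_id (F : fieldType) (X : Type) (R : pterm F X -> pterm F X -> Prop) :
  algebra_hom (@id (palg R)).
Proof. by []. Qed.

Lemma hom_comp (F : fieldType) (X Y Z : Type) (R : pterm F X -> pterm F X -> Prop)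
  (S : pterm F Y -> pterm F Y -> Prop) (T : pterm F Z -> pterm F Z -> Prop)
  (k : palg S -> palg T) (l : palg R -> palg S) :
  algebra_hom k -> algebra_hom l -> algebra_hom (k \o l).
Proof.
move=> hk hl; split; first exact: linear_comp (homL hk) (homL hl).
by split=> [|x y] /=; [rewrite (hom1 hl) (hom1 hk)|rewrite (homM hl) (homM hk)].
Qed.

(* [D (x y) = D x y + p x D y]: a superderivation of odd (even) parity when [p]
   is the parity automorphism (the identity). *)
Definition twder (F : fieldType) (X : Type) (R : pterm F X -> pterm F X -> Prop)
    (p D : palg R -> palg R) : Prop :=
  linear D /\ forall x y, D (x * y) = D x * y + p x * D y.

Section TwistedDerivation.
Variables (F : fieldType) (X : Type) (R : pterm F X -> pterm F X -> Prop).
Notation A := (palg R).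
Variables (p : A -> A) (hp : algebra_hom p).

Section Existence.
Variable d : X -> A.

(** The values lie in the quotient, since the twist [p] is only defined there. *)
Fixpoint twder_eval (t : pterm F X) : A :=
  match t with
  | PGen x => d x
  | PConst _ => 0
  | PAdd s t => twder_eval s + twder_eval t
  | PMul s t => twder_eval s * pclass R t + p (pclass R s) * twder_eval t
  end.

Definition twder_lift (x : A) : A := twder_eval (prepr x).

Hypothesis d_rel : forall s t, R s t -> twder_eval s = twder_eval t.

Lemma twder_eval_cong s t : pcong R s t -> twder_eval s = twder_eval t.
Proof.
have p1 : p 1 = 1 := hom1 hp.
have pZ a x : p (a *: x) = a *: p x := linZ (homL hp) a x.
have pM x y : p (x * y) = p x * p y := homM hp x y.
elim=> //=.
- by move=> > _ -> _ ->.
- by move=> > _ -> _ ->.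
- by move=> > /pclassP-> -> /pclassP-> ->.
- by move=> *; rewrite addr0.
- by move=> *; rewrite mul0r mulr0 addr0.
- by move=> a t0; rewrite mul0r mulr0 add0r addr0 !pclass_const pZ p1 scalarl scalarr.
- by move=> *; rewrite addrA.
- by move=> *; rewrite addrC.
- by move=> *; rewrite add0r.
- by move=> *; rewrite !pclassM pM !mulrDl mulrDr !mulrA addrA.
- by move=> t0; rewrite mul0r add0r pclass_const scale1r p1 mul1r.
- by move=> t0; rewrite mul0r add0r pclass_const pZ scale0r mul0r.
- by move=> *; rewrite !pclassD (linD (homL hp)) !mulrDl addrACA.
- by move=> *; rewrite !pclassD !mulrDr addrACA.
Qed.

Lemma twder_lift_class t : twder_lift (pclass R t) = twder_eval t.
Proof. exact/twder_eval_cong/prepr_pclass. Qed.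

Lemma twder_lift_gen x : twder_lift (pgen R x) = d x.
Proof. exact: twder_lift_class. Qed.

Lemma twder_liftP : twder p twder_lift.
Proof.
split=> [a|]; elim/pclassW=> s; elim/pclassW=> t.
  rewrite -scalarl -pclass_const -pclassM -pclassD !twder_lift_class /=.
  by rewrite mul0r add0r pclass_const (linZ (homL hp)) (hom1 hp) scalarl.
by rewrite -pclassM !twder_lift_class.
Qed.
End Existence.

Section Theory.
Variables (D : A -> A) (hD : twder p D).

Lemma twderL : linear D. Proof. by case: hD. Qed.
Lemma twderM x y : D (x * y) = D x * y + p x * D y. Proof. by case: hD. Qed.
Lemma twder1 : D 1 = 0.
Proof.
have /eqP := twderM 1 1; rewrite (hom1 hp) !mul1r mulr1.
by rewrite addrC -subr_eq subrr eq_sym => /eqP.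
Qed.
End Theory.

(** Reduces identities between derivations, such as Cartan's formula on the Weil algebra, to
    generators. *)
Lemma twder_ext (D E : A -> A) : twder p D -> twder p E ->
  (forall x, D (pgen R x) = E (pgen R x)) -> D =1 E.
Proof.
move=> hD hE DE; elim/palg_ind=> [//|a|x y IHx IHy|x y IHx IHy].
- by rewrite (linZ (twderL hD)) (linZ (twderL hE)) (twder1 hD) (twder1 hE).
- by rewrite (linD (twderL hD)) (linD (twderL hE)) IHx IHy.
- by rewrite (twderM hD) (twderM hE) IHx IHy.
Qed.

Lemma twderD (D E : A -> A) : twder p D -> twder p E -> twder p (fun x => D x + E x).
Proof.
move=> hD hE; split=> [a x y|x y].
  by rewrite (twderL hD) (twderL hE) scalerDr addrACA.
by rewrite (twderM hD) (twderM hE) mulrDl mulrDr addrACA.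
Qed.

Lemma twder0 : twder p (fun=> 0).
Proof. by split=> [a x y|x y]; rewrite ?scaler0 ?mul0r ?mulr0 addr0. Qed.

Lemma twderZ a (D : A -> A) : twder p D -> twder p (fun x => a *: D x).
Proof.
move=> hD; split=> [b x y|x y].
  by rewrite (twderL hD) scalerDr !scalerA mulrC.
by rewrite (twderM hD) scalerDr palg_scaleAl palg_scaleAr.
Qed.

Lemma twder_sum (I : Type) (r : seq I) (D : I -> A -> A) :
  (forall i, twder p (D i)) -> twder p (fun x => \sum_(i <- r) D i x).
Proof.
move=> hD; elim: r => [|i r IH].
  have : twder p (fun=> 0) := twder0.
  by congr (twder p _); apply/funext=> x; rewrite big_nil.
have := twderD (hD i) IH.
by congr (twder p _); apply/funext=> x; rewrite big_cons.
Qed.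

End TwistedDerivation.

Lemma inner_twder (F : fieldType) (X : Type) (R : pterm F X -> pterm F X -> Prop)
  (z : palg R) : twder id (fun x => z * x - x * z).
Proof.
split=> [a x y|x y].
  by rewrite mulrDl mulrDr -palg_scaleAr -palg_scaleAl scalerBr; abel.
by rewrite mulrBl mulrBr !mulrA; abel.
Qed.


Section Commutators.
Variables (F : fieldType) (X : Type) (R : pterm F X -> pterm F X -> Prop).
Notation A := (palg R).
Variables (p : A -> A) (hp : algebra_hom p) (pK : involutive p).

(** The cross terms of the two Leibniz rules carry opposite signs, because both maps anticommute
    with [p]; the twists that remain are squares of [p], so the result is an untwisted
    derivation. *)
Lemma twder_anticomm (D E : A -> A) : twder p D -> twder p E ->
  (forall x, D (p x) = - p (D x)) -> (forall x, E (p x) = - p (E x)) ->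
  twder id (fun x => D (E x) + E (D x)).
Proof.
move=> hD hE Dp Ep; split=> [a x y|x y].
  by rewrite !(twderL hD, twderL hE) scalerDr addrACA.
rewrite (twderM hE) (twderM hD) !(linD (twderL hD)) !(linD (twderL hE)).
by rewrite !(twderM hE, twderM hD) Dp Ep !pK !mulNr mulrDl mulrDr; abel.
Qed.

Lemma twder_comm (q D E : A -> A) : twder id D -> twder q E ->
  (forall x, D (q x) = q (D x)) -> twder q (fun x => D (E x) - E (D x)).
Proof.
move=> hD hE Dq; split=> [a x y|x y].
  by rewrite !(twderL hD, twderL hE) scalerBr; abel.
rewrite (twderM hE) (twderM hD) !(linD (twderL hD)) !(linD (twderL hE)).
by rewrite !(twderM hE, twderM hD) Dq mulrBl mulrBr; abel.
Qed.

Lemma twder_id_comm_hom (q D : A -> A) : algebra_hom q -> twder id D ->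
  (forall x, D (q (pgen R x)) = q (D (pgen R x))) -> forall x, D (q x) = q (D x).
Proof.
move=> hq hD Dq; elim/palg_ind=> [//|a|x y IHx IHy|x y IHx IHy].
- rewrite (linZ (homL hq)) (hom1 hq) !(linZ (twderL hD)) (twder1 (hom_id R) hD).
  by rewrite scaler0 (lin0 (homL hq)).
- by rewrite !(linD (homL hq), linD (twderL hD)) IHx IHy.
- by rewrite (homM hq) !(twderM hD) (linD (homL hq)) !(homM hq) IHx IHy.
Qed.

Lemma twder_anticomm_id (D : A -> A) : twder p D ->
  (forall x, D (p (pgen R x)) = - p (D (pgen R x))) -> forall x, D (p x) = - p (D x).
Proof.
move=> hD Dp; elim/palg_ind=> [//|a|x y IHx IHy|x y IHx IHy].
- by rewrite (linZ (homL hp)) (hom1 hp) !(linZ (twderL hD)) (twder1 hp hD) scaler0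
     (lin0 (homL hp)) oppr0.
- by rewrite !(linD (homL hp), linD (twderL hD)) IHx IHy opprD.
- rewrite (homM hp) !(twderM hD) (linD (homL hp)) !(homM hp) IHx IHy !pK.
  by rewrite mulNr mulrN; abel.
Qed.
End Commutators.

(* An action of a presented algebra on the subspace [C] of [M]; the operators
   [h x] need not satisfy the relations outside of [C]. *)
Section Action.
Variables (F : fieldType) (X : Type) (R : pterm F X -> pterm F X -> Prop).
Variables (M : lmodType F) (C : M -> Prop) (h : X -> M -> M).

Fixpoint aeval (t : pterm F X) (m : M) : M :=
  match t with
  | PGen x => h x m
  | PConst a => a *: m
  | PAdd s t => aeval s m + aeval t m
  | PMul s t => aeval s (aeval t m)
  end.

Definition pact (x : palg R) (m : M) : M := aeval (prepr x) m.

Hypothesis h_linear : forall x, linear (h x).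
Hypothesis C_linear : forall a m n, C m -> C n -> C (a *: m + n).
Hypothesis C_stable : forall x m, C m -> C (h x m).
Hypothesis h_rel : forall s t m, R s t -> C m -> aeval s m = aeval t m.

Lemma aeval_linear t : linear (aeval t).
Proof.
elim: t => [x|b|s IHs t IHt|s IHs t IHt] a m n /=.
- exact: h_linear.
- by rewrite scalerDr !scalerA mulrC.
- by rewrite IHs IHt scalerDr addrACA.
- by rewrite IHt IHs.
Qed.

Lemma aeval_stable t m : C m -> C (aeval t m).
Proof.
elim: t m => [x|b|s IHs t IHt|s IHs t IHt] m Cm /=.
- exact: C_stable.
(* Closure of [C] is only given for [a *: m + n], so [b *: m] is written as [(b - 1) *: m + m]. *)
- have := C_linear (b - 1) Cm Cm.
  by rewrite scalerBl scale1r subrK.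
- by rewrite -[aeval s m]scale1r; apply: C_linear; [apply: IHs|apply: IHt].
- exact/IHs/IHt.
Qed.

Lemma aeval_cong s t m : pcong R s t -> C m -> aeval s m = aeval t m.
Proof.
move=> st; elim: st m => {s t} /=.
- by move=> s t Rst m /(h_rel Rst).
- by [].
- by move=> s t _ IH m /IH.
- by move=> s t u _ IH1 _ IH2 m Cm; rewrite IH1 ?IH2.
- by move=> s s' t t' _ IH1 _ IH2 m Cm; rewrite IH1 ?IH2.
- by move=> s s' t t' _ IH1 _ IH2 m Cm; rewrite IH2 // IH1 //; apply: aeval_stable.
- by move=> *; rewrite scalerDl.
- by move=> *; rewrite scalerA.
- by move=> a t m _; rewrite (linZ (aeval_linear t)).
- by move=> *; rewrite addrA.
- by move=> *; rewrite addrC.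
- by move=> *; rewrite scale0r add0r.
- by [].
- by move=> *; rewrite scale1r.
- by move=> *; rewrite !scale0r.
- by [].
- by move=> s t u m Cm; rewrite (linD (aeval_linear u)).
Qed.

Lemma pact_class t m : C m -> pact (pclass R t) m = aeval t m.
Proof. exact/aeval_cong/prepr_pclass. Qed.

Lemma pact_stable x m : C m -> C (pact x m).
Proof. exact: aeval_stable. Qed.

Lemma pact_gen x m : C m -> pact (pgen R x) m = h x m.
Proof. exact: pact_class. Qed.

Lemma pactM x y m : C m -> pact (x * y) m = pact x (pact y m).
Proof.
move=> Cm; elim/pclassW: x => s; elim/pclassW: y => t.
rewrite -pclassM [LHS]pact_class // [in RHS]pact_class; last exact: pact_stable.
by rewrite [in RHS]pact_class.
Qed.

Lemma pact_linearl m : C m -> linear (pact^~ m).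
Proof.
move=> Cm a; elim/pclassW=> s; elim/pclassW=> t.
by rewrite -scalarl -pclass_const -pclassM -pclassD !pact_class.
Qed.

Lemma pact1 m : C m -> pact 1 m = m.
Proof. by move=> Cm; rewrite -[1]/(pclass R (PConst 1)) pact_class //= scale1r. Qed.
End Action.

(* The bound on weights is strict, so that [wfil wt 0] only contains [0]. *)
Section WeightFiltration.
Variables (F : fieldType) (X : Type) (R : pterm F X -> pterm F X -> Prop).
Variable wt : X -> nat.
Notation A := (palg R).

Definition word (s : seq X) : A := \prod_(x <- s) pgen R x.
Definition wsize (s : seq X) : nat := \sum_(x <- s) wt x.

Lemma word_nil : word [::] = 1.
Proof. by rewrite /word big_nil. Qed.
Lemma word_cons x s : word (x :: s) = pgen R x * word s.
Proof. by rewrite /word big_cons. Qed.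
Lemma word_cat s t : word (s ++ t) = word s * word t.
Proof. by rewrite /word big_cat. Qed.
Lemma wsize_cons x s : wsize (x :: s) = (wt x + wsize s)%N.
Proof. by rewrite /wsize big_cons. Qed.
Lemma wsize_cat s t : wsize (s ++ t) = (wsize s + wsize t)%N.
Proof. by rewrite /wsize big_cat. Qed.

Inductive wfil (k : nat) : A -> Prop :=
| wfil_word s : (wsize s < k)%N -> wfil k (word s)
| wfil0 : wfil k 0
| wfilD x y : wfil k x -> wfil k y -> wfil k (x + y)
| wfilZ a x : wfil k x -> wfil k (a *: x).

Lemma wfilN k x : wfil k x -> wfil k (- x).
Proof. by move=> hx; rewrite -scaleN1r; apply: wfilZ. Qed.

Lemma wfilB k x y : wfil k x -> wfil k y -> wfil k (x - y).
Proof. by move=> hx hy; apply: wfilD => //; apply: wfilN. Qed.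

Lemma wfil_sum (I : Type) (r : seq I) (P : pred I) (E : I -> A) k :
  (forall i, P i -> wfil k (E i)) -> wfil k (\sum_(i <- r | P i) E i).
Proof. by move=> hE; apply: big_ind => //; [apply: wfil0|move=> x y; apply: wfilD]. Qed.

Lemma wfil_le k l x : (k <= l)%N -> wfil k x -> wfil l x.
Proof.
move=> kl; elim=> [s sk||y z _ IHy _ IHz|a y _ IH].
- by apply: wfil_word; apply: leq_trans kl.
- exact: wfil0.
- exact: wfilD.
- exact: wfilZ.
Qed.

Lemma wfil0_eq0 x : wfil 0 x -> x = 0.
Proof.
elim=> [s|//|y z _ -> _ ->|a y _ ->]; rewrite ?ltn0 ?addr0 ?scaler0 //.
Qed.

(** Weights at most [k] and below [l] add up to a weight below [k + l]: only one of the two strict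
    bounds is relaxed. *)
Lemma wfilM k l x y : wfil k.+1 x -> wfil l y -> wfil (k + l) (x * y).
Proof.
move=> hx hy; elim: hx => [s sk||x1 x2 _ IH1 _ IH2|a x1 _ IH].
- elim: hy => [t tl||y1 y2 _ IH1 _ IH2|a y1 _ IH].
  + by rewrite -word_cat; apply: wfil_word; rewrite wsize_cat -addnS leq_add.
  + by rewrite mulr0; apply: wfil0.
  + by rewrite mulrDr; apply: wfilD.
  + by rewrite -palg_scaleAr; apply: wfilZ.
- by rewrite mul0r; apply: wfil0.
- by rewrite mulrDl; apply: wfilD.
- by rewrite -palg_scaleAl; apply: wfilZ.
Qed.

Lemma wfilMr k l x y : wfil k x -> wfil l.+1 y -> wfil (k + l) (x * y).
Proof.
case: k => [/wfil0_eq0-> _|k hx hy]; first by rewrite mul0r; apply: wfil0.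
by rewrite addSnnS; apply: wfilM.
Qed.

Lemma wfil_gen x : wfil (wt x).+1 (pgen R x).
Proof.
have -> : pgen R x = word [:: x] by rewrite /word big_seq1.
by apply: wfil_word; rewrite /wsize big_seq1.
Qed.

Lemma wfil1 k : wfil k.+1 1.
Proof.
have -> : 1 = word [::] by rewrite /word big_nil.
by apply: wfil_word; rewrite /wsize big_nil.
Qed.

Lemma wfil_exhaustive x : exists k, wfil k x.
Proof.
elim/palg_ind: x => [x|a|x y [k hx] [l hy]|x y [k hx] [l hy]].
- by exists (wt x).+1; apply: wfil_gen.
- by exists 1%N; apply/wfilZ/wfil1.
- exists (k + l)%N; apply: wfilD.
    by apply: wfil_le hx; rewrite leq_addr.
  by apply: wfil_le hy; rewrite leq_addl.
- by exists (k + l)%N; apply: wfilM => //; apply: wfil_le hx.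
Qed.

Lemma wfil_lin (V : lmodType F) (P : V -> Prop) (f : A -> V) k :
  linear f -> P 0 -> (forall u v, P u -> P v -> P (u + v)) ->
  (forall a v, P v -> P (a *: v)) ->
  (forall s, (wsize s < k)%N -> P (f (word s))) -> forall x, wfil k x -> P (f x).
Proof.
move=> lf P0 PD PZ Pw x; elim=> [s /Pw//||y z _ IHy _ IHz|a y _ IH].
- by rewrite (lin0 lf).
- by rewrite (linD lf); apply: PD.
- by rewrite (linZ lf); apply: PZ.
Qed.
End WeightFiltration.
Arguments word {F X} R s.

Section WeightFiltrationMaps.
Variables (F : fieldType) (X : Type) (R : pterm F X -> pterm F X -> Prop).
Variable wt : X -> nat.

(** Each Leibniz term differentiates one letter, whose weight strictly drops, while [p] does not
    raise the weight of the letters it passes. *)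
Lemma wfil_twder (p D : palg R -> palg R) : algebra_hom p -> twder p D ->
  (forall x, wfil wt (wt x).+1 (p (pgen R x))) ->
  (forall x, wfil wt (wt x) (D (pgen R x))) ->
  forall n x, wfil wt n.+1 x -> wfil wt n (D x).
Proof.
move=> hp hD pgen Dgen n; apply: wfil_lin; [exact: twderL hD|exact: wfil0|..].
- by move=> *; apply: wfilD.
- by move=> *; apply: wfilZ.
move=> s sn; have : wfil wt (wsize wt s) (D (word R s)); last exact: wfil_le.
elim: s {sn} => [|x s IH].
  by rewrite /word big_nil (twder1 hp hD); apply: wfil0.
rewrite word_cons wsize_cons (twderM hD); apply: wfilD; last exact: wfilM.
by apply: wfilMr => //; apply: wfil_word.
Qed.
End WeightFiltrationMaps.

(** * The Weil algebras *)

Lemma twder_evalB (F : fieldType) (X : Type) (R : pterm F X -> pterm F X -> Prop)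
    (p : palg R -> palg R) (d : X -> palg R) s t : algebra_hom p ->
  twder_eval p d (s - t)%P = twder_eval p d s - twder_eval p d t.
Proof.
move=> hp /=; rewrite mul0r add0r pclass_const (linZ (homL hp)) (hom1 hp).
by rewrite scalarl scaleN1r.
Qed.

Lemma pevalB (F : fieldType) (X Y : Type) (S : pterm F Y -> pterm F Y -> Prop)
    (h : X -> palg S) s t :
  peval (@pconst F Y S) h (s - t)%P
    = peval (@pconst F Y S) h s - peval (@pconst F Y S) h t.
Proof. by rewrite /= pconstE scalarl scaleN1r. Qed.

Definition weil_case (V : Type) (T : Type) (o e : V -> T) (w : weil_gen V) : T :=
  match w with WOdd x => o x | WEven x => e x end.

Section WeilAlgebra.
Variables (F : fieldType) (V : vectType F).
Notation W := (weilAlg V).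

Definition wo (x : V) : W := weilGen (WOdd x).
Definition we (x : V) : W := weilGen (WEven x).

Lemma wo_linear : linear wo.
Proof.
move=> a x y; rewrite /wo; apply: etrans; first exact/palg_rel/WeilOddLinear.
by rewrite pclassD pclassM pclass_const scalarl.
Qed.

Lemma we_linear : linear we.
Proof.
move=> a x y; rewrite /we; apply: etrans; first exact/palg_rel/WeilEvenLinear.
by rewrite pclassD pclassM pclass_const scalarl.
Qed.

Lemma we_we x y : we x * we y = we y * we x.
Proof.
apply/eqP; rewrite -subr_eq0 -!pclassM -pclassB; apply/eqP.
exact/palg_rel/WeilEvenEven.
Qed.

Lemma we_wo x y : we x * wo y = wo y * we x.
Proof.
apply/eqP; rewrite -subr_eq0 -!pclassM -pclassB; apply/eqP.
exact/palg_rel/WeilEvenOdd.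
Qed.

Lemma wo_wo x y : wo x * wo y = - (wo y * wo x).
Proof.
apply/eqP; rewrite -addr_eq0 -!pclassM -pclassD; apply/eqP.
exact/palg_rel/WeilOddOdd.
Qed.

Section Hom.
Variables (Y : Type) (S : pterm F Y -> pterm F Y -> Prop) (o e : V -> palg S).
Hypotheses (lo : linear o) (le : linear e).
Hypotheses (ee : forall x y, e x * e y = e y * e x)
  (eo : forall x y, e x * o y = o y * e x)
  (oo : forall x y, o x * o y = - (o y * o x)).

Definition weil_hom : W -> palg S := phom (weil_case o e).

Lemma weil_hom_rel s t : weil_rel s t ->
  peval (@pconst F Y S) (weil_case o e) s = peval (@pconst F Y S) (weil_case o e) t.
Proof.
have c0 : pconst S 0 = 0 by rewrite pconstE scale0r.
case=> [a x y|a x y|x y|x y|x y]; rewrite ?pevalB /= ?c0.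
- by rewrite pconstE scalarl lo.
- by rewrite pconstE scalarl le.
- by rewrite ee subrr.
- by rewrite eo subrr.
- by rewrite oo addNr.
Qed.

Lemma weil_hom_algebra : algebra_hom weil_hom.
Proof. exact/phom_hom/weil_hom_rel. Qed.
Lemma weil_hom_wo x : weil_hom (wo x) = o x.
Proof. exact/phom_gen/weil_hom_rel. Qed.
Lemma weil_hom_we x : weil_hom (we x) = e x.
Proof. exact/phom_gen/weil_hom_rel. Qed.
End Hom.

Definition wpar : W -> W := weil_hom (fun x => - wo x) we.

Lemma oppwo_linear : linear (fun x => - wo x).
Proof. by move=> a x y; rewrite wo_linear opprD scalerN. Qed.

Let par_eo x y : we x * - wo y = - wo y * we x.
Proof. by rewrite mulrN we_wo mulNr. Qed.
Let par_oo x y : - wo x * - wo y = - (- wo y * - wo x).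
Proof. by rewrite !mulrNN wo_wo. Qed.

Lemma wpar_hom : algebra_hom wpar.
Proof. exact: (weil_hom_algebra oppwo_linear we_linear we_we par_eo par_oo). Qed.
Lemma wpar_wo x : wpar (wo x) = - wo x.
Proof. exact: (weil_hom_wo oppwo_linear we_linear we_we par_eo par_oo). Qed.
Lemma wpar_we x : wpar (we x) = we x.
Proof. exact: (weil_hom_we oppwo_linear we_linear we_we par_eo par_oo). Qed.

Lemma wparK : involutive wpar.
Proof.
apply: (@hom_ext _ _ _ _ _ (wpar \o wpar) id).
- exact: hom_comp wpar_hom wpar_hom.
- exact: hom_id.
case=> x /=; last by rewrite -/(we x) !wpar_we.
by rewrite -/(wo x) wpar_wo (linN (homL wpar_hom)) wpar_wo opprK.
Qed.

Section OddDerivation.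
Variables (b : {scalar V}) (k a : {linear V -> V}).

Let oval : weil_gen V -> W :=
  weil_case (fun x => b x *: (1 : W) + we (k x)) (fun x => wo (a x)).

(** The differential, the contractions, the partial derivatives in odd variables and the
    transgression are all of this form, for different [b], [k] and [a]. The even counterpart [weven]
    covers Lie derivatives, even partial derivatives and number operators. *)
Definition wodd : W -> W :=
  twder_lift wpar oval.

Lemma wodd_rel s t : weil_rel s t ->
  twder_eval wpar oval s
  = twder_eval wpar oval t.
Proof.
have hp := wpar_hom.
case=> [c x y|c x y|x y|x y|x y]; rewrite ?twder_evalB //=;
  rewrite ?mul0r ?add0r ?pclass_const ?(linZ (homL hp)) ?(hom1 hp) ?scalarl;
  rewrite -/(wo _) -/(we _) -?[pclass _ (PGen (WEven _))]/(we _)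
          -?[pclass _ (PGen (WOdd _))]/(wo _) ?wpar_we ?wpar_wo.
- rewrite (linearP b) (linearP k) /= (linP we_linear) scalerDl scalerDr -scalerA.
  by abel.
- by rewrite (linearP a) (linP wo_linear).
- by rewrite we_wo [we y * _]we_wo; abel.
- rewrite mulrDl mulrDr scalarl scalarr mulNr wo_wo we_we; abel.
- rewrite !mulrDl !mulrDr !mulNr !scalarl !scalarr ![we _ * wo _]we_wo; abel.
Qed.

Lemma wodd_twder : twder wpar wodd.
Proof. exact/(twder_liftP wpar_hom)/wodd_rel. Qed.
Lemma wodd_wo x : wodd (wo x) = b x *: (1 : W) + we (k x).
Proof. exact/(twder_lift_gen wpar_hom)/wodd_rel. Qed.
Lemma wodd_we x : wodd (we x) = wo (a x).
Proof. exact/(twder_lift_gen wpar_hom)/wodd_rel. Qed.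

Lemma wodd_par x : wodd (wpar x) = - wpar (wodd x).
Proof.
move: x; apply: (twder_anticomm_id wpar_hom wparK wodd_twder).
have hp := wpar_hom.
case=> x; rewrite -/(wo _) -/(we _).
  rewrite wpar_wo (linN (twderL wodd_twder)) wodd_wo (linD (homL hp)).
  by rewrite (linZ (homL hp)) (hom1 hp) wpar_we.
by rewrite wpar_we wodd_we wpar_wo opprK.
Qed.
End OddDerivation.

Section EvenDerivation.
Variables (b : {scalar V}) (k a : {linear V -> V}).

Let eval : weil_gen V -> W :=
  weil_case (fun x => wo (k x)) (fun x => b x *: (1 : W) + we (a x)).

Definition weven : W -> W :=
  twder_lift id eval.

Lemma weven_rel s t : weil_rel s t ->
  twder_eval id eval s
  = twder_eval id eval t.
Proof.
case=> [c x y|c x y|x y|x y|x y]; rewrite ?twder_evalB //=;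
  rewrite ?mul0r ?add0r ?pclass_const ?scalarl;
  rewrite -/(wo _) -/(we _) -?[pclass _ (PGen (WEven _))]/(we _)
          -?[pclass _ (PGen (WOdd _))]/(wo _).
- by rewrite (linearP k) (linP wo_linear).
- rewrite (linearP b) (linearP a) /= (linP we_linear) scalerDl scalerDr -scalerA.
  by abel.
- rewrite !mulrDl !mulrDr !scalarl !scalarr [we y * we (a x)]we_we.
  by rewrite [we x * we (a y)]we_we; abel.
- by rewrite !mulrDl !mulrDr !scalarl !scalarr ![we _ * wo _]we_wo; abel.
- by rewrite [wo y * wo (k x)]wo_wo [wo (k y) * _]wo_wo; abel.
Qed.

Lemma weven_twder : twder id weven.
Proof. exact/(twder_liftP (hom_id _))/weven_rel. Qed.
Lemma weven_wo x : weven (wo x) = wo (k x).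
Proof. exact/(twder_lift_gen (hom_id _))/weven_rel. Qed.
Lemma weven_we x : weven (we x) = b x *: (1 : W) + we (a x).
Proof. exact/(twder_lift_gen (hom_id _))/weven_rel. Qed.

Lemma weven_par x : weven (wpar x) = wpar (weven x).
Proof.
move: x; apply: (twder_id_comm_hom wpar_hom weven_twder).
have hp := wpar_hom.
case=> x; rewrite -/(wo _) -/(we _).
  by rewrite wpar_wo (linN (twderL weven_twder)) !weven_wo wpar_wo.
rewrite wpar_we weven_we (linD (homL hp)).
by rewrite (linZ (homL hp)) (hom1 hp) wpar_we.
Qed.
End EvenDerivation.

(** Supercommutators of such derivations have the same shape, so commutation relations reduce to
    identities between linear maps on [V]. *)
Lemma wodd_wodd (b1 b2 b : {scalar V}) (k1 a1 k2 a2 k a : {linear V -> V}) :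
  (forall x, k x = a1 (k2 x) + a2 (k1 x)) ->
  (forall x, b x = b1 (a2 x) + b2 (a1 x)) ->
  (forall x, a x = k1 (a2 x) + k2 (a1 x)) ->
  forall u, wodd b1 k1 a1 (wodd b2 k2 a2 u) + wodd b2 k2 a2 (wodd b1 k1 a1 u)
    = weven b k a u.
Proof.
move=> Ek Eb Ea.
have D1 := wodd_twder b1 k1 a1; have D2 := wodd_twder b2 k2 a2.
apply: (twder_ext (hom_id _)).
- by apply: (twder_anticomm wparK D1 D2); apply: wodd_par.
- exact: weven_twder.
case=> x; rewrite -/(wo _) -/(we _).
  rewrite !wodd_wo !(linD (twderL D1)) !(linD (twderL D2)) (linZ (twderL D1)).
  rewrite (linZ (twderL D2)) (twder1 wpar_hom D1) (twder1 wpar_hom D2) !scaler0 !add0r.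
  by rewrite !wodd_we weven_wo Ek (linD wo_linear).
rewrite !wodd_we !wodd_wo weven_we Eb Ea scalerDl (linD we_linear); abel.
Qed.

Lemma weven_wodd (b1 b2 b : {scalar V}) (k1 a1 k2 a2 k a : {linear V -> V}) :
  (forall x, k x = a1 (k2 x) - k2 (k1 x)) ->
  (forall x, b x = b1 (k2 x) - b2 (k1 x)) ->
  (forall x, a x = k1 (a2 x) - a2 (a1 x)) ->
  forall u, weven b1 k1 a1 (wodd b2 k2 a2 u) - wodd b2 k2 a2 (weven b1 k1 a1 u)
    = wodd b k a u.
Proof.
move=> Ek Eb Ea.
have D1 := weven_twder b1 k1 a1; have D2 := wodd_twder b2 k2 a2.
apply: (twder_ext wpar_hom).
- by apply: (twder_comm D1 D2); apply: weven_par.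
- exact: wodd_twder.
case=> x; rewrite -/(wo _) -/(we _).
  rewrite !wodd_wo !weven_wo (linD (twderL D1)) (linZ (twderL D1)) (twder1 (hom_id _) D1).
  rewrite weven_we wodd_wo Ek Eb scalerBl (linB we_linear) scaler0; abel.
rewrite weven_we (linD (twderL D2)) (linZ (twderL D2)) (twder1 wpar_hom D2) !wodd_we.
by rewrite weven_wo Ea (linB wo_linear) scaler0; abel.
Qed.

Lemma weven_eq0 u : weven \0 \0 \0 u = 0.
Proof.
move: u; apply: (twder_ext (hom_id _)); [exact: weven_twder|exact: twder0|].
case=> x; rewrite -/(wo _) -/(we _) ?weven_wo ?weven_we.
  exact: (lin0 wo_linear).
by rewrite scale0r add0r; exact: (lin0 we_linear).
Qed.

Lemma wodd_eq0 u : wodd \0 \0 \0 u = 0.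
Proof.
move: u; apply: (twder_ext wpar_hom); [exact: wodd_twder|exact: (twder0 wpar)|].
case=> x; rewrite -/(wo _) -/(we _) ?wodd_wo ?wodd_we.
  by rewrite scale0r add0r; exact: (lin0 we_linear).
exact: (lin0 wo_linear).
Qed.

Lemma wodd_add (b1 b2 b : {scalar V}) (k1 a1 k2 a2 k a : {linear V -> V}) :
  (forall x, b x = b1 x + b2 x) -> (forall x, k x = k1 x + k2 x) ->
  (forall x, a x = a1 x + a2 x) ->
  forall u, wodd b k a u = wodd b1 k1 a1 u + wodd b2 k2 a2 u.
Proof.
move=> Eb Ek Ea; apply: (twder_ext wpar_hom); first exact: wodd_twder.
  by apply: twderD; apply: wodd_twder.
case=> x; rewrite -/(wo _) -/(we _).
  by rewrite !wodd_wo Eb Ek scalerDl (linD we_linear); abel.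
by rewrite !wodd_we Ea (linD wo_linear).
Qed.

Definition wd : W -> W := wodd \0 idfun \0.

Lemma wd_wo x : wd (wo x) = we x.
Proof. by rewrite /wd wodd_wo scale0r add0r. Qed.
Lemma wd_we x : wd (we x) = 0.
Proof. by rewrite /wd wodd_we (lin0 wo_linear). Qed.
Lemma wd_twder : twder wpar wd. Proof. exact: wodd_twder. Qed.
Lemma wd_par x : wd (wpar x) = - wpar (wd x). Proof. exact: wodd_par. Qed.

End WeilAlgebra.

(** * Quadratic Lie algebras and dual bases *)

Section QuadraticLie.
Variables (F : fieldType) (g : quadLieAlgType F).

Lemma quad_sym (x y : g) : quad_form x y = quad_form y x.
Proof. by rewrite hermC /= expr0 mul1r. Qed.

Lemma quadPl (y : g) a x z : quad_form (a *: x + z) y = a * quad_form x y + quad_form z y.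
Proof. exact: (linearPl (@quad_form F g)). Qed.

Lemma quadPr (y : g) a x z : quad_form y (a *: x + z) = a * quad_form y x + quad_form y z.
Proof. exact: (linearPr (@quad_form F g)). Qed.

Lemma quad_linearl y : linear (fun x : g => quad_form x y : F^o).
Proof. by move=> a x z; rewrite quadPl. Qed.

Lemma quad_linearr x : linear (fun y : g => quad_form x y : F^o).
Proof. by move=> a y z; rewrite quadPr. Qed.

Lemma quad_invl (x y z : g) :
  quad_form (lie_bracket x y) z = - quad_form y (lie_bracket x z).
Proof.
rewrite (lie_antisym x y); apply: etrans; first exact: linearNl.
exact/congr1/quad_invariant.
Qed.

Lemma quad_nondeg (x : g) : (forall y, quad_form x y = 0) -> x = 0.
Proof.
move=> x0; have /eqP rad0 := @quad_nondegenerate F g.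
apply/eqP; rewrite -memv0 -rad0; apply/mem_orthovP => y _.
exact: x0.
Qed.

Section DualBases.
Variables e f : (\dim {:g}).-tuple g.
Hypothesis ef : dual_bases e f.

Lemma dual_expandl z : z = \sum_a quad_form z (tnth f a) *: tnth e a.
Proof.
have [be efd] := ef; have ze : z \in <<e>>%VS by rewrite (span_basis be) memvf.
have qz b : quad_form z (tnth f b) = coord e b z.
  rewrite [in LHS](coord_span ze) (lin_sum (quad_linearl _)) (bigD1 b) //= big1.
    by rewrite (linZ (quad_linearl _)) -tnth_nth efd eqxx addr0 /GRing.scale /= mulr1.
  move=> a nab; rewrite (linZ (quad_linearl _)) -tnth_nth efd (negbTE nab).
  by rewrite /GRing.scale /= mulr0.
rewrite {1}(coord_span ze); apply: eq_bigr => a _.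
by rewrite qz -tnth_nth.
Qed.

(** By nondegeneracy it suffices to pair both sides with the [e]; this is how the [f] are seen to
    span. *)
Lemma dual_expandr z : z = \sum_a quad_form z (tnth e a) *: tnth f a.
Proof.
apply/eqP; rewrite -subr_eq0; apply/eqP/quad_nondeg => y.
rewrite {1}(dual_expandl y) (lin_sum (quad_linearr _)) big1 // => b _.
rewrite (linZ (quad_linearr _)) (linB (quad_linearl _)) (lin_sum (quad_linearl _)).
rewrite (bigD1 b) //= big1 => [|a nab].
  rewrite (linZ (quad_linearl _)) [quad_form (tnth f b) _]quad_sym ef.2 eqxx addr0.
  by rewrite /GRing.scale /= mulr1 subrr mulr0.
rewrite (linZ (quad_linearl _)) [quad_form (tnth f a) _]quad_sym ef.2.
by rewrite eq_sym (negbTE nab) /GRing.scale /= mulr0.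
Qed.

(** Invariance of the canonical element $\sum_a e_a\otimes e^a$, seen through a bilinear map [b]. *)
Lemma dual_slide (M : lmodType F) (b : g -> g -> M) z :
  (forall x, linear (b x)) -> (forall y, linear (b^~ y)) ->
  \sum_a b (lie_bracket z (tnth e a)) (tnth f a)
    = - \sum_a b (tnth e a) (lie_bracket z (tnth f a)).
Proof.
move=> lr ll.
transitivity (\sum_a \sum_c quad_form (lie_bracket z (tnth e a)) (tnth f c)
    *: b (tnth e c) (tnth f a)).
  apply: eq_bigr => a _; rewrite {1}(dual_expandl (lie_bracket z (tnth e a))).
  rewrite (lin_sum (ll _)); apply: eq_bigr => c _; exact: (linZ (ll _)).
rewrite exchange_big -sumrN; apply: eq_bigr => c _ /=.
rewrite [lie_bracket z (tnth f c)]dual_expandr (lin_sum (lr _)) -sumrN.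
apply: eq_bigr => a _; rewrite (linZ (lr _)) -scaleNr; congr (_ *: _).
by apply: etrans (quad_invl _ _ _) _; rewrite quad_sym.
Qed.
End DualBases.
End QuadraticLie.

(** * The noncommutative Weil algebra and its Cartan calculus *)

Section NCWeilAlgebra.
Variables (F : fieldType) (g : quadLieAlgType F).
Notation NW := (ncWeilAlg g).

Definition nco (x : g) : NW := ncWeilGen (WOdd x).
Definition nce (x : g) : NW := ncWeilGen (WEven x).

Lemma nco_linear : linear nco.
Proof.
move=> a x y; rewrite /nco; apply: etrans; first exact/palg_rel/NcWeilOddLinear.
by rewrite pclassD pclassM pclass_const scalarl.
Qed.

Lemma nce_linear : linear nce.
Proof.
move=> a x y; rewrite /nce; apply: etrans; first exact/palg_rel/NcWeilEvenLinear.
by rewrite pclassD pclassM pclass_const scalarl.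
Qed.

Lemma nce_nce x y : nce x * nce y = nce y * nce x + nce (lie_bracket x y).
Proof.
apply/eqP; rewrite addrC -subr_eq -!pclassM -pclassB; apply/eqP.
exact/palg_rel/NcWeilEvenEven.
Qed.

Lemma nce_nco x y : nce x * nco y = nco y * nce x + nco (lie_bracket x y).
Proof.
apply/eqP; rewrite addrC -subr_eq -!pclassM -pclassB; apply/eqP.
exact/palg_rel/NcWeilEvenOdd.
Qed.

Lemma nco_nco x y : nco x * nco y = quad_form x y *: (1 : NW) - nco y * nco x.
Proof.
apply/eqP; rewrite eq_sym subr_eq eq_sym -!pclassM -pclassD -pclass_const; apply/eqP.
exact/palg_rel/NcWeilOddOdd.
Qed.

Section Hom.
Variables (Y : Type) (S : pterm F Y -> pterm F Y -> Prop) (o e : g -> palg S).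
Hypotheses (lo : linear o) (le : linear e).
Hypotheses (ee : forall x y, e x * e y = e y * e x + e (lie_bracket x y))
  (eo : forall x y, e x * o y = o y * e x + o (lie_bracket x y))
  (oo : forall x y, o x * o y = quad_form x y *: (1 : palg S) - o y * o x).

Definition ncweil_hom : NW -> palg S := phom (weil_case o e).

Lemma ncweil_hom_rel s t : ncweil_rel s t ->
  peval (@pconst F Y S) (weil_case o e) s = peval (@pconst F Y S) (weil_case o e) t.
Proof.
case=> [a x y|a x y|x y|x y|x y]; rewrite ?pevalB /=.
- by rewrite pconstE scalarl lo.
- by rewrite pconstE scalarl le.
- by rewrite ee addrC addKr.
- by rewrite eo addrC addKr.
- by rewrite oo subrK pconstE.
Qed.

Lemma ncweil_hom_algebra : algebra_hom ncweil_hom.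
Proof. exact/phom_hom/ncweil_hom_rel. Qed.
Lemma ncweil_hom_nco x : ncweil_hom (nco x) = o x.
Proof. exact/phom_gen/ncweil_hom_rel. Qed.
Lemma ncweil_hom_nce x : ncweil_hom (nce x) = e x.
Proof. exact/phom_gen/ncweil_hom_rel. Qed.
End Hom.

Definition npar : NW -> NW := ncweil_hom (fun x => - nco x) nce.

Lemma oppnco_linear : linear (fun x => - nco x).
Proof. by move=> a x y; rewrite nco_linear opprD scalerN. Qed.

Let par_eo x y : nce x * - nco y = - nco y * nce x + - nco (lie_bracket x y).
Proof. by rewrite mulrN nce_nco opprD mulNr. Qed.
Let par_oo x y : - nco x * - nco y = quad_form x y *: (1 : NW) - (- nco y * - nco x).
Proof. by rewrite !mulrNN nco_nco. Qed.

Lemma npar_hom : algebra_hom npar.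
Proof. exact: (ncweil_hom_algebra oppnco_linear nce_linear nce_nce par_eo par_oo). Qed.
Lemma npar_nco x : npar (nco x) = - nco x.
Proof. exact: (ncweil_hom_nco oppnco_linear nce_linear nce_nce par_eo par_oo). Qed.
Lemma npar_nce x : npar (nce x) = nce x.
Proof. exact: (ncweil_hom_nce oppnco_linear nce_linear nce_nce par_eo par_oo). Qed.

Lemma nparK : involutive npar.
Proof.
apply: (@hom_ext _ _ _ _ _ (npar \o npar) id).
- exact: hom_comp npar_hom npar_hom.
- exact: hom_id.
case=> x /=; last by rewrite -/(nce x) !npar_nce.
by rewrite -/(nco x) npar_nco (linN (homL npar_hom)) npar_nco opprK.
Qed.

Definition nd_val : weil_gen g -> NW := weil_case nce (fun=> 0).
Definition nd : NW -> NW := twder_lift npar nd_val.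

Lemma nd_rel s t : ncweil_rel s t ->
  twder_eval npar nd_val s = twder_eval npar nd_val t.
Proof.
have hp := npar_hom.
case=> [c x y|c x y|x y|x y|x y]; rewrite ?twder_evalB //=;
  rewrite ?mul0r ?add0r ?pclass_const ?(linZ (homL hp)) ?(hom1 hp) ?scalarl;
  rewrite -/(nco _) -/(nce _) -?[pclass _ (PGen (WEven _))]/(nce _)
          -?[pclass _ (PGen (WOdd _))]/(nco _) ?npar_nce ?npar_nco.
- by rewrite (linP nce_linear).
- by rewrite scaler0 addr0.
- by rewrite !(mul0r, mulr0); abel.
- by rewrite !(mul0r, mulr0) nce_nce; abel.
- rewrite !mulNr !nce_nco [lie_bracket y x]lie_antisym (linN nco_linear); abel.
Qed.

Lemma nd_twder : twder npar nd.
Proof. exact/(twder_liftP npar_hom)/nd_rel. Qed.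
Lemma nd_nco x : nd (nco x) = nce x.
Proof. exact/(twder_lift_gen npar_hom)/nd_rel. Qed.
Lemma nd_nce x : nd (nce x) = 0.
Proof. exact/(twder_lift_gen npar_hom)/nd_rel. Qed.

Lemma nd_par x : nd (npar x) = - npar (nd x).
Proof.
move: x; apply: (twder_anticomm_id npar_hom nparK nd_twder).
have hp := npar_hom.
case=> x; rewrite -/(nco _) -/(nce _).
  by rewrite npar_nco (linN (twderL nd_twder)) nd_nco npar_nce.
by rewrite npar_nce nd_nce (lin0 (homL hp)) oppr0.
Qed.

(** Contractions and Lie derivatives are inner here, the Clifford relation making the
    supercommutator with [nco z] the pairing with [z]. Cartan's formula then comes from applying
    [nd] to a supercommutator. *)
Definition niota (z : g) (x : NW) : NW := nco z * x - npar x * nco z.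
Definition nlie (z : g) (x : NW) : NW := nce z * x - x * nce z.

Lemma niota_twder z : twder npar (niota z).
Proof.
have hp := npar_hom; rewrite /niota; split=> [a x y|x y].
  rewrite (linP (homL hp)) mulrDl mulrDr -palg_scaleAr -palg_scaleAl scalerBr.
  by abel.
by rewrite (homM hp) mulrBl mulrBr !mulrA; abel.
Qed.

Lemma niota_nco z x : niota z (nco x) = quad_form z x *: (1 : NW).
Proof. by rewrite /niota npar_nco mulNr opprK nco_nco subrK. Qed.

Lemma niota_nce z x : niota z (nce x) = nco (lie_bracket z x).
Proof.
by rewrite /niota npar_nce nce_nco [lie_bracket x z]lie_antisym (linN nco_linear); abel.
Qed.

Lemma niota_linear x : linear (niota^~ x).
Proof.
move=> a y z; rewrite /niota (linP nco_linear) mulrDl mulrDr -palg_scaleAr.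
by rewrite -palg_scaleAl scalerBr; abel.
Qed.

Lemma nlie_twder z : twder id (nlie z).
Proof. exact: inner_twder. Qed.

Lemma nlie_nco z x : nlie z (nco x) = nco (lie_bracket z x).
Proof. by rewrite /nlie nce_nco; abel. Qed.
Lemma nlie_nce z x : nlie z (nce x) = nce (lie_bracket z x).
Proof. by rewrite /nlie nce_nce; abel. Qed.

Lemma ncartan z x : niota z (nd x) + nd (niota z x) = nlie z x.
Proof.
rewrite /niota /nlie (linB (twderL nd_twder)) !(twderM nd_twder) nd_nco npar_nco.
by rewrite nd_par nparK mulNr mulNr; abel.
Qed.

End NCWeilAlgebra.

Section WeilCartan.
Variables (F : fieldType) (g : quadLieAlgType F).
Notation W := (weilAlg g).

(** The even generator [we x] is $dx$ and not the curvature, so contractions do not kill it: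
    Cartan's formula forces $\iota_z dx = L_z x = [z,x]$. *)
Definition wiota (z : g) : W -> W := wodd (quad_form z) \0 (lie_bracket z).
Definition wlie (z : g) : W -> W := weven \0 (lie_bracket z) (lie_bracket z).

Lemma wiota_wo z x : wiota z (wo x) = quad_form z x *: (1 : W).
Proof. by rewrite /wiota wodd_wo (lin0 (@we_linear _ _)) addr0. Qed.
Lemma wiota_we z x : wiota z (we x) = wo (lie_bracket z x).
Proof. by rewrite /wiota wodd_we. Qed.
Lemma wlie_wo z x : wlie z (wo x) = wo (lie_bracket z x).
Proof. by rewrite /wlie weven_wo. Qed.
Lemma wlie_we z x : wlie z (we x) = we (lie_bracket z x).
Proof. by rewrite /wlie weven_we scale0r add0r. Qed.

Lemma wiota_twder z : twder (@wpar F g) (wiota z). Proof. exact: wodd_twder. Qed.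
Lemma wlie_twder z : twder id (wlie z). Proof. exact: weven_twder. Qed.
Lemma wiota_par z x : wiota z (wpar x) = - wpar (wiota z x).
Proof. exact: wodd_par. Qed.

Lemma wcartan z x : wiota z (wd x) + wd (wiota z x) = wlie z x.
Proof.
move: x; apply: (twder_ext (hom_id _)).
- apply: (twder_anticomm (@wparK _ _) (wiota_twder z) (@wd_twder _ _)).
    exact: wiota_par.
  exact: wd_par.
- exact: wlie_twder.
case=> x; rewrite -/(wo _) -/(we _).
  rewrite wd_wo wiota_we wiota_wo (linZ (twderL (@wd_twder _ _))).
  by rewrite (twder1 (@wpar_hom _ _) (@wd_twder _ _)) scaler0 addr0 wlie_wo.
by rewrite wd_we (lin0 (twderL (wiota_twder z))) add0r wiota_we wd_wo wlie_we.
Qed.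

Lemma wiota_linear x : linear (wiota^~ x).
Proof.
have iL z := twderL (wiota_twder z).
have i1 z : wiota z 1 = 0 := twder1 (@wpar_hom _ _) (wiota_twder z).
elim/palg_ind: x => [x|b|x y IHx IHy|x y IHx IHy] a u v.
- case: x => x; rewrite -/(wo _) -/(we _) ?wiota_wo ?wiota_we.
    by rewrite quadPl scalerDl scalerA.
  by rewrite linearPl (linP (@wo_linear _ _)).
- by rewrite !(linZ (iL _)) !i1 !scaler0 addr0.
- by rewrite !(linD (iL _)) IHx IHy scalerDr; abel.
- rewrite !(twderM (wiota_twder _)) IHx IHy mulrDl mulrDr -palg_scaleAl -palg_scaleAr.
  by rewrite scalerDr; abel.
Qed.

End WeilCartan.

(** * The quantization map *)

(** The range of summation depends on the argument, but any range beyond the last nonzero term gives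
    the same value; linearity follows by taking a common range. *)
Lemma locfin_sum (F : fieldType) (U V : lmodType F) (phi : nat -> U -> V) :
  (forall k, linear (phi k)) ->
  (forall u, exists n, forall k, (n <= k)%N -> phi k u = 0) ->
  exists Phi : U -> V, linear Phi /\
    forall u n, (forall k, (n <= k)%N -> phi k u = 0) -> Phi u = \sum_(k < n) phi k u.
Proof.
move=> lphi fin; have /choice[n nP] := fin.
have tail0 u m l : (forall k, (m <= k)%N -> phi k u = 0) ->
    \sum_(m <= k < l) phi k u = 0.
  by move=> mP; rewrite big_nat_cond big1 // => k /andP[/andP[/mP]].
have sumE u m : (forall k, (m <= k)%N -> phi k u = 0) ->
    \sum_(k < n u) phi k u = \sum_(k < m) phi k u.
  move=> mP; rewrite -!(big_mkord xpredT (fun k => phi k u)).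
  have [le|/ltnW le] := leqP (n u) m.
    by rewrite [in RHS](big_cat_nat (leq0n _) le) /= (tail0 u (n u) m (nP u)) addr0.
  by rewrite (big_cat_nat (leq0n _) le) /= (tail0 u m (n u) mP) addr0.
exists (fun u => \sum_(k < n u) phi k u); split=> [a u v|]; last exact: sumE.
pose m := maxn (n u) (n v).
rewrite (sumE u m) => [|k]; last by rewrite geq_max => /andP[/nP].
rewrite (sumE v m) => [|k]; last by rewrite geq_max => /andP[_ /nP].
rewrite (sumE _ m) => [|k]; last first.
  by rewrite geq_max => /andP[/nP ku /nP kv]; rewrite lphi ku kv scaler0 addr0.
by rewrite scaler_sumr -big_split /=; apply: eq_bigr => k _; rewrite lphi.
Qed.

Section ExponentialSum.
Variables (F : fieldType) (g : quadLieAlgType F) (e f : (\dim {:g}).-tuple g).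
Hypothesis ef : dual_bases e f.
Variables (V : vectType F) (p : {linear V -> g}).
Notation W := (weilAlg V).
Notation NW := (ncWeilAlg g).
Notation I := 'I_(\dim {:g}).

(** The dual derivations see a letter [v] only through [p v], so letters in the kernel of [p] are
    never extracted. In the second use of this section, with [p] the first projection of [g * g],
    these are the letters of the second copy. *)
Definition odel (a : I) : W -> W := wodd (quad_form (tnth f a) \o p) \0 \0.
Definition edel (a : I) : W -> W := weven (quad_form (tnth f a) \o p) \0 \0.

Lemma odel_twder a : twder (@wpar F V) (odel a). Proof. exact: wodd_twder. Qed.
Lemma edel_twder a : twder id (edel a). Proof. exact: weven_twder. Qed.
Lemma odel_wo a v : odel a (wo v) = quad_form (tnth f a) (p v) *: (1 : W).
Proof. by rewrite /odel wodd_wo (lin0 (@we_linear _ _)) addr0. Qed.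
Lemma odel_we a v : odel a (we v) = 0.
Proof. by rewrite /odel wodd_we (lin0 (@wo_linear _ _)). Qed.
Lemma edel_wo a v : edel a (wo v) = 0.
Proof. by rewrite /edel weven_wo (lin0 (@wo_linear _ _)). Qed.
Lemma edel_we a v : edel a (we v) = quad_form (tnth f a) (p v) *: (1 : W).
Proof. by rewrite /edel weven_we (lin0 (@we_linear _ _)) addr0. Qed.

Variable phi0 : W -> NW.
Hypothesis phi0_linear : linear phi0.

(* On words, [ephi k] extracts [k] letters in all possible orders, with signs, and
   applies [phi0] to the remaining word. *)
Fixpoint ephi (k : nat) (u : W) : NW :=
  if k is k'.+1 then
    \sum_a (nco (tnth e a) * ephi k' (odel a u) + nce (tnth e a) * ephi k' (edel a u))
  else phi0 u.

Lemma ephi_linear k : linear (ephi k).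
Proof.
elim: k => [//|k IH] c u v /=; rewrite scaler_sumr -big_split /=; apply: eq_bigr => a _.
rewrite (linP (twderL (odel_twder a))) (linP (twderL (edel_twder a))) !IH.
by rewrite !mulrDr scalerDr !palg_scaleAr; abel.
Qed.

Lemma odel_wpar a u : odel a (wpar u) = - wpar (odel a u).
Proof. exact: wodd_par. Qed.
Lemma edel_wpar a u : edel a (wpar u) = wpar (edel a u).
Proof. exact: weven_par. Qed.

Lemma odel_wd a u : odel a (wd u) = - wd (odel a u).
Proof.
apply/eqP; rewrite -addr_eq0; apply/eqP.
rewrite -[RHS](@weven_eq0 F V u); apply: wodd_wodd => x /=.
- by rewrite addr0.
- by rewrite linear0 (lin0 (quad_linearr _)) addr0.
- by rewrite addr0.
Qed.

Lemma edel_wd a u : edel a (wd u) = wd (edel a u) + odel a u.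
Proof.
apply/eqP; rewrite addrC -subr_eq; apply/eqP.
by apply: weven_wodd => x /=; rewrite ?subr0.
Qed.

Lemma ephi_par : (forall u, phi0 (wpar u) = npar (phi0 u)) ->
  forall k u, ephi k (wpar u) = npar (ephi k u).
Proof.
move=> phi0p; elim=> [//|k IH] u /=; have hp := @npar_hom F g.
rewrite (lin_sum (homL hp)); apply: eq_bigr => a _.
rewrite (linD (homL hp)) !(homM hp) npar_nco npar_nce odel_wpar edel_wpar.
by rewrite (linN (ephi_linear k)) !IH mulNr mulrN.
Qed.

(** The extra [odel] term in [edel_wd] matches the differential of an extracted odd letter, which is
    the corresponding even letter; the sign in [odel_wd] is that of moving [nd] past the odd
    letter. *)
Lemma ephi_d : (forall u, phi0 (wd u) = nd (phi0 u)) ->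
  forall k u, ephi k (wd u) = nd (ephi k u).
Proof.
move=> phi0d; elim=> [//|k IH] u /=; have hd := @nd_twder F g.
rewrite (lin_sum (twderL hd)); apply: eq_bigr => a _.
rewrite (linD (twderL hd)) !(twderM hd) nd_nco nd_nce npar_nco npar_nce odel_wd edel_wd.
rewrite (linN (ephi_linear k)) (linD (ephi_linear k)) !IH mul0r mulNr mulrN mulrDr.
by abel.
Qed.

Section Contraction.
Variables (z : g) (b : {scalar V}) (ad : {linear V -> V}).
Hypothesis p_ad : forall v, p (ad v) = lie_bracket z (p v).

Let iota' : W -> W := wodd b \0 ad.
Let iota0 : W -> W := wodd (quad_form z \o p) \0 \0.

Let odel_iota' a u : odel a (iota' u) =
  - iota' (odel a u) + \sum_c quad_form (tnth f a) (lie_bracket z (tnth e c)) *: edel c u.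
Proof.
apply/eqP; rewrite addrC -subr_eq opprK; apply/eqP.
transitivity (weven (quad_form (tnth f a) \o lie_bracket z \o p) \0 \0 u).
  apply: wodd_wodd => x /=; rewrite ?linear0 ?addr0 ?p_ad //.
move: u; apply: (twder_ext (hom_id _)); first exact: weven_twder.
  by apply: twder_sum => c; apply: twderZ; apply: edel_twder.
case=> x; rewrite -/(wo _) -/(we _).
  rewrite weven_wo (lin0 (@wo_linear _ _)) big1 // => c _.
  by rewrite edel_wo scaler0.
rewrite weven_we (lin0 (@we_linear _ _)) addr0.
transitivity ((\sum_c quad_form (tnth f a) (lie_bracket z (tnth e c))
    * quad_form (tnth f c) (p x)) *: (1 : W)); last first.
  by rewrite scaler_suml; apply: eq_bigr => c _; rewrite edel_we scalerA.
congr (_ *: _); rewrite /= {1}(dual_expandl ef (p x)) linear_sum.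
rewrite (lin_sum (quad_linearr _)); apply: eq_bigr => c _.
rewrite linearZ (linZ (quad_linearr _)) [RHS]mulrC.
by rewrite [quad_form (p x) _]quad_sym.
Qed.

Let odel_iota0 a u : odel a (iota0 u) = - iota0 (odel a u).
Proof.
apply/eqP; rewrite -addr_eq0; apply/eqP.
rewrite -[RHS](@weven_eq0 F V u).
by apply: wodd_wodd => x /=; rewrite ?linear0 ?(lin0 (quad_linearr _)) ?addr0.
Qed.

Let edel_iota' a u : edel a (iota' u) = iota' (edel a u).
Proof.
apply/eqP; rewrite -subr_eq0; apply/eqP.
rewrite -[RHS](@wodd_eq0 F V u).
by apply: weven_wodd => x /=; rewrite ?linear0 ?(lin0 (quad_linearr _)) ?subr0 ?addr0.
Qed.

Let edel_iota0 a u : edel a (iota0 u) = iota0 (edel a u).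
Proof.
apply/eqP; rewrite -subr_eq0; apply/eqP.
rewrite -[RHS](@wodd_eq0 F V u).
by apply: weven_wodd => x /=; rewrite ?linear0 ?(lin0 (quad_linearr _)) ?subr0 ?addr0.
Qed.

Let iota0E u : iota0 u = \sum_a quad_form z (tnth e a) *: odel a u.
Proof.
move: u; apply: (twder_ext (@wpar_hom F V)); first exact: wodd_twder.
  by apply: twder_sum => c; apply: twderZ; apply: odel_twder.
case=> x; rewrite -/(wo _) -/(we _) /iota0.
  rewrite wodd_wo (lin0 (@we_linear _ _)) addr0 /=.
  rewrite {1}(dual_expandl ef (p x)) (lin_sum (quad_linearr _)) scaler_suml.
  apply: eq_bigr => c _; rewrite odel_wo scalerA (linZ (quad_linearr _)) mulrC.
  by rewrite [quad_form (p x) _]quad_sym.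
rewrite wodd_we (lin0 (@wo_linear _ _)) big1 // => c _.
by rewrite odel_we scaler0.
Qed.

(** Contracting an extracted odd letter deletes it, which happens in [k] ways and gives the last
    term. Contracting an extracted even letter makes it odd, which is what the [edel] terms in
    [odel_iota'] account for. For [k = 0] the value of [k.-1] is multiplied by zero. *)
Lemma ephi_iota : (forall u, niota z (phi0 u) = phi0 (iota' u)) ->
  forall k u, niota z (ephi k u) = ephi k (iota' u) + k%:R *: ephi k.-1 (iota0 u).
Proof.
move=> phi0i; elim=> [|k IH] u /=; first by rewrite scale0r addr0.
have hi := @niota_twder F g z; have lphi := ephi_linear k.
rewrite (lin_sum (twderL hi)).
have -> : ephi k (iota0 u) = \sum_a quad_form z (tnth e a) *: ephi k (odel a u).
  by rewrite iota0E (lin_sum lphi); apply: eq_bigr => a _; rewrite (linZ lphi).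
have -> : k.+1%:R *: (\sum_a quad_form z (tnth e a) *: ephi k (odel a u))
   = (\sum_a quad_form z (tnth e a) *: ephi k (odel a u))
     + \sum_a (- (nco (tnth e a) * (k%:R *: ephi k.-1 (iota0 (odel a u))))
        + nce (tnth e a) * (k%:R *: ephi k.-1 (iota0 (edel a u)))).
  rewrite -addn1 natrD scalerDl scale1r addrC; congr (_ + _).
  case: k {IH lphi} => [|k].
    by rewrite scale0r big1 // => a _; rewrite !scale0r !mulr0 oppr0 addr0.
  have -> : \sum_a quad_form z (tnth e a) *: ephi k.+1 (odel a u) = ephi k.+1 (iota0 u).
    rewrite iota0E (lin_sum (ephi_linear _)).
    by apply: eq_bigr => a _; rewrite (linZ (ephi_linear _)).
  rewrite /= scaler_sumr; apply: eq_bigr => a _.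
  rewrite odel_iota0 edel_iota0 (linN (ephi_linear k)) mulrN scalerDr scalerN.
  by rewrite !palg_scaleAr.
have -> : \sum_a (nco (tnth e a) * ephi k (odel a (iota' u))
              + nce (tnth e a) * ephi k (edel a (iota' u)))
   = \sum_a (nco (lie_bracket z (tnth e a)) * ephi k (edel a u))
     + \sum_a (- (nco (tnth e a) * ephi k (iota' (odel a u)))
              + nce (tnth e a) * ephi k (iota' (edel a u))).
  transitivity (\sum_a (\sum_c quad_form (tnth f a) (lie_bracket z (tnth e c))
        *: (nco (tnth e a) * ephi k (edel c u)))
     + \sum_a (- (nco (tnth e a) * ephi k (iota' (odel a u)))
              + nce (tnth e a) * ephi k (iota' (edel a u)))).
    rewrite -big_split /=; apply: eq_bigr => a _ /=.
    rewrite odel_iota' edel_iota' (linD lphi) (linN lphi) mulrDr mulrN (lin_sum lphi).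
    rewrite mulr_sumr.
    have -> : \sum_i nco (tnth e a) * ephi k
          (quad_form (tnth f a) (lie_bracket z (tnth e i)) *: edel i u)
      = \sum_c quad_form (tnth f a) (lie_bracket z (tnth e c))
        *: (nco (tnth e a) * ephi k (edel c u)).
      by apply: eq_bigr => c _; rewrite (linZ lphi) palg_scaleAr.
    by abel.
  (* Summed over [a], the coefficients rebuild $[z,e_c]$, the contraction of the extracted even
     letter. *)
  congr (_ + _); rewrite exchange_big; apply: eq_bigr => c _ /=.
  rewrite [in RHS](dual_expandl ef (lie_bracket z (tnth e c))).
  rewrite (lin_sum (@nco_linear _ _)) mulr_suml; apply: eq_bigr => a _.
  by rewrite (linZ (@nco_linear _ _)) -palg_scaleAl quad_sym.
rewrite -!big_split; apply: eq_bigr => a _ /=.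
rewrite (linD (twderL hi)) !(twderM hi) niota_nco niota_nce npar_nco npar_nce !IH.
by rewrite scalarl mulNr !mulrDr; abel.
Qed.
End Contraction.

End ExponentialSum.

Section ExponentialSumExists.
Variables (F : fieldType) (charF0 : [pchar F] =i pred0).
Variables (g : quadLieAlgType F) (e f : (\dim {:g}).-tuple g).
Hypothesis ef : dual_bases e f.
Variables (V : vectType F) (p : {linear V -> g}).
Notation W := (weilAlg V).
Notation NW := (ncWeilAlg g).

Lemma natF_neq0 n : n.+1%:R != 0 :> F.
Proof. by have /pcharf0P-> := charF0. Qed.

Lemma factF_neq0 n : n`!%:R != 0 :> F.
Proof. by have := fact_gt0 n; case: n`! => // m _; apply: natF_neq0. Qed.

Variable phi0 : W -> NW.
Hypothesis phi0_linear : linear phi0.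
Notation ephi := (ephi e f p phi0).
Notation lphi := (ephi_linear e f p phi0_linear).

(** Every extraction shortens words; the weight used here counts letters. *)
Lemma ephi_nilp n u k : wfil (fun=> 1%N) n u -> (n <= k)%N -> ephi k u = 0.
Proof.
elim: k n u => [|k IH] [|n] u.
- by move=> /wfil0_eq0-> _; rewrite (lin0 (lphi 0)).
- by [].
- by move=> /wfil0_eq0-> _; rewrite (lin0 (lphi k.+1)).
move=> hu nk /=; rewrite big1 // => a _.
have wp x : wfil (fun=> 1%N) 2 (@wpar F V (pgen _ x)).
  case: x => x; rewrite -/(wo _) -/(we _) ?wpar_wo ?wpar_we.
    exact/wfilN/(wfil_gen _ (fun=> 1%N)).
  exact: (wfil_gen _ (fun=> 1%N)).
rewrite (IH n) //; last first.
  apply: (wfil_twder (@wpar_hom F V) (odel_twder f p a) wp) hu => x.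
  by case: x => x; rewrite -/(wo _) -/(we _) ?odel_wo ?odel_we;
    [apply/wfilZ/wfil1|apply: wfil0].
rewrite (IH n) ?mulr0 ?addr0 //.
apply: (wfil_twder (hom_id _) (edel_twder f p a)) hu => x.
  exact: (wfil_gen _ (fun=> 1%N)).
by case: x => x; rewrite -/(wo _) -/(we _) ?edel_wo ?edel_we;
  [apply: wfil0|apply/wfilZ/wfil1].
Qed.

Lemma ephi_locfin u : exists n, forall k, (n <= k)%N -> ephi k u = 0.
Proof.
have [n hn] := wfil_exhaustive (fun=> 1%N) u.
by exists n => k; apply: ephi_nilp.
Qed.

Definition is_expsum (Phi : W -> NW) := linear Phi /\
  forall u n, (forall k, (n <= k)%N -> ephi k u = 0) ->
    Phi u = \sum_(k < n) (k`!%:R)^-1 *: ephi k u.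

Lemma expsum_exists : exists Phi, is_expsum Phi.
Proof.
have [k a x y|u|Phi [lP hP]] :=
    @locfin_sum F W NW (fun k u => (k`!%:R)^-1 *: ephi k u).
- by rewrite lphi scalerDr !scalerA mulrC.
- have [n hn] := ephi_locfin u; exists n => k nk.
  by rewrite hn ?scaler0.
exists Phi; split=> // u n hn; apply: hP => k nk.
by rewrite hn ?scaler0.
Qed.

Section Theory.
Variables (Phi : W -> NW) (hPhi : is_expsum Phi).

Lemma expsumL : linear Phi. Proof. by case: hPhi. Qed.

Lemma expsum_par : (forall u, phi0 (wpar u) = npar (phi0 u)) ->
  forall u, Phi (wpar u) = npar (Phi u).
Proof.
move=> h u; have [n hn] := ephi_locfin u; have hp := @npar_hom F g.
have E := ephi_par e f p phi0_linear h.
rewrite (hPhi.2 u n) // (hPhi.2 _ n) => [|k nk]; last first.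
  by rewrite E hn // (lin0 (homL hp)).
rewrite (lin_sum (homL hp)); apply: eq_bigr => k _.
by rewrite E (linZ (homL hp)).
Qed.

Lemma expsum_d : (forall u, phi0 (wd u) = nd (phi0 u)) ->
  forall u, Phi (wd u) = nd (Phi u).
Proof.
move=> h u; have [n hn] := ephi_locfin u; have hd := @nd_twder F g.
have E := ephi_d e f p phi0_linear h.
rewrite (hPhi.2 u n) // (hPhi.2 _ n) => [|k nk]; last first.
  by rewrite E hn // (lin0 (twderL hd)).
rewrite (lin_sum (twderL hd)); apply: eq_bigr => k _.
by rewrite E (linZ (twderL hd)).
Qed.

(** Dividing [ephi_iota] by $k!$ turns its coefficient $k$ into a shift from $1/k!$ to $1/(k-1)!$.
    So extracted letters contribute [quad_form z (p v)] to the scalar part of the contraction, and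
    the letters left to [phi0] contribute [b']. *)
Lemma expsum_iota z (b b' : {scalar V}) (ad : {linear V -> V}) :
  (forall v, p (ad v) = lie_bracket z (p v)) ->
  (forall v, b v = b' v + quad_form z (p v)) ->
  (forall u, niota z (phi0 u) = phi0 (wodd b' \0 ad u)) ->
  forall u, niota z (Phi u) = Phi (wodd b \0 ad u).
Proof.
move=> p_ad bE h u.
have E k w := ephi_iota ef phi0_linear p_ad h k w.
have -> : wodd b \0 ad u = wodd b' \0 ad u + wodd (quad_form z \o p) \0 \0 u.
  by apply: wodd_add => x /=; rewrite ?addr0 ?bE.
set u1 := wodd b' _ _ u; set u0 := wodd _ _ _ u.
have [n hn] := ephi_locfin u; have [n1 hn1] := ephi_locfin u1.
have [n0 hn0] := ephi_locfin u0; have hi := @niota_twder F g z.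
(* The sums for [u] and [u1] run up to [N.+1], that for [u0] only up to [N]: the term of index
   [k.+1] on the left produces the term of index [k] for [u0]. *)
pose N := (n + n1 + n0)%N.
rewrite (linD expsumL) (hPhi.2 u N.+1) => [|k Nk]; last first.
  by apply: hn; apply: leq_trans (ltnW Nk); rewrite /N -addnA leq_addr.
rewrite (hPhi.2 u1 N.+1) => [|k Nk]; last first.
  by apply: hn1; apply: leq_trans (ltnW Nk); rewrite /N -addnA addnCA leq_addr.
rewrite (hPhi.2 u0 N) => [|k Nk]; last first.
  by apply: hn0; apply: leq_trans Nk; rewrite /N leq_addl.
rewrite (lin_sum (twderL hi)).
transitivity (\sum_(k < N.+1) (k`!%:R^-1 *: ephi k u1
    + (k`!%:R^-1 * k%:R) *: ephi k.-1 u0)).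
  apply: eq_bigr => k _; rewrite (linZ (twderL hi)) E scalerDr scalerA.
  by [].
rewrite big_split /=; congr (_ + _).
rewrite big_ord_recl /= mulr0 scale0r add0r; apply: eq_bigr => k _ /=.
rewrite /bump leq0n add1n add0n factS natrM invfM -mulrA mulrCA mulVf ?mulr1 //.
exact: natF_neq0.
Qed.
End Theory.
End ExponentialSumExists.

Section Quantization.
Variables (F : fieldType) (charF0 : [pchar F] =i pred0).
Variables (g : quadLieAlgType F) (e f : (\dim {:g}).-tuple g).
Hypothesis ef : dual_bases e f.
Notation W := (weilAlg g).
Notation NW := (ncWeilAlg g).

Let zl : linear (fun _ : g => 0 : NW).
Proof. by move=> a x y; rewrite scaler0 addr0. Qed.
Let zc (x y : g) : (0 : NW) * 0 = 0 * 0. Proof. by []. Qed.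
Let za (x y : g) : (0 : NW) * 0 = - (0 * 0). Proof. by rewrite mulr0 oppr0. Qed.

Definition waug : W -> NW := weil_hom (fun=> 0) (fun=> 0).

Lemma waug_hom : algebra_hom waug.
Proof. exact: (weil_hom_algebra zl zl zc zc za). Qed.
Lemma waug_gen w : waug (weilGen w) = 0.
Proof.
by case: w => x; [exact: (weil_hom_wo zl zl zc zc za)|exact: (weil_hom_we zl zl zc zc za)].
Qed.

Lemma waug_scalar u : exists c, waug u = c *: (1 : NW).
Proof.
elim/palg_ind: u => [w|a|x y [c Ec] [d Ed]|x y [c Ec] [d Ed]].
- by exists 0; rewrite waug_gen scale0r.
- by exists a; rewrite (linZ (homL waug_hom)) (hom1 waug_hom).
- by exists (c + d); rewrite (linD (homL waug_hom)) Ec Ed scalerDl.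
- by exists (c * d); rewrite (homM waug_hom) Ec Ed scalarl scalerA.
Qed.

Lemma waug_twder_eq0 p (D : W -> W) : algebra_hom p -> twder p D ->
  (forall w, waug (D (weilGen w)) = 0) -> forall u, waug (D u) = 0.
Proof.
move=> hp hD h; have lw := homL waug_hom; elim/palg_ind=> [//|a|x y Ex Ey|x y Ex Ey].
- by rewrite (linZ (twderL hD)) (twder1 hp hD) scaler0 (lin0 lw).
- by rewrite (linD (twderL hD)) (linD lw) Ex Ey addr0.
- by rewrite (twderM hD) (linD lw) !(homM waug_hom) Ex Ey mul0r mulr0 addr0.
Qed.

Lemma waug_par u : waug (wpar u) = npar (waug u).
Proof.
move: u; apply: (@hom_ext _ _ _ _ _ (waug \o @wpar F g) (@npar F g \o waug)).
- exact: hom_comp waug_hom (@wpar_hom F g).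
- exact: hom_comp (@npar_hom F g) waug_hom.
move=> w /=; rewrite waug_gen (lin0 (homL (@npar_hom F g))).
case: w => x; rewrite -/(wo _) -/(we _) ?wpar_wo ?wpar_we.
  by rewrite (linN (homL waug_hom)) waug_gen oppr0.
exact: waug_gen.
Qed.

Lemma waug_d u : waug (wd u) = nd (waug u).
Proof.
have [c ->] := waug_scalar u; have hd := @nd_twder F g.
rewrite (linZ (twderL hd)) (twder1 (@npar_hom F g) hd) scaler0.
move: u; apply: (waug_twder_eq0 (@wpar_hom F g) (@wd_twder F g)).
case=> x; rewrite -/(wo _) -/(we _) ?wd_wo ?wd_we; first exact: waug_gen.
exact: (lin0 (homL waug_hom)).
Qed.

Lemma waug_iota z u : niota z (waug u) = waug (wodd \0 \0 (lie_bracket z) u).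
Proof.
have [c ->] := waug_scalar u; have hi := @niota_twder F g z.
rewrite (linZ (twderL hi)) (twder1 (@npar_hom F g) hi) scaler0; apply/esym.
move: u; apply: (waug_twder_eq0 (@wpar_hom F g) (wodd_twder _ _ _)).
case=> x; rewrite -/(wo _) -/(we _) ?wodd_wo ?wodd_we; last exact: waug_gen.
rewrite scale0r add0r (lin0 (@we_linear _ _)).
exact: (lin0 (homL waug_hom)).
Qed.

Lemma quant_intertwines (Q : W -> NW) : is_expsum e f idfun waug Q ->
  [/\ forall u, Q (wpar u) = npar (Q u),
      forall u, Q (wd u) = nd (Q u)
    & forall z u, Q (wiota z u) = niota z (Q u)].
Proof.
move=> hQ; have lw := homL waug_hom; split.
- exact/(expsum_par lw hQ)/waug_par.
- exact/(expsum_d lw hQ)/waug_d.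
- move=> z u; apply/esym; apply: (expsum_iota charF0 ef lw hQ (b' := \0)) => [//|v|w].
    exact/esym/add0r.
  exact: waug_iota.
Qed.

End Quantization.

(** * Identification of the exponential sum with symmetrization *)

Section DerivationOfProduct.
Variables (F : fieldType) (X : Type) (R : pterm F X -> pterm F X -> Prop).
Notation A := (palg R).
Variables (par : X -> bool) (p D : A -> A) (c : X -> F).
Hypothesis hD : twder p D.
Hypothesis p_gen : forall x, p (pgen R x) = (-1) ^+ par x *: pgen R x.
Hypothesis D_gen : forall x, D (pgen R x) = c x *: (1 : A).

Definition nodd_before m (v : 'I_m -> X) (i : 'I_m) : nat :=
  \sum_(j < m | (j < i)%N) par (v j).

Lemma nodd_before0 m (v : 'I_m.+1 -> X) : nodd_before v ord0 = 0%N.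
Proof. by rewrite /nodd_before big1. Qed.

Lemma nodd_before_lift m (v : 'I_m.+1 -> X) (i : 'I_m) :
  nodd_before v (lift ord0 i) = (par (v ord0) + nodd_before (v \o lift ord0) i)%N.
Proof. by rewrite /nodd_before big_mkcond big_ord_recl /= -big_mkcond. Qed.

Lemma twder_prod m (v : 'I_m.+1 -> X) :
  D (\prod_(i < m.+1) pgen R (v i)) =
  \sum_i ((-1) ^+ nodd_before v i * c (v i)) *: \prod_(j < m) pgen R (v (lift i j)).
Proof.
elim: m v => [|m IH] v.
  by rewrite !big_ord1 D_gen big_ord0 nodd_before0 mul1r.
rewrite big_ord_recl (twderM hD) D_gen scalarl p_gen [RHS]big_ord_recl nodd_before0 mul1r.
congr (_ + _); rewrite (IH (v \o lift ord0)) mulr_sumr; apply: eq_bigr => i _ /=.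
rewrite nodd_before_lift -palg_scaleAr -palg_scaleAl scalerA big_ord_recl.
have -> : lift (lift ord0 i) ord0 = ord0 :> 'I_m.+2 by apply: val_inj.
rewrite exprD [_ * (-1) ^+ par _]mulrC mulrA; congr (_ *: (pgen R (v ord0) * _)).
apply: eq_bigr => j _; congr (pgen R (v _)); apply: val_inj => /=.
by rewrite /bump !leq0n !add1n ltnS; case: (_ <= _)%N.
Qed.
End DerivationOfProduct.

Section PermutationSum.
Variables (F : fieldType) (g : quadLieAlgType F).
Notation NW := (ncWeilAlg g).
Notation nodd := (nodd_before (@is_odd g)).

Definition symsum m (v : 'I_m -> weil_gen g) : NW :=
  \sum_(s : 'S_m) (-1) ^+ koszul v s *: \prod_(i < m) ncWeilGen (v (s^-1%g i)).

Lemma koszulE m (v : 'I_m -> weil_gen g) s : koszul v s =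
  (\sum_(i < m) \sum_(j < m)
    [&& i < j, is_odd (v (s^-1 i)), is_odd (v (s^-1 j)) & s^-1 j < s^-1 i]%g)%N.
Proof.
rewrite /koszul -sum1dep_card big_mkcond pair_bigA /=.
by apply: eq_bigr => -[i j] _ /=; case: ifP.
Qed.

(** Once [v i] is placed first, the reversed odd pairs are those between [v i] and the odd letters
    that preceded it, and those among the remaining letters. *)
Lemma koszul_lift m (v : 'I_m.+1 -> weil_gen g) i (t : 'S_m) :
  koszul v (lift_perm i ord0 t) =
  (is_odd (v i) * nodd v i + koszul (v \o lift i) t)%N.
Proof.
rewrite !koszulE lift_permV big_ord_recl lift_perm_id; congr (_ + _)%N.
  rewrite big_ord_recl /= add0n.
  transitivity (\sum_(j < m) (is_odd (v i) && (is_odd (v (lift i (t^-1%g j)))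
      && (lift i (t^-1%g j) < i)%N) : nat))%N.
    by apply: eq_bigr => j _; rewrite lift_perm_lift.
  rewrite (reindex_inj (@perm_inj _ t)) /= big_distrr /=.
  rewrite [RHS]big_mkcond [RHS](bigD1_ord i) //= ltnn add0n; apply: eq_bigr => j _.
  by rewrite permK; case: (bump i j < i)%N; rewrite ?andbT ?andbF ?mulnb.
apply: eq_bigr => a _; rewrite big_ord_recl /= add0n; apply: eq_bigr => b _.
rewrite !lift_perm_lift /= /bump !leq0n !add1n ltnS.
by congr [&& _, _, _ & _]; rewrite !ltnNge leq_bump2.
Qed.

(** Permutations are sorted by the letter they bring to the front. The exponential sum satisfies the
    same recursion, [ephi_prod]. *)
Lemma symsum_rec m (v : 'I_m.+1 -> weil_gen g) : symsum v =
  \sum_i (-1) ^+ (is_odd (v i) * nodd v i) *: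
    (ncWeilGen (v i) * symsum (v \o lift i)).
Proof.
rewrite /symsum (reindex (fun it : 'I_m.+1 * 'S_m => lift_perm it.1 ord0 it.2)) /=; last first.
  apply: onW_bij; apply: inj_card_bij => [[i s] [j t] /= E|].
    have ij : i = j.
      apply: (@perm_inj _ (lift_perm i ord0 s)).
      by rewrite lift_perm_id E lift_perm_id.
    subst j; congr (_, _); apply/permP=> k; apply: (@lift_inj _ ord0).
    by rewrite -!(lift_perm_lift i) E.
  by rewrite card_prod card_ord !card_Sn factS.
rewrite -(pair_bigA _ (fun i t => (-1) ^+ koszul v (lift_perm i ord0 t) *:
    \prod_(k < m.+1) ncWeilGen (v ((lift_perm i ord0 t)^-1%g k)))) /=.
apply: eq_bigr => i _; rewrite mulr_sumr scaler_sumr; apply: eq_bigr => t _.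
rewrite koszul_lift exprD -scalerA -palg_scaleAr lift_permV big_ord_recl lift_perm_id.
have -> : \prod_(j < m) ncWeilGen (v (lift_perm ord0 i t^-1%g (lift ord0 j)))
    = \prod_(j < m) ncWeilGen ((v \o lift i) (t^-1%g j)).
  by apply: eq_bigr => j _; rewrite lift_perm_lift.
by [].
Qed.
End PermutationSum.

(** Weight two makes $\overline\zeta$ as heavy as the quadratic terms $\lambda(\zeta)$ and
    $\gamma(\zeta)$, and lets contractions, which turn an even generator into an odd one, strictly
    lower the weight. *)
Definition wgt (V : Type) (w : weil_gen V) : nat := if is_odd w then 1 else 2.

Section QuantizationFormula.
Variables (F : fieldType) (charF0 : [pchar F] =i pred0).
Variables (g : quadLieAlgType F) (e f : (\dim {:g}).-tuple g).
Hypothesis ef : dual_bases e f.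
Notation W := (weilAlg g).
Notation NW := (ncWeilAlg g).
Notation nodd := (nodd_before (@is_odd g)).
Notation phi := (ephi e f idfun (@waug F g)).
Notation lphi := (ephi_linear e f idfun (homL (@waug_hom F g))).

Let oc a (w : weil_gen g) : F := if w is WOdd x then quad_form (tnth f a) x else 0.
Let ec a (w : weil_gen g) : F := if w is WEven x then quad_form (tnth f a) x else 0.

Let wpar_gen (w : weil_gen g) : wpar (weilGen w) = (-1) ^+ is_odd w *: weilGen w.
Proof. by case: w => x; [rewrite wpar_wo scaleN1r|rewrite wpar_we scale1r]. Qed.

Let odel_gen a (w : weil_gen g) : odel f idfun a (weilGen w) = oc a w *: (1 : W).
Proof. by case: w => x; [exact: odel_wo|rewrite odel_we scale0r]. Qed.

Let edel_gen a (w : weil_gen g) : edel f idfun a (weilGen w) = ec a w *: (1 : W).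
Proof. by case: w => x; [rewrite edel_wo scale0r|exact: edel_we]. Qed.

Let gen_expand s t (w : weil_gen g) :
  \sum_a ((s * oc a w) *: nco (tnth e a) + (t * ec a w) *: nce (tnth e a))
    = (if is_odd w then s else t) *: ncWeilGen w.
Proof.
case: w => x /=.
  rewrite [WOdd x in RHS](congr1 (@WOdd g) (dual_expandl ef x)).
  rewrite -/(nco _) (lin_sum (@nco_linear _ _)) scaler_sumr; apply: eq_bigr => a _.
  by rewrite mulr0 scale0r addr0 (linZ (@nco_linear _ _)) scalerA [quad_form x _]quad_sym.
rewrite [WEven x in RHS](congr1 (@WEven g) (dual_expandl ef x)).
rewrite -/(nce _) (lin_sum (@nce_linear _ _)) scaler_sumr; apply: eq_bigr => a _.
by rewrite mulr0 scale0r add0r (linZ (@nce_linear _ _)) scalerA [quad_form x _]quad_sym.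
Qed.

Lemma ephi_prod k m (v : 'I_m.+1 -> weil_gen g) :
  phi k.+1 (\prod_(i < m.+1) weilGen (v i)) =
  \sum_i (-1) ^+ (is_odd (v i) * nodd v i) *:
    (ncWeilGen (v i) * phi k (\prod_(j < m) weilGen (v (lift i j)))).
Proof.
rewrite /=.
transitivity (\sum_a \sum_i
  (((-1) ^+ nodd v i * oc a (v i)) *: nco (tnth e a) + (1 * ec a (v i)) *: nce (tnth e a))
   * phi k (\prod_(j < m) weilGen (v (lift i j)))).
  apply: eq_bigr => a _.
  rewrite (twder_prod (odel_twder f idfun a) wpar_gen (odel_gen a)).
  have id_gen (w : weil_gen g) : id (weilGen w) = (-1) ^+ false *: weilGen w.
    by rewrite scale1r.
  rewrite (twder_prod (par := fun=> false) (edel_twder f idfun a) id_gen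
    (edel_gen a)).
  rewrite !(lin_sum (lphi k)) !mulr_sumr -big_split /=; apply: eq_bigr => i _.
  rewrite !(linZ (lphi k)) -!palg_scaleAr mulrDl !palg_scaleAl.
  by rewrite [nodd_before _ v i in X in _ + X]big1 ?expr0.
rewrite exchange_big; apply: eq_bigr => i _ /=.
rewrite -mulr_suml gen_expand palg_scaleAl.
by case: (is_odd _); rewrite ?mul1n ?mul0n ?expr0.
Qed.

Lemma symsum0 (v : 'I_0 -> weil_gen g) : symsum v = 1.
Proof.
rewrite /symsum (eq_bigr (fun=> 1)) => [|s _].
  by rewrite sumr_const card_Sn fact0 mulr1n.
rewrite big_ord0 koszulE big_ord0 expr0; exact: scale1r.
Qed.

(** With fewer extractions than letters, the augmentation kills what is left; with more, a
    derivation meets a constant. *)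
Lemma ephi_word k m (v : 'I_m -> weil_gen g) :
  phi k (\prod_(i < m) weilGen (v i)) = if k == m then symsum v else 0.
Proof.
elim: k m v => [|k IH] [|m] v.
- by rewrite big_ord0 symsum0; exact: (hom1 (@waug_hom F g)).
- by rewrite /= big_ord_recl (homM (@waug_hom F g)) waug_gen mul0r.
- rewrite big_ord0 /= big1 // => a _.
  rewrite (twder1 (@wpar_hom F g) (odel_twder f idfun a)).
  by rewrite (twder1 (hom_id _) (edel_twder f idfun a)) (lin0 (lphi k)) !mulr0 addr0.
rewrite ephi_prod eqSS; case: eqP => [km|nkm].
  rewrite symsum_rec; apply: eq_bigr => i _; rewrite (IH m (v \o lift i)).
  by rewrite km eqxx.
rewrite big1 // => i _; rewrite (IH m (v \o lift i)).
by case: eqP => // _; rewrite mulr0 scaler0.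
Qed.

(** * Leading terms of the quantization map *)

Section Symbol.
Variables (Q : W -> NW) (hQ : is_expsum e f idfun (@waug F g) Q).

Lemma quant_word m (v : 'I_m -> weil_gen g) :
  Q (\prod_(i < m) weilGen (v i)) = (m`!%:R)^-1 *: symsum v.
Proof.
rewrite (hQ.2 _ m.+1) => [|k mk]; last by rewrite ephi_word gtn_eqF.
rewrite big_ord_recr /= ephi_word eqxx big1 ?add0r // => i _.
by rewrite ephi_word ltn_eqF ?scaler0.
Qed.

Lemma quant_symmetrization : is_symmetrization Q.
Proof. by split; [exact: hQ.1|exact: quant_word]. Qed.

Notation nfil := (wfil (@wgt g)).
Notation wsum v := (\sum_(i < _) wgt (v i))%N.

Lemma ncgen_comm (w w' : weil_gen g) :
  nfil (wgt w + wgt w') (ncWeilGen w * ncWeilGen w'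
    - (-1) ^+ (is_odd w * is_odd w') *: (ncWeilGen w' * ncWeilGen w)).
Proof.
case: w => x; case: w' => y /=; rewrite -?/(nco _) -?/(nce _).
- rewrite expr1 scaleN1r opprK nco_nco subrK; apply: wfilZ; exact: wfil1.
- rewrite expr0 scale1r nce_nco opprD addrA subrr add0r; apply: wfilN.
  exact: (wfil_le _ (wfil_gen (@ncweil_rel F g) (@wgt g) (WOdd _))).
- rewrite expr0 scale1r nce_nco addrC addKr.
  exact: (wfil_le _ (wfil_gen (@ncweil_rel F g) (@wgt g) (WOdd _))).
- rewrite expr0 scale1r nce_nce addrC addKr.
  exact: (wfil_le _ (wfil_gen (@ncweil_rel F g) (@wgt g) (WEven _))).
Qed.

Lemma ncgen_prod m (v : 'I_m -> weil_gen g) :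
  nfil (wsum v).+1 (\prod_(i < m) ncWeilGen (v i)).
Proof.
elim: m v => [|m IH] v; first by rewrite !big_ord0; apply: wfil1.
rewrite !big_ord_recl -addnS; apply: wfilM; first exact: wfil_gen.
exact: IH (v \o lift ord0).
Qed.

Lemma wsum_lift m (v : 'I_m.+1 -> weil_gen g) i :
  wsum v = (wgt (v i) + wsum (v \o lift i))%N.
Proof. by rewrite (bigD1_ord i). Qed.

(** The letter passes those before it one at a time; each exchange costs a Koszul sign and a
    supercommutator of lower weight. *)
Lemma ncgen_move m (v : 'I_m.+1 -> weil_gen g) i :
  nfil (wsum v) (ncWeilGen (v i) * \prod_(j < m) ncWeilGen (v (lift i j))
    - (-1) ^+ (is_odd (v i) * nodd v i) *: \prod_(j < m.+1) ncWeilGen (v j)).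
Proof.
elim: m v i => [|m IH] v i.
  rewrite (ord1 i) nodd_before0 muln0 expr0 scale1r big_ord0 [X in _ - X]big_ord1 mulr1 /= subrr.
  exact: wfil0.
case: (unliftP ord0 i) => [i' ->|->]; last first.
  rewrite nodd_before0 muln0 expr0 scale1r [X in _ - X]big_ord_recl /= subrr.
  exact: wfil0.
rewrite nodd_before_lift mulnDr exprD -scalerA.
rewrite [X in _ * X - _]big_ord_recl [X in _ - _ *: (_ *: X)]big_ord_recl /=.
have -> : lift (lift ord0 i') ord0 = ord0 :> 'I_m.+2 by apply: val_inj.
have -> : \prod_(j < m) ncWeilGen (v (lift (lift ord0 i') (lift ord0 j)))
    = \prod_(j < m) ncWeilGen ((v \o lift ord0) (lift i' j)).
  apply: eq_bigr => j _; congr (ncWeilGen (v _)); apply: val_inj => /=.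
  by rewrite /bump !leq0n !add1n ltnS; case: (_ <= _)%N.
have := IH (v \o lift ord0) i'; set c := (-1) ^+ (_ * nodd _ _); set P := \prod_(j < m) _.
set T := \prod_(j < m.+1) _ => hT.
have hP : nfil (wsum (v \o lift ord0 \o lift i')).+1 P.
  exact: (ncgen_prod (v \o lift ord0 \o lift i')).
set a := ncWeilGen (v (lift ord0 i')); set b := ncWeilGen (v ord0).
set s := (-1) ^+ _.
have -> : a * (b * P) - s *: (c *: (b * T))
   = (a * b - s *: (b * a)) * P + s *: (b * (a * P - c *: T)).
  by rewrite mulrBl mulrBr scalerBr -palg_scaleAl -palg_scaleAr !mulrA; abel.
apply: wfilD.
  rewrite (wsum_lift v (lift ord0 i')) big_ord_recl /=.
  have -> : (wsum (fun i0 : 'I_m => v (lift (lift ord0 i') (lift ord0 i0)))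
     = wsum (v \o lift ord0 \o lift i'))%N.
    apply: eq_bigr => j _; congr (wgt (v _)); apply: val_inj => /=.
    by rewrite /bump !leq0n !add1n ltnS; case: (_ <= _)%N.
  have -> : lift (lift ord0 i') ord0 = ord0 :> 'I_m.+2 by apply: val_inj.
  by rewrite addnA; apply: wfilMr hP; apply: ncgen_comm.
by rewrite (wsum_lift v ord0); apply/wfilZ/wfilM => //; apply: wfil_gen.
Qed.

(** To leading order each rearrangement is the original word up to a sign, which the Koszul sign in
    the sum cancels, so $m!$ equal terms add up. *)
Lemma symsum_symbol m (v : 'I_m -> weil_gen g) :
  nfil (wsum v) (symsum v - m`!%:R *: \prod_(i < m) ncWeilGen (v i)).
Proof.
elim: m v => [|m IH] v.
  by rewrite symsum0 !big_ord0 fact0 scale1r subrr; apply: wfil0.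
rewrite symsum_rec factS mulnC natrM -scalerA.
set T := \prod_(i < _) _.
have -> : m.+1%:R *: T = \sum_(i < m.+1) T.
  by rewrite sumr_const card_ord scaler_nat.
rewrite scaler_sumr -sumrB; apply: wfil_sum => i _.
set s := (-1) ^+ _; set P := \prod_(j < m) ncWeilGen (v (lift i j)).
have ss : s * s = 1 by rewrite /s -expr2 sqrr_sign.
have -> : s *: (ncWeilGen (v i) * symsum (v \o lift i)) - m`!%:R *: T
  = s *: (ncWeilGen (v i) * (symsum (v \o lift i) - m`!%:R *: P))
    + (s * m`!%:R) *: (ncWeilGen (v i) * P - s *: T).
  rewrite mulrBr !scalerBr -palg_scaleAr !scalerA [s * _ * s]mulrAC ss mul1r; abel.
apply: wfilD; apply: wfilZ; last exact: ncgen_move.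
by rewrite (wsum_lift v i); apply: wfilM (wfil_gen _ _ _) (IH _).
Qed.

Lemma quant_symbol s : nfil (wsize (@wgt g) s) (Q (word _ s) - word _ s).
Proof.
have E (Y : pzRingType) (G : weil_gen g -> Y) :
    \prod_(x <- s) G x = \prod_(i < size s) G (tnth (in_tuple s) i).
  by rewrite [LHS](big_tnth _ _ s).
have -> : wsize (@wgt g) s = wsum (tnth (in_tuple s)) by rewrite /wsize big_tnth.
rewrite /word !E quant_word.
have := wfilZ ((size s)`!%:R^-1) (symsum_symbol (tnth (in_tuple s))).
by rewrite scalerBr scalerA mulVf ?scale1r // factF_neq0.
Qed.

Lemma quant_fil k x : wfil (@wgt g) k x -> nfil k (Q x).
Proof.
move: x; apply: (wfil_lin (P := nfil k) hQ.1); [exact: wfil0|exact: wfilD|exact: wfilZ|].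
move=> s sk; rewrite -[Q _](subrK (word _ s)); apply: wfilD; last exact: wfil_word.
exact: wfil_le (ltnW sk) (quant_symbol s).
Qed.

(** By bilinearity it is enough to compare words, where both terms have the concatenated word as
    leading term. *)
Lemma quant_mul_symbol k l x y : wfil (@wgt g) k.+1 x -> wfil (@wgt g) l.+1 y ->
  nfil (k + l) (Q (x * y) - Q x * Q y).
Proof.
have lQ := hQ.1; move=> hx; move: y.
have lin2 (z : W) : linear (fun y : W => Q (z * y) - Q z * Q y).
  by move=> a u v; rewrite mulrDr -palg_scaleAr !lQ mulrDr -palg_scaleAr scalerBr; abel.
have lin1 (z : W) : linear (fun y : W => Q (y * z) - Q y * Q z).
  by move=> a u v; rewrite mulrDl -palg_scaleAl !lQ mulrDl -palg_scaleAl scalerBr; abel.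
apply: (wfil_lin (P := nfil (k + l)) (lin2 x)); [exact: wfil0|exact: wfilD|exact: wfilZ|] => t tl.
move: x hx; apply: (wfil_lin (P := nfil (k + l)) (lin1 _)); [exact: wfil0|exact: wfilD|exact: wfilZ|] => s sk.
have hst := quant_symbol (s ++ t); have hs := quant_symbol s; have ht := quant_symbol t.
have -> : Q (word _ s * word _ t) - Q (word _ s) * Q (word _ t)
  = (Q (word _ (s ++ t)) - word _ (s ++ t))
    - (Q (word _ s) - word _ s) * Q (word _ t) - word _ s * (Q (word _ t) - word _ t).
  by rewrite !word_cat mulrBl mulrBr; abel.
have le : (wsize (@wgt g) s + wsize (@wgt g) t <= k + l)%N by apply: leq_add.
apply: wfilB; first apply: wfilB.
- by apply: wfil_le hst; rewrite wsize_cat.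
- apply: wfil_le le _; apply: wfilMr => //; apply: quant_fil.
  by apply: wfil_word.
- by apply: wfil_le le _; apply: wfilM => //; apply: wfil_word.
Qed.

Lemma quant_surj y : exists x, Q x = y.
Proof.
have lQ := hQ.1; have [k hk] := wfil_exhaustive (@wgt g) y.
elim: k y hk => [|k IH] y; first by move/wfil0_eq0->; exists 0; rewrite (lin0 lQ).
have lid : linear (@id NW) by [].
move: y; apply: (wfil_lin (P := fun y => exists x, Q x = y) lid).
- by exists 0; rewrite (lin0 lQ).
- by move=> u v [x <-] [x' <-]; exists (x + x'); rewrite (linD lQ).
- by move=> a u [x <-]; exists (a *: x); rewrite (linZ lQ).
move=> s; rewrite ltnS => sk; have [x xE] := IH _ (wfil_le sk (quant_symbol s)).
by exists (word _ s - x); rewrite (linB lQ) xE opprB addrC subrK.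
Qed.
End Symbol.
End QuantizationFormula.

(** * The Poincare-Birkhoff-Witt theorem *)

Section Straightening.
Variables (F : fieldType) (g : lieAlgType F) (n : nat) (b : 'I_n -> g) (c : 'I_n -> g -> F^o).
Hypotheses (lc : forall a, linear (c a)) (b_expand : forall z, z = \sum_a (c a z : F) *: b a).
Variables (V : lmodType F) (lam0 : seq 'I_n -> V).
Notation I := 'I_n.
Implicit Types (u v w t : seq I) (x y : I) (z : g).

Fixpoint first_descent w : option (seq I * I * I * seq I) :=
  match w with
  | x :: ((y :: w'') as w') =>
    if (y < x)%N then Some ([::], x, y, w'') else
    if first_descent w' is Some (u, x', y', v) then Some (x :: u, x', y', v) else None
  | _ => None
  end.

Lemma first_descent_cons2 x y w : first_descent (x :: y :: w) =
  if (y < x)%N then Some ([::], x, y, w) else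
  if first_descent (y :: w) is Some (u, x', y', v) then Some (x :: u, x', y', v) else None.
Proof. by []. Qed.

Lemma first_descentP w u x y v : first_descent w = Some (u, x, y, v) ->
  w = u ++ x :: y :: v /\ (y < x)%N.
Proof.
elim: w u => [//|x0 [//|y0 w] IH] u; rewrite first_descent_cons2.
case: ifP => [lt [<- <- <- <-] //|_].
case E: (first_descent (y0 :: w)) => [[[[u' x'] y'] v']|//] [<- Ex Ey Ev].
by rewrite Ex Ey Ev in E; have [-> lt] := IH _ E.
Qed.

(** A given descent is the first one, or the first one overlaps it in the letter [x], or the first
    one lies disjointly to its left. These are the cases of the diamond lemma below. *)
Lemma first_descent_cat u x y v : (y < x)%N ->
  exists u' x' y' v', first_descent (u ++ x :: y :: v) = Some (u', x', y', v') /\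
   [\/ [/\ u' = u, x' = x, y' = y & v' = v],
       [/\ u = rcons u' x', y' = x & v' = y :: v]
     | exists t, u = u' ++ x' :: y' :: t /\ v' = t ++ x :: y :: v].
Proof.
move=> lt; elim: u => [|x0 u [u' [x' [y' [v' [E cases]]]]]].
  by rewrite /= lt; exists [::], x, y, v; split; last by constructor.
case: u E cases => [|x1 u] E cases.
  rewrite cat1s first_descent_cons2.
  case: ifP => lt1.
    by exists [::], x0, x, (y :: v); split; last by constructor 2.
  rewrite /= lt.
  by exists [:: x0], x, y, v; split; last by constructor.
rewrite !cat_cons first_descent_cons2; case: ifP => lt1.
  exists [::], x0, x1, (u ++ x :: y :: v); split=> //; constructor 3.
  by exists u.
rewrite -cat_cons E; exists (x0 :: u'), x', y', v'; split=> //.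
case: cases => [[-> -> -> ->]|[-> -> ->]|[t [-> ->]]].
- by constructor.
- by constructor 2.
- by constructor 3; exists t.
Qed.

Fixpoint inversions w : nat :=
  if w is x :: w' then (count (fun y : I => y < x) w' + inversions w')%N else 0%N.

(* Decreases along swaps of descents and along shortenings of words. *)
Definition complexity w : nat := (size w ^ 3 + inversions w)%N.

Lemma inversions_le w : (inversions w <= size w ^ 2)%N.
Proof.
elim: w => //= x w IH; have := count_size (fun y : I => y < x)%N w.
by nia.
Qed.

Lemma complexity_swap u x y v : (y < x)%N ->
  (complexity (u ++ y :: x :: v) < complexity (u ++ x :: y :: v))%N.
Proof.
move=> lt; rewrite /complexity !size_cat /= ltn_add2l.
elim: u => [|x0 u IH] /=.
  by have /ltnW := lt; rewrite leqNgt => /negbTE nlt; rewrite lt nlt /=; lia.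
by rewrite !count_cat /=; lia.
Qed.

(** A word of length $l$ has at most $l^2$ inversions, and $l^3+l^2<(l+1)^3$: the cube outweighs any
    inversions gained by shortening. *)
Lemma complexity_short w w' : (size w' < size w)%N -> (complexity w' < complexity w)%N.
Proof.
rewrite /complexity => lt; have := inversions_le w'.
move: (inversions w') (inversions w) (size w) (size w') lt => i j k l lt il.
suff : (l ^ 3 + l ^ 2 < k ^ 3)%N by lia.
have : (l.+1 ^ 3 <= k ^ 3)%N by rewrite leq_exp2r.
by apply: leq_trans; nia.
Qed.

Definition bcoef x y a : F := c a (lie_bracket (b x) (b y)).

(** The recursion is well founded for [complexity]; with more fuel than that, the default value 0 is
    never reached. *)
Fixpoint straighten_fuel k w : V :=
  if k is k'.+1 then
    if first_descent w is Some (u, x, y, v) then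
      straighten_fuel k' (u ++ y :: x :: v)
        + \sum_a bcoef x y a *: straighten_fuel k' (u ++ a :: v)
    else lam0 w
  else 0.

Lemma straighten_fuel_stable k l w : (complexity w < k)%N -> (complexity w < l)%N ->
  straighten_fuel k w = straighten_fuel l w.
Proof.
elim: k l w => [//|k IH] [//|l] w /= wk wl.
case E: (first_descent w) => [[[[u x] y] v]|//].
have [Ew lt] := first_descentP E.
have lts := complexity_swap u v lt; rewrite -Ew in lts.
congr (_ + _); first by apply: IH; lia.
apply: eq_bigr => a _; congr (_ *: _).
have lt' : (complexity (u ++ a :: v) < complexity w)%N.
  by apply: complexity_short; rewrite Ew !size_cat /=; lia.
by apply: IH; lia.
Qed.

Definition straighten w : V := straighten_fuel (complexity w).+1 w.
Notation L := straighten.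

Definition insert_lin (lam : seq I -> V) u z v : V := \sum_a c a z *: lam (u ++ a :: v).
Notation br := (insert_lin L).

Lemma insert_linear lam u v : linear (fun z => insert_lin lam u z v).
Proof.
move=> k z z'; rewrite /insert_lin scaler_sumr -big_split; apply: eq_bigr => a _ /=.
by rewrite lc scalerDl scalerA.
Qed.

Lemma straighten_sorted w : first_descent w = None -> L w = lam0 w.
Proof. by rewrite /L /= => ->. Qed.

Lemma straighten_desc w u x y v : first_descent w = Some (u, x, y, v) ->
  L w = L (u ++ y :: x :: v) + br u (lie_bracket (b x) (b y)) v.
Proof.
move=> E; rewrite {1}/L /= E; have [Ew lt] := first_descentP E.
have lts := complexity_swap u v lt; rewrite -Ew in lts.
congr (_ + _); first by apply: straighten_fuel_stable.
apply: eq_bigr => a _; congr (_ *: _); apply: straighten_fuel_stable => //.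
by apply: complexity_short; rewrite Ew !size_cat /=; lia.
Qed.

Definition lie_compat (lam : seq I -> V) : Prop := forall u x y v,
  lam (u ++ x :: y :: v) =
    lam (u ++ y :: x :: v) + insert_lin lam u (lie_bracket (b x) (b y)) v.

(** In an overlap the letter exchanged with [x] is a bracket, no longer a basis vector, so the
    exchange rule is extended linearly in that letter. *)
Lemma insert_lin_swap lam u x z v :
  (forall y, lam (u ++ x :: y :: v) =
    lam (u ++ y :: x :: v) + insert_lin lam u (lie_bracket (b x) (b y)) v) ->
  insert_lin lam (rcons u x) z v =
    insert_lin lam u z (x :: v) + insert_lin lam u (lie_bracket (b x) z) v.
Proof.
move=> h.
have -> : insert_lin lam u (lie_bracket (b x) z) v
    = \sum_a c a z *: insert_lin lam u (lie_bracket (b x) (b a)) v.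
  rewrite {1}(b_expand z) linear_sum (lin_sum (insert_linear lam u v)).
  by apply: eq_bigr => a _; rewrite linearZ (linZ (insert_linear lam u v)).
rewrite {2}/insert_lin -big_split /=; apply: eq_bigr => a _.
by rewrite cat_rcons h scalerDr.
Qed.

(* Bergman's diamond lemma: disjoint descents commute, and overlapping ones are
   resolved by the Jacobi identity. *)
Lemma straighten_compat : lie_compat L.
Proof.
pose P u x y v := L (u ++ x :: y :: v) =
  L (u ++ y :: x :: v) + br u (lie_bracket (b x) (b y)) v.
have Psym u x y v : P u x y v -> P u y x v.
  rewrite /P => ->; rewrite lie_antisym (linN (insert_linear _ _ _)).
  by rewrite subrK.
suff desc N u x y v : (complexity (u ++ x :: y :: v) < N)%N -> (y < x)%N -> P u x y v.
  move=> u x y v; have [lt|lt|E] := ltngtP x y.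
  - by apply/Psym/(desc _ _ _ _ _ (ltnSn _)).
  - exact: (desc _ _ _ _ _ (ltnSn _)).
  - by rewrite (val_inj E) lie_alternating (lin0 (insert_linear _ _ _)) addr0.
elim: N u x y v => [//|N IH] u x y v wN lt.
have short u' x' y' v' :
    (size (u' ++ x' :: y' :: v') < size (u ++ x :: y :: v))%N -> P u' x' y' v'.
  move=> sz; have small w : size w = size (u' ++ x' :: y' :: v') -> (complexity w < N)%N.
    by move=> E; have := @complexity_short (u ++ x :: y :: v) w; rewrite E; lia.
  have [l|l|E] := ltngtP x' y'.
  - by apply/Psym/IH => //; apply: small; rewrite !size_cat.
  - by apply: IH => //; apply: small.
  - rewrite /P (val_inj E : x' = y') lie_alternating.
    by rewrite (lin0 (insert_linear _ _ _)) addr0.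
have [u' [x' [y' [v' [E cases]]]]] := first_descent_cat u v lt.
have := straighten_desc E; rewrite /P => ->.
have lt' := (first_descentP E).2.
case: cases => [[-> -> -> ->] //|[Eu Ey ->]|[t [Eu ->]]].
(* Overlap [z x y] with [y < x < z]: both routes to the sorted order [y x z] are expanded by
   induction, and the shorter words left over agree by the Jacobi identity. *)
- subst u y'; rewrite !cat_rcons in wN short *; move: x' lt' wN short {E} => z lt' wN short.
  have sh w : size w = (size u' + size v + 2)%N ->
      (size w < size (u' ++ [:: z, x, y & v]))%N.
    by move=> ->; rewrite size_cat /=; lia.
  have S X Z : br (rcons u' X) Z v = br u' Z (X :: v) + br u' (lie_bracket (b X) Z) v.
    by apply: insert_lin_swap => k; apply: short; apply: sh; rewrite size_cat /=; lia.
  have c1 := complexity_swap u' (y :: v) lt'.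
  have c2 := complexity_swap (rcons u' z) v lt; rewrite !cat_rcons in c2.
  have c3 := complexity_swap (rcons u' x) v (ltn_trans lt lt'); rewrite !cat_rcons in c3.
  have c4 := complexity_swap u' (x :: v) (ltn_trans lt lt').
  have := IH (rcons u' x) z y v _ (ltn_trans lt lt').
  rewrite /P !cat_rcons => ->; last by lia.
  have := IH u' x y (z :: v) _ lt; rewrite /P => ->; last by lia.
  have := IH u' z y (x :: v) _ (ltn_trans lt lt'); rewrite /P => ->; last by lia.
  have := IH (rcons u' y) z x v _ lt'; rewrite /P !cat_rcons => ->; last by lia.
  have lb := insert_linear L u' v; rewrite !S.
  have /eqP := lie_jacobi (b z) (b x) (b y).
  rewrite [lie_bracket (b y) (b z)]lie_antisym linearNr addrAC subr_eq0 => /eqP J.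
  by rewrite -J (linD lb); abel.
(* Disjoint descents: performing both exchanges in either order leaves the same double sum of
   brackets. *)
- subst u; rewrite -!catA !cat_cons in wN short *.
  have c1 := complexity_swap u' (t ++ x :: y :: v) lt'.
  have c2 := complexity_swap (u' ++ [:: x', y' & t]) v lt.
  rewrite -!catA !cat_cons in c2.
  have := IH (u' ++ [:: y', x' & t]) x y v _ lt.
  rewrite /P -!catA !cat_cons => ->; last by lia.
  have := IH u' x' y' (t ++ y :: x :: v) _ lt'; rewrite /P => ->; last by lia.
  have T1 : br u' (lie_bracket (b x') (b y')) (t ++ [:: x, y & v]) =
      br u' (lie_bracket (b x') (b y')) (t ++ [:: y, x & v])
      + \sum_a \sum_d (bcoef x' y' a * bcoef x y d) *: L (u' ++ a :: t ++ d :: v).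
    rewrite /insert_lin -big_split; apply: eq_bigr => a _ /=.
    have := short (u' ++ a :: t) x y v; rewrite /P -!catA !cat_cons => ->; last first.
      by rewrite !size_cat /= !size_cat /=; lia.
    rewrite scalerDr /insert_lin scaler_sumr; congr (_ + _); apply: eq_bigr => d _.
    by rewrite -catA scalerA.
  have T2 : br (u' ++ [:: x', y' & t]) (lie_bracket (b x) (b y)) v =
      br (u' ++ [:: y', x' & t]) (lie_bracket (b x) (b y)) v
      + \sum_d \sum_a (bcoef x' y' a * bcoef x y d) *: L (u' ++ a :: t ++ d :: v).
    rewrite /insert_lin -big_split; apply: eq_bigr => d _ /=.
    have := short u' x' y' (t ++ d :: v); rewrite /P -!catA !cat_cons => ->; last first.
      by rewrite !size_cat /= !size_cat /=; lia.
    rewrite scalerDr /insert_lin scaler_sumr; congr (_ + _); apply: eq_bigr => a _.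
    by rewrite scalerA mulrC.
  by rewrite T1 T2 exchange_big /=; abel.
Qed.
End Straightening.

Section EnvelopingAction.
Variables (F : fieldType) (g : lieAlgType F) (n : nat) (b : 'I_n -> g) (c : 'I_n -> g -> F^o).
Hypotheses (lc : forall a, linear (c a)) (b_expand : forall z, z = \sum_a (c a z : F) *: b a).
Variable V : lmodType F.
Notation I := 'I_n.
Notation compat := (@lie_compat F g n b c V).

(** Letters are appended on the right, so that [x * y] acting on [lam] and evaluated at the empty
    word reads [lam] on the letters of [x] followed by those of [y]. *)
Definition env_op (z : g) (lam : seq I -> V) : seq I -> V :=
  fun w => \sum_a c a z *: lam (rcons w a).

Lemma env_op_linear z : linear (env_op z).
Proof.
move=> k l m; apply/funext=> w; rewrite /env_op !fctE scaler_sumr -big_split.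
by apply: eq_bigr => a _ /=; rewrite scalerDr !scalerA mulrC.
Qed.

Lemma compat_linear k l m : compat l -> compat m -> compat (k *: l + m).
Proof.
move=> hl hm u x y v; rewrite !fctE (hl u) (hm u) scalerDr.
have -> : insert_lin c (k *: l + m) u (lie_bracket (b x) (b y)) v
   = k *: insert_lin c l u (lie_bracket (b x) (b y)) v
     + insert_lin c m u (lie_bracket (b x) (b y)) v.
  rewrite /insert_lin scaler_sumr -big_split; apply: eq_bigr => a _ /=.
  by rewrite !fctE scalerDr !scalerA mulrC.
by abel.
Qed.

Lemma env_op_compat z lam : compat lam -> compat (env_op z lam).
Proof.
move=> h u x y v.
have -> : insert_lin c (env_op z lam) u (lie_bracket (b x) (b y)) v
   = \sum_a c a z *: insert_lin c lam u (lie_bracket (b x) (b y)) (rcons v a).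
  rewrite /insert_lin /env_op; under eq_bigr => a _ do rewrite scaler_sumr.
  rewrite exchange_big; apply: eq_bigr => d _ /=; rewrite scaler_sumr.
  by apply: eq_bigr => a _; rewrite !scalerA mulrC rcons_cat rcons_cons.
rewrite /env_op -big_split; apply: eq_bigr => a _ /=.
by rewrite !rcons_cat !rcons_cons h scalerDr.
Qed.

(** The bracket relation is [lie_compat] for the last two letters of a word, hence the restriction
    to compatible functions. *)
Lemma env_op_rel s t lam : env_rel s t -> compat lam ->
  aeval env_op s lam = aeval env_op t lam.
Proof.
case=> [k x y|x y] h /=; apply/funext=> w.
  rewrite !fctE /env_op scaler_sumr -big_split; apply: eq_bigr => a _ /=.
  by rewrite lc scalerDl scalerA.
rewrite !fctE scaleN1r /env_op.
under eq_bigr => a _ do rewrite scaler_sumr.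
under [X in _ - X]eq_bigr => a _ do rewrite scaler_sumr.
rewrite [X in _ - X]exchange_big -sumrB /=.
transitivity (\sum_a \sum_d (c a x * c d y) *: insert_lin c lam w (lie_bracket (b a) (b d)) [::]).
  apply: eq_bigr => a _; rewrite -sumrB; apply: eq_bigr => d _ /=.
  rewrite !scalerA [c d y * _]mulrC -scalerBr; congr (_ *: _).
  by rewrite -!cats1 -!catA (h w) addrAC subrr add0r.
have lI := insert_linear lc lam w [::].
transitivity (insert_lin c lam w (lie_bracket x y) [::]).
  rewrite {2}(b_expand x) linear_sumlz (lin_sum lI); apply: eq_bigr => a _.
  rewrite linearZl_LR (linZ lI) {2}(b_expand y) linear_sumr (lin_sum lI) scaler_sumr.
  by apply: eq_bigr => d _; rewrite linearZr_LR (linZ lI) scalerA.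
by apply: eq_bigr => a _; rewrite cats1.
Qed.

Definition env_act : envAlg g -> (seq I -> V) -> (seq I -> V) := pact env_op.

Lemma env_act_gen z lam : compat lam -> env_act (envGen z) lam = env_op z lam.
Proof.
exact: (pact_gen env_op_linear compat_linear env_op_compat env_op_rel).
Qed.

Lemma env_actM x y lam : compat lam -> env_act (x * y) lam = env_act x (env_act y lam).
Proof.
exact: (pactM env_op_linear compat_linear env_op_compat env_op_rel).
Qed.

Lemma env_act1 lam : compat lam -> env_act 1 lam = lam.
Proof.
exact: (pact1 env_op_linear compat_linear env_op_compat env_op_rel).
Qed.

Lemma env_act_linearl lam : compat lam -> linear (env_act^~ lam).
Proof.
exact: (pact_linearl env_op_linear compat_linear env_op_compat env_op_rel).
Qed.

Lemma env_act_compat x lam : compat lam -> compat (env_act x lam).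
Proof.
exact: (pact_stable compat_linear env_op_compat).
Qed.

End EnvelopingAction.

Section PBW.
Variables (F : fieldType) (g : lieAlgType F) (n : nat) (b : 'I_n -> g) (c : 'I_n -> g -> F^o).
Hypotheses (lc : forall a, linear (c a)) (b_expand : forall z, z = \sum_a (c a z : F) *: b a).
Notation I := 'I_n.
Notation S := (symAlg g).
Notation sfil := (wfil (R := @sym_rel F g) (fun=> 1%N)).

Let lam0 (w : seq I) : S := word (@sym_rel F g) [seq b a | a <- w].
Let L := straighten b c lam0.

Lemma symGen_linear : linear (fun x : g => symGen x : S).
Proof. by move=> a x y; apply: sym_genP. Qed.

Lemma sym_mulC (x y : S) : x * y = y * x.
Proof.
elim/palg_ind: x y => [x|a|x1 x2 IH1 IH2|x1 x2 IH1 IH2] y.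
- elim/palg_ind: y => [y|a|y1 y2 IH1 IH2|y1 y2 IH1 IH2].
  + exact: sym_genC.
  + by rewrite scalarl scalarr.
  + by rewrite mulrDl mulrDr IH1 IH2.
  + by rewrite mulrA IH1 -mulrA IH2 mulrA.
- by rewrite scalarl scalarr.
- by rewrite mulrDl mulrDr IH1 IH2.
- by rewrite -mulrA IH2 mulrA IH1 mulrA.
Qed.

Let size1 (s : seq g) : wsize (fun=> 1%N) s = size s.
Proof. exact: sum1_size. Qed.

Let lam0_fil w : sfil (size w).+1 (lam0 w).
Proof. by apply: wfil_word; rewrite size1 size_map. Qed.

Lemma straighten_symbol w : sfil (size w) (L w - lam0 w).
Proof.
have [N wN] := ubnP (complexity w); elim: N w wN => [//|N IH] w; rewrite ltnS => wN.
case E: (first_descent w) => [[[[u x] y] v]|]; last first.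
  by rewrite /L straighten_sorted // subrr; apply: wfil0.
have [Ew lt] := first_descentP E.
rewrite /L (straighten_desc b c lam0 E) -/L addrAC; apply: wfilD.
  have -> : lam0 w = lam0 (u ++ y :: x :: v).
    rewrite Ew /lam0 !map_cat /= !word_cat !word_cons !mulrA; congr (_ * _).
    by rewrite -!mulrA; congr (_ * _); apply: sym_mulC.
  have -> : size w = size (u ++ y :: x :: v) by rewrite Ew !size_cat.
  apply: IH; apply: leq_trans wN; rewrite Ew; exact: complexity_swap.
apply: wfil_sum => a _; apply: wfilZ.
have sz : (size (u ++ a :: v)).+1 = size w by rewrite Ew !size_cat /=; lia.
rewrite -[X in wfil _ _ X](subrK (lam0 (u ++ a :: v))).
apply: wfilD; last by rewrite -sz; apply: lam0_fil.
rewrite -sz; apply: wfil_le (leqnSn _) _; apply: IH.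
by apply: leq_trans wN; apply: complexity_short; rewrite -sz.
Qed.

(** Evaluates the straightening function on any word representing [x]; compatibility with brackets
    makes the choice irrelevant. What matters later is its linearity and its leading term. *)
Definition pbw (x : envAlg g) : S := env_act c x L [::].

Let compatL : lie_compat b c L.
Proof. exact: straighten_compat. Qed.

Lemma pbw_linear : linear pbw.
Proof.
move=> k x y; rewrite /pbw.
by rewrite (env_act_linearl lc b_expand compatL k x y).
Qed.

Lemma pbw_symbol (s : seq g) :
  sfil (size s) (pbw (word (@env_rel F g) s) - word (@sym_rel F g) s).
Proof.
(* The induction on [s] appends its letters to a prefix [w] of basis letters, so the prefix has to
   be arbitrary. *)
suff h (w : seq I) : sfil (size w + size s)
    (env_act c (word (@env_rel F g) s) L w - lam0 w * word (@sym_rel F g) s).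
  by have := h [::]; rewrite add0n /lam0 /= /word big_nil mul1r.
elim: s w => [|z s IH] w.
  rewrite /word !big_nil mulr1 addn0.
  by rewrite (env_act1 lc b_expand compatL); apply: straighten_symbol.
rewrite !word_cons (env_actM lc b_expand _ _ compatL).
rewrite (env_act_gen lc b_expand); last exact: env_act_compat.
have -> : symGen z = \sum_a (c a z : F) *: symGen (b a) :> S.
  rewrite {1}(b_expand z) (lin_sum symGen_linear); apply: eq_bigr => a _.
  exact: (linZ symGen_linear).
rewrite /env_op mulr_suml mulr_sumr -sumrB.
apply: wfil_sum => a _; rewrite -palg_scaleAl -palg_scaleAr -scalerBr.
apply: wfilZ; have := IH (rcons w a); rewrite size_rcons addSnnS.
by rewrite /lam0 map_rcons -[rcons (map _ _) _]cats1 word_cat word_cons word_nil mulr1 mulrA.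
Qed.
End PBW.

(** * Horizontal subalgebras *)

Section OddQuadratic.
Variables (F : fieldType) (charF0 : [pchar F] =i pred0).
Variables (g : quadLieAlgType F) (e f : (\dim {:g}).-tuple g).
Hypothesis ef : dual_bases e f.
Variables (X : Type) (R : pterm F X -> pterm F X -> Prop).
Notation A := (palg R).
Variables (o : g -> A) (c0 : F).
Hypotheses (lo : linear o)
  (oo : forall x y, o x * o y = (c0 * quad_form x y) *: (1 : A) - o y * o x).

(** The common form of $\lambda$, for [c0 = 0], and of $\gamma$, for [c0 = 1]. *)
Definition odd_quad (z : g) : A :=
  2^-1 *: \sum_a o (lie_bracket z (tnth e a)) * o (tnth f a).
Notation gam := odd_quad.

Lemma twoF : (2 : F) != 0.
Proof. by have /pcharf0P-> := charF0. Qed.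

Lemma halfF (x : A) : 2^-1 *: (x + x) = x.
Proof. by rewrite scalerDr -scalerDl -mulr2n -[_ *+ 2]mulr_natl mulfV ?scale1r // twoF. Qed.

Let lob z : linear (fun y => o (lie_bracket z y)).
Proof. by move=> k x y; rewrite linearPr lo. Qed.

Let lbo y : linear (fun z => o (lie_bracket z y)).
Proof. by move=> k x z; rewrite linearPl lo. Qed.

Lemma odd_quad_linear : linear gam.
Proof.
move=> k x y; rewrite /gam scalerA [k * _]mulrC -scalerA -scalerDr; congr (_ *: _).
rewrite scaler_sumr -big_split; apply: eq_bigr => a _ /=.
by rewrite (linP (lbo _)) mulrDl palg_scaleAl.
Qed.

(** The Leibniz terms with $[z,e^a]$ are moved onto $e_a$ by [dual_slide], after which the Jacobi
    identity combines them with the others. *)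
Lemma odd_quad_der (D : A -> A) z y : twder id D ->
  (forall x, D (o x) = o (lie_bracket z x)) -> D (gam y) = gam (lie_bracket z y).
Proof.
move=> hD Do; rewrite /gam (linZ (twderL hD)) (lin_sum (twderL hD)); congr (_ *: _).
transitivity (\sum_a o (lie_bracket z (lie_bracket y (tnth e a))) * o (tnth f a)
   + \sum_a o (lie_bracket y (tnth e a)) * o (lie_bracket z (tnth f a))).
  by rewrite -big_split; apply: eq_bigr => a _; rewrite (twderM hD) !Do.
have S : \sum_a o (lie_bracket y (tnth e a)) * o (lie_bracket z (tnth f a))
    = - \sum_a o (lie_bracket y (lie_bracket z (tnth e a))) * o (tnth f a).
  apply/eqP; rewrite -eqr_oppLR; apply/eqP/esym.
  apply: (dual_slide ef (b := fun u v => o (lie_bracket y u) * o v)) => x k u v.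
    by rewrite lo mulrDr palg_scaleAr.
  by rewrite (linP (lob y)) mulrDl palg_scaleAl.
rewrite S -sumrB; apply: eq_bigr => a _.
rewrite -mulrBl -(linB lo); congr (o _ * _); apply/eqP.
by rewrite subr_eq lie_leibniz.
Qed.

(** Each of the two factors contributes $[z,y]$, which cancels the one half. The even generator has
    the same contraction, so the hatted element is horizontal. *)
Lemma odd_quad_iota (p D : A -> A) z y : twder p D ->
  (forall x, p (o x) = - o x) -> (forall x, D (o x) = quad_form z x *: (1 : A)) ->
  D (gam y) = o (lie_bracket z y).
Proof.
move=> hD po Do; rewrite /gam (linZ (twderL hD)) (lin_sum (twderL hD)).
transitivity (2^-1 *: (o (lie_bracket z y) - o (lie_bracket y z))); last first.
  by rewrite [lie_bracket y z]lie_antisym (linN lo) opprK halfF.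
congr (_ *: _); transitivity (\sum_a quad_form (lie_bracket z y) (tnth e a) *: o (tnth f a)
    - \sum_a quad_form z (tnth f a) *: o (lie_bracket y (tnth e a))).
  rewrite -sumrB; apply: eq_bigr => a _; rewrite (twderM hD) !Do po scalarl mulNr scalarr.
  by rewrite quad_invariant.
congr (_ - _).
  rewrite [in RHS](dual_expandr ef (lie_bracket z y)) (lin_sum lo).
  by apply: eq_bigr => a _; rewrite (linZ lo).
rewrite {2}(dual_expandl ef z) (lin_sum (lob y)).
by apply: eq_bigr => a _; rewrite (linZ (lob y)).
Qed.

Lemma odd_quad_fix (p : A -> A) z : algebra_hom p -> (forall x, p (o x) = - o x) ->
  p (gam z) = gam z.
Proof.
move=> hp po; rewrite /gam (linZ (homL hp)) (lin_sum (homL hp)); congr (_ *: _).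
by apply: eq_bigr => a _; rewrite (homM hp) !po mulrNN.
Qed.

Lemma odd_quad_comm u z : (forall x, u * o x = o x * u) -> u * gam z = gam z * u.
Proof.
move=> h; rewrite /gam -palg_scaleAr -palg_scaleAl mulr_sumr mulr_suml; congr (_ *: _).
by apply: eq_bigr => a _; rewrite -mulrA -h !mulrA h.
Qed.

(** The spin representation: for [c0 = 1] commutators with $\gamma(z)$ give the adjoint action on
    odd generators. Subtracting it from the even generator leaves an element commuting with the odd
    ones. *)
Lemma odd_quad_odd z x : gam z * o x = o x * gam z + c0 *: o (lie_bracket z x).
Proof.
rewrite /gam -palg_scaleAr -palg_scaleAl mulr_sumr mulr_suml.
transitivity (2^-1 *: ((\sum_a o x * (o (lie_bracket z (tnth e a)) * o (tnth f a)))
   + (c0 *: o (lie_bracket z x) + c0 *: o (lie_bracket z x)))); last first.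
  by rewrite scalerDr halfF.
congr (_ *: _).
have E1 : c0 *: o (lie_bracket z x)
    = \sum_a (c0 * quad_form (tnth f a) x) *: o (lie_bracket z (tnth e a)).
  rewrite {1}(dual_expandl ef x) (lin_sum (lob z)) scaler_sumr; apply: eq_bigr => a _.
  by rewrite (linZ (lob z)) scalerA quad_sym.
have E2 : c0 *: o (lie_bracket z x)
    = - \sum_a (c0 * quad_form (lie_bracket z (tnth e a)) x) *: o (tnth f a).
  rewrite {1}(dual_expandr ef (lie_bracket z x)) (lin_sum lo) scaler_sumr -sumrN.
  apply: eq_bigr => a _; rewrite (linZ lo) scalerA -scaleNr -mulrN; congr (_ * _ *: _).
  by apply: etrans (quad_invl _ _ _) _; rewrite quad_sym.
rewrite {1}E1 E2 -sumrB -big_split; apply: eq_bigr => a _ /=.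
rewrite -mulrA oo mulrBr scalarr [in RHS]mulrA.
have -> : o x * o (lie_bracket z (tnth e a)) =
    (c0 * quad_form (lie_bracket z (tnth e a)) x) *: (1 : A)
      - o (lie_bracket z (tnth e a)) * o x.
  by rewrite oo quad_sym.
by rewrite mulrBl scalarl !mulrA; abel.
Qed.

End OddQuadratic.

Section HorizontalKernel.
Variables (F : fieldType) (charF0 : [pchar F] =i pred0).
Variables (g : quadLieAlgType F) (e f : (\dim {:g}).-tuple g).
Hypothesis ef : dual_bases e f.
Variables (X : Type) (R : pterm F X -> pterm F X -> Prop).
Variables (Y : Type) (S : pterm F Y -> pterm F Y -> Prop).
Notation A := (palg R).
Variables (o : g -> A) (c0 : F) (p : A -> A) (iota : g -> A -> A) (j : palg S -> A).
Hypotheses (lo : linear o)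
  (oo : forall x y, o x * o y = (c0 * quad_form x y) *: (1 : A) - o y * o x)
  (hp : algebra_hom p) (po : forall x, p (o x) = - o x)
  (hi : forall z, twder p (iota z)) (li : forall x, linear (iota^~ x))
  (io : forall z x, iota z (o x) = quad_form z x *: (1 : A))
  (hj : algebra_hom j) (jo : forall u x, j u * o x = o x * j u)
  (pj : forall u, p (j u) = j u) (ij : forall z u, iota z (j u) = 0).

Definition oword (s : seq g) : A := \prod_(x <- s) o x.

Lemma oword_cons x s : oword (x :: s) = o x * oword s.
Proof. by rewrite /oword big_cons. Qed.

Inductive ofil (n : nat) : A -> Prop :=
| ofil_mon u s : (size s < n)%N -> ofil n (j u * oword s)
| ofil0 : ofil n 0
| ofilD x y : ofil n x -> ofil n y -> ofil n (x + y).

Lemma ofilZ n a x : ofil n x -> ofil n (a *: x).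
Proof.
elim=> [u s sn||y z _ IHy _ IHz]; last by rewrite scalerDr; apply: ofilD.
  by rewrite palg_scaleAl -(linZ (homL hj)); apply: ofil_mon.
by rewrite scaler0; apply: ofil0.
Qed.

Lemma ofilB n x y : ofil n x -> ofil n y -> ofil n (x - y).
Proof. by move=> hx hy; rewrite -[- y]scaleN1r; apply: ofilD => //; apply: ofilZ. Qed.

Lemma ofil_le n m x : (n <= m)%N -> ofil n x -> ofil m x.
Proof.
move=> nm; elim=> [u s sn||y z _ IHy _ IHz]; [|exact: ofil0|exact: ofilD].
by apply: ofil_mon; apply: leq_trans nm.
Qed.

Lemma ofil_jmul n u x : ofil n x -> ofil n (j u * x).
Proof.
elim=> [v s sn||y z _ IHy _ IHz].
- by rewrite mulrA -(homM hj); apply: ofil_mon.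
- by rewrite mulr0; apply: ofil0.
- by rewrite mulrDr; apply: ofilD.
Qed.

Lemma ofil_omul n z x : ofil n x -> ofil n.+1 (o z * x).
Proof.
elim=> [v s sn||y w _ IHy _ IHw].
- by rewrite mulrA -jo -mulrA -oword_cons; apply: ofil_mon.
- by rewrite mulr0; apply: ofil0.
- by rewrite mulrDr; apply: ofilD.
Qed.

Lemma ofil_mul n m x y : ofil n x -> ofil m y -> ofil (n + m) (x * y).
Proof.
move=> hx hy; elim: hx => [u s sn||x1 x2 _ IH1 _ IH2].
- rewrite -mulrA; apply: ofil_jmul; elim: s n sn => [|z s IH] n sn.
    by rewrite /oword big_nil mul1r; apply: ofil_le hy; rewrite leq_addl.
  case: n sn => // n sn.
  by rewrite oword_cons -mulrA addSn; apply/ofil_omul/IH.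
- by rewrite mul0r; apply: ofil0.
- by rewrite mulrDl; apply: ofilD.
Qed.

Lemma ofil_oword n s : (size s < n)%N -> ofil n (oword s).
Proof. by move=> sn; rewrite -[oword s]mul1r -(hom1 hj); apply: ofil_mon. Qed.

Lemma ofil_exhaustive : (forall x, exists n, ofil n (pgen R x)) ->
  forall x, exists n, ofil n x.
Proof.
move=> h; elim/palg_ind=> [x|a|x y [n hx] [m hy]|x y [n hx] [m hy]].
- exact: h.
- by exists 1%N; apply: ofilZ; have := @ofil_oword 1 [::] isT; rewrite /oword big_nil.
- exists (n + m)%N; apply: ofilD; [apply: ofil_le hx|apply: ofil_le hy].
    by rewrite leq_addr.
  by rewrite leq_addl.
- by exists (n + m)%N; apply: ofil_mul.
Qed.

Lemma iota_oword z s : ofil (size s) (iota z (oword s)).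
Proof.
elim: s => [|x s IH].
  by rewrite /oword big_nil (twder1 hp (hi z)); apply: ofil0.
rewrite oword_cons (twderM (hi z)) io scalarl po mulNr; apply: ofilB.
  by apply: ofilZ; apply: ofil_oword.
exact: ofil_omul.
Qed.

(* The number operator of odd generators, up to terms of lower odd degree. *)
Definition onum (x : A) : A := \sum_a o (tnth e a) * iota (tnth f a) x.

Lemma onum_linear : linear onum.
Proof.
move=> k x y; rewrite /onum scaler_sumr -big_split; apply: eq_bigr => a _ /=.
by rewrite (linP (twderL (hi _))) mulrDr palg_scaleAr.
Qed.

(** Moving $e_a$ past the first letter only costs a Clifford term with coefficient [c0], which has
    lower odd degree. *)
Lemma onum_oword s : ofil (size s) (onum (oword s) - (size s)%:R *: oword s).
Proof.
elim: s => [|z s IH].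
  rewrite scale0r subr0 /onum big1 => [|a _]; first exact: ofil0.
  by rewrite /oword big_nil (twder1 hp (hi _)) mulr0.
have -> : onum (oword (z :: s)) - (size (z :: s))%:R *: oword (z :: s)
  = o z * (onum (oword s) - (size s)%:R *: oword s) - c0 *: iota z (oword s).
  have E : onum (oword (z :: s)) = o z * oword s + o z * onum (oword s)
      - c0 *: iota z (oword s).
    have Ez : o z = \sum_a quad_form z (tnth f a) *: o (tnth e a).
      rewrite {1}(dual_expandl ef z) (lin_sum lo).
      by apply: eq_bigr => a _; rewrite (linZ lo).
    have Ei : iota z (oword s) = \sum_a quad_form z (tnth e a) *: iota (tnth f a) (oword s).
      rewrite {1}(dual_expandr ef z) (lin_sum (li _)).
      by apply: eq_bigr => a _; rewrite (linZ (li _)).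
    rewrite {1}Ez Ei mulr_suml /onum mulr_sumr scaler_sumr.
    rewrite -big_split -sumrB; apply: eq_bigr => a _ /=.
    rewrite oword_cons (twderM (hi _)) io po scalarl mulNr mulrBr -palg_scaleAr.
    rewrite [quad_form (tnth f a) z]quad_sym -palg_scaleAl.
    rewrite -!addrA; congr (_ + _).
    rewrite [o (tnth e a) * (_ * _)]mulrA [o z * (_ * _)]mulrA oo mulrBl scalarl scalerA.
    by rewrite [quad_form (tnth e a) z]quad_sym; abel.
  by rewrite E -natr1 scalerDl scale1r mulrBr -oword_cons -palg_scaleAr -oword_cons; abel.
apply: ofilB; first exact: ofil_omul.
by apply: ofilZ; apply: ofil_le (iota_oword z s).
Qed.

Lemma onum_ofil n x : ofil n.+2 x -> ofil n.+1 (onum x - n.+1%:R *: x).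
Proof.
elim=> [u s sn||y z _ IHy _ IHz].
- have -> : onum (j u * oword s) = j u * onum (oword s).
    rewrite /onum mulr_sumr; apply: eq_bigr => a _.
    by rewrite (twderM (hi _)) ij pj mul0r add0r !mulrA jo.
  have -> : j u * onum (oword s) - n.+1%:R *: (j u * oword s)
    = j u * (onum (oword s) - (size s)%:R *: oword s)
      + ((size s)%:R - n.+1%:R) *: (j u * oword s).
    by rewrite mulrBr scalerBl -palg_scaleAr; abel.
  apply: ofilD.
    by apply/ofil_jmul/(ofil_le _ (onum_oword s)); rewrite -ltnS.
  move: sn; rewrite ltnS leq_eqVlt => /orP[/eqP->|sn].
    by rewrite subrr scale0r; apply: ofil0.
  by apply/ofilZ/ofil_mon.
- by rewrite (lin0 onum_linear) scaler0 subr0; apply: ofil0.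
- rewrite (linD onum_linear) scalerDr.
  have -> : onum y + onum z - (n.+1%:R *: y + n.+1%:R *: z)
     = (onum y - n.+1%:R *: y) + (onum z - n.+1%:R *: z) by abel.
  exact: ofilD.
Qed.

(** On a horizontal element [onum] vanishes, while to leading order it multiplies by the odd degree.
    In characteristic zero the leading part therefore vanishes until degree zero, the image of [j],
    is reached. *)
Lemma horizontal_image x : (forall x, exists n, ofil n (pgen R x)) ->
  (forall z, iota z x = 0) -> exists u, x = j u.
Proof.
move=> h ix; have [n hn] := ofil_exhaustive h x.
have : ofil n.+1 x by apply: ofil_le hn.
elim: n {hn} => [|n IH] hx; last first.
  apply: IH; have := onum_ofil hx.
  have -> : onum x = 0 by rewrite /onum big1 // => a _; rewrite ix mulr0.
  rewrite sub0r -scaleNr => /(ofilZ (- n.+1%:R)^-1).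
  by rewrite scalerA mulVf ?scale1r // oppr_eq0 natF_neq0.
elim: hx => [u [|//] _||y z _ [u ->] _ [v ->]].
- by exists u; rewrite /oword big_nil mulr1.
- by exists 0; rewrite (lin0 (homL hj)).
- by exists (u + v); rewrite (linD (homL hj)).
Qed.
End HorizontalKernel.

Section HorizontalEmbeddings.
Variables (F : fieldType) (charF0 : [pchar F] =i pred0).
Variables (g : quadLieAlgType F) (e f : (\dim {:g}).-tuple g).
Hypothesis ef : dual_bases e f.
Notation W := (weilAlg g).
Notation NW := (ncWeilAlg g).
Notation wlam := (odd_quad e f (@wo F g)).
Notation ngam := (odd_quad e f (@nco F g)).

Let wlo : linear (@wo F g) := @wo_linear F g.
Let nlo : linear (@nco F g) := @nco_linear F g.

Let woo x y : wo x * wo y = (0 * quad_form x y) *: (1 : W) - wo y * wo x.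
Proof. by rewrite mul0r scale0r sub0r wo_wo. Qed.

Let noo x y : nco x * nco y = (1 * quad_form x y) *: (1 : NW) - nco y * nco x.
Proof. by rewrite mul1r nco_nco. Qed.

Lemma weil_hatE z : weil_hat e f z = we z - wlam z. Proof. by []. Qed.
Lemma ncweil_hatE z : ncweil_hat e f z = nce z - ngam z. Proof. by []. Qed.

Lemma weil_hat_linear : linear (weil_hat e f).
Proof.
move=> k x y; rewrite !weil_hatE (linP (@we_linear _ _)).
by rewrite (linP (odd_quad_linear e f wlo)) scalerBr; abel.
Qed.

Lemma ncweil_hat_linear : linear (ncweil_hat e f).
Proof.
move=> k x y; rewrite !ncweil_hatE (linP (@nce_linear _ _)).
by rewrite (linP (odd_quad_linear e f nlo)) scalerBr; abel.
Qed.

Lemma weil_hat_wo z x : weil_hat e f z * wo x = wo x * weil_hat e f z.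
Proof.
rewrite weil_hatE mulrBl mulrBr we_wo (odd_quad_odd charF0 ef wlo woo).
by rewrite scale0r addr0.
Qed.

Lemma ncweil_hat_nco z x : ncweil_hat e f z * nco x = nco x * ncweil_hat e f z.
Proof.
rewrite ncweil_hatE mulrBl mulrBr nce_nco (odd_quad_odd charF0 ef nlo noo).
by rewrite scale1r; abel.
Qed.

Lemma weil_hat_comm x y : weil_hat e f x * weil_hat e f y = weil_hat e f y * weil_hat e f x.
Proof.
have K u z : u * we z = we z * u -> (forall t, u * wo t = wo t * u) ->
    u * weil_hat e f z = weil_hat e f z * u.
  move=> he ho; have h : u * wlam z = wlam z * u by apply: odd_quad_comm.
  by rewrite weil_hatE mulrBr mulrBl he h.
apply: (K) (weil_hat_wo x); apply/esym/(K) => [|t]; [exact: we_we|exact: we_wo].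
Qed.

(** Since $\widehat y$ commutes with $\gamma(x)$, the commutator of $\widehat x$ with it is that of
    $\overline x$, and the Lie derivative acts on hatted elements by the bracket. *)
Lemma ncweil_hat_comm x y : ncweil_hat e f x * ncweil_hat e f y
  = ncweil_hat e f y * ncweil_hat e f x + ncweil_hat e f (lie_bracket x y).
Proof.
have h : ncweil_hat e f y * ngam x = ngam x * ncweil_hat e f y.
  by apply: odd_quad_comm => t; apply: ncweil_hat_nco.
have E : nlie x (ncweil_hat e f y) = ncweil_hat e f (lie_bracket x y).
  rewrite !ncweil_hatE (linB (twderL (nlie_twder x))) nlie_nce.
  by rewrite (odd_quad_der ef nlo _ (nlie_twder x) (nlie_nco x)).
rewrite -E /nlie; move: (ncweil_hat e f y) h => Y h.
by rewrite ncweil_hatE mulrBl mulrBr h; abel.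
Qed.

Definition ihom : symAlg g -> W := phom (weil_hat e f).
Definition jhom : envAlg g -> NW := phom (ncweil_hat e f).

Let ihom_rel s t : sym_rel s t ->
  peval (@pconst F _ (@weil_rel F g)) (weil_hat e f) s
  = peval (@pconst F _ (@weil_rel F g)) (weil_hat e f) t.
Proof.
case=> [k x y|x y] /=; last exact: weil_hat_comm.
by rewrite pconstE scalarl weil_hat_linear.
Qed.

Let jhom_rel s t : env_rel s t ->
  peval (@pconst F _ (@ncweil_rel F g)) (ncweil_hat e f) s
  = peval (@pconst F _ (@ncweil_rel F g)) (ncweil_hat e f) t.
Proof.
case=> [k x y|x y]; rewrite ?pevalB /=.
  by rewrite pconstE scalarl ncweil_hat_linear.
by rewrite ncweil_hat_comm addrC addKr.
Qed.

Lemma ihom_algebra : algebra_hom ihom. Proof. exact: phom_hom ihom_rel. Qed.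
Lemma jhom_algebra : algebra_hom jhom. Proof. exact: phom_hom jhom_rel. Qed.
Lemma ihom_gen z : ihom (symGen z) = weil_hat e f z.
Proof. exact: phom_gen ihom_rel z. Qed.
Lemma jhom_gen z : jhom (envGen z) = ncweil_hat e f z.
Proof. exact: phom_gen jhom_rel z. Qed.

Lemma ihom_wo u x : ihom u * wo x = wo x * ihom u.
Proof.
have hi := ihom_algebra.
elim/palg_ind: u => [z|a|u v IHu IHv|u v IHu IHv].
- by rewrite ihom_gen weil_hat_wo.
- by rewrite (linZ (homL hi)) (hom1 hi) scalarl scalarr.
- by rewrite (linD (homL hi)) mulrDl mulrDr IHu IHv.
- by rewrite (homM hi) -mulrA IHv mulrA IHu mulrA.
Qed.

Lemma jhom_nco u x : jhom u * nco x = nco x * jhom u.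
Proof.
have hj := jhom_algebra.
elim/palg_ind: u => [z|a|u v IHu IHv|u v IHu IHv].
- by rewrite jhom_gen ncweil_hat_nco.
- by rewrite (linZ (homL hj)) (hom1 hj) scalarl scalarr.
- by rewrite (linD (homL hj)) mulrDl mulrDr IHu IHv.
- by rewrite (homM hj) -mulrA IHv mulrA IHu mulrA.
Qed.

Lemma ihom_par u : wpar (ihom u) = ihom u.
Proof.
move: u; apply: (@hom_ext _ _ _ _ _ (@wpar F g \o ihom) ihom).
- exact: hom_comp (@wpar_hom F g) ihom_algebra.
- exact: ihom_algebra.
move=> z /=; rewrite ihom_gen weil_hatE (linB (homL (@wpar_hom F g))) wpar_we.
by rewrite (odd_quad_fix _ _ _ (@wpar_hom F g) (@wpar_wo F g)).
Qed.

Lemma jhom_par u : npar (jhom u) = jhom u.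
Proof.
move: u; apply: (@hom_ext _ _ _ _ _ (@npar F g \o jhom) jhom).
- exact: hom_comp (@npar_hom F g) jhom_algebra.
- exact: jhom_algebra.
move=> z /=; rewrite jhom_gen ncweil_hatE (linB (homL (@npar_hom F g))) npar_nce.
by rewrite (odd_quad_fix _ _ _ (@npar_hom F g) (@npar_nco F g)).
Qed.

Lemma ihom_iota z u : wiota z (ihom u) = 0.
Proof.
have hi := ihom_algebra; have hD := wiota_twder z.
elim/palg_ind: u => [x|a|u v IHu IHv|u v IHu IHv].
- rewrite ihom_gen weil_hatE (linB (twderL hD)) wiota_we.
  by rewrite (odd_quad_iota charF0 ef wlo _ hD (@wpar_wo F g) (wiota_wo z)) subrr.
- by rewrite (linZ (homL hi)) (hom1 hi) (linZ (twderL hD)) (twder1 (@wpar_hom F g) hD) scaler0.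
- by rewrite (linD (homL hi)) (linD (twderL hD)) IHu IHv addr0.
- by rewrite (homM hi) (twderM hD) IHu IHv mul0r mulr0 addr0.
Qed.

Lemma jhom_iota z u : niota z (jhom u) = 0.
Proof. by rewrite /niota jhom_par jhom_nco subrr. Qed.

Lemma weil_horizontal x : (forall z, wiota z x = 0) -> exists u, x = ihom u.
Proof.
move=> hx; have := horizontal_image charF0 ef wlo woo (@wpar_hom F g) (@wpar_wo F g)
  (@wiota_twder F g) (@wiota_linear F g) (@wiota_wo F g) ihom_algebra ihom_wo ihom_par ihom_iota _ hx.
apply; case=> y; rewrite -/(wo y) -/(we y).
  by exists 2%N; have := @ofil_oword _ _ _ _ _ _ (@wo F g) _ ihom_algebra 2 [:: y] isT;
     rewrite /oword big_seq1.
(* The even generator is a hatted element plus a quadratic odd term, so its odd degree is at most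
   two; the bound 3 is strict. *)
exists 3%N; rewrite -[we y](subrK (wlam y)) -weil_hatE -ihom_gen; apply: ofilD.
  by have := @ofil_mon _ _ _ _ _ _ (@wo F g) ihom 3 (symGen y) [::] isT;
     rewrite /oword big_nil mulr1.
apply: (ofilZ ihom_algebra); apply: big_ind; [exact: ofil0|exact: ofilD|move=> a _].
by have := @ofil_oword _ _ _ _ _ _ (@wo F g) _ ihom_algebra 3
     [:: lie_bracket y (tnth e a); tnth f a] isT; rewrite /oword big_cons big_seq1.
Qed.

Lemma ncweil_horizontal x : (forall z, niota z x = 0) -> exists u, x = jhom u.
Proof.
move=> hx; have := horizontal_image charF0 ef nlo noo (@npar_hom F g) (@npar_nco F g)
  (@niota_twder F g) (@niota_linear F g) (@niota_nco F g) jhom_algebra jhom_nco jhom_par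
  jhom_iota _ hx.
apply; case=> y; rewrite -/(nco y) -/(nce y).
  by exists 2%N; have := @ofil_oword _ _ _ _ _ _ (@nco F g) _ jhom_algebra 2 [:: y] isT;
     rewrite /oword big_seq1.
exists 3%N; rewrite -[nce y](subrK (ngam y)) -ncweil_hatE -jhom_gen; apply: ofilD.
  by have := @ofil_mon _ _ _ _ _ _ (@nco F g) jhom 3 (envGen y) [::] isT;
     rewrite /oword big_nil mulr1.
apply: (ofilZ jhom_algebra); apply: big_ind; [exact: ofil0|exact: ofilD|move=> a _].
by have := @ofil_oword _ _ _ _ _ _ (@nco F g) _ jhom_algebra 3
     [:: lie_bracket y (tnth e a); tnth f a] isT; rewrite /oword big_cons big_seq1.
Qed.

Lemma ihom_ad z u : wlie z (ihom u) = ihom (sym_ad z u).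
Proof.
have hi := ihom_algebra; have hD := wlie_twder z.
elim/palg_ind: u => [x|a|u v IHu IHv|u v IHu IHv].
- rewrite sym_ad_gen !ihom_gen !weil_hatE (linB (twderL hD)) wlie_we.
  by rewrite (odd_quad_der ef wlo _ hD (wlie_wo z)).
- have ad1 : sym_ad z (1 : symAlg g) = 0.
    by apply: (twder1 (hom_id _) (D := sym_ad z)); split; [exact: sym_ad_linear|exact: sym_adM].
  rewrite (linZ (homL hi)) (hom1 hi) (linZ (twderL hD)) (twder1 (hom_id _) hD) scaler0.
  by rewrite (linZ (sym_ad_linear z)) ad1 scaler0 (lin0 (homL hi)).
- by rewrite (linD (sym_ad_linear z)) !(linD (homL hi)) (linD (twderL hD)) IHu IHv.
- by rewrite sym_adM (linD (homL hi)) !(homM hi) (twderM hD) IHu IHv.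
Qed.

Lemma jhom_ad z u : nlie z (jhom u) = jhom (env_ad z u).
Proof.
have hi := jhom_algebra; have hD := @nlie_twder F g z.
elim/palg_ind: u => [x|a|u v IHu IHv|u v IHu IHv].
- rewrite env_ad_gen !jhom_gen !ncweil_hatE (linB (twderL hD)) nlie_nce.
  by rewrite (odd_quad_der ef nlo _ hD (nlie_nco z)).
- have ad1 : env_ad z (1 : envAlg g) = 0.
    by apply: (twder1 (hom_id _) (D := env_ad z)); split; [exact: env_ad_linear|exact: env_adM].
  rewrite (linZ (homL hi)) (hom1 hi) (linZ (twderL hD)) (twder1 (hom_id _) hD) scaler0.
  by rewrite (linZ (env_ad_linear z)) ad1 scaler0 (lin0 (homL hi)).
- by rewrite (linD (env_ad_linear z)) !(linD (homL hi)) (linD (twderL hD)) IHu IHv.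
- by rewrite env_adM (linD (homL hi)) !(homM hi) (twderM hD) IHu IHv.
Qed.

Let zl : linear (fun _ : g => 0 : symAlg g).
Proof. by move=> a x y; rewrite scaler0 addr0. Qed.
Let sl : linear (fun x : g => symGen x : symAlg g).
Proof. by move=> a x y; apply: sym_genP. Qed.
Let seo (x y : g) : symGen x * (0 : symAlg g) = 0 * symGen x.
Proof. by rewrite mulr0 mul0r. Qed.
Let soo (x y : g) : (0 : symAlg g) * 0 = - (0 * 0). Proof. by rewrite mulr0 oppr0. Qed.

(** Killing the odd generators is an algebra retraction. *)
Lemma ihom_inj : injective ihom.
Proof.
pose r : W -> symAlg g := weil_hom (fun=> 0) (fun x => symGen x).
have hr : algebra_hom r := weil_hom_algebra zl sl (@sym_genC F g) seo soo.
have re x : r (we x) = symGen x := weil_hom_we zl sl (@sym_genC F g) seo soo x.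
have ro x : r (wo x) = 0 := weil_hom_wo zl sl (@sym_genC F g) seo soo x.
apply: (can_inj (g := r)); apply: (@hom_ext _ _ _ _ _ (r \o ihom) id).
- exact: hom_comp hr ihom_algebra.
- exact: hom_id.
move=> z /=; rewrite ihom_gen weil_hatE (linB (homL hr)).
rewrite re (linZ (homL hr)) (lin_sum (homL hr)).
rewrite big1 ?scaler0 ?subr0 // => a _; rewrite (homM hr).
by rewrite ro mul0r.
Qed.

(* An odd horizontal element vanishes since the horizontal subalgebra is even;
   this makes basic elements closed. *)
Lemma ncweil_odd_horizontal (x : NW) : (forall z, niota z x = 0) -> npar x = - x -> x = 0.
Proof.
move=> /ncweil_horizontal[u ->]; rewrite jhom_par => /eqP; rewrite -addr_eq0 => /eqP E.
by rewrite -[LHS](halfF charF0) E scaler0.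
Qed.

Lemma weil_odd_horizontal (x : W) : (forall z, wiota z x = 0) -> wpar x = - x -> x = 0.
Proof.
move=> /weil_horizontal[u ->]; rewrite ihom_par => /eqP; rewrite -addr_eq0 => /eqP E.
by rewrite -[LHS](halfF charF0) E scaler0.
Qed.

(** For the image $w$ of an invariant, $\iota_z dw = L_z w - d\iota_z w = 0$, so $dw$ is odd and
    horizontal. *)
Lemma basic_closed u : sym_inv g u -> wd (ihom u) = 0.
Proof.
move=> inv; apply: weil_odd_horizontal => [z|].
  have := wcartan z (ihom u); rewrite ihom_iota (lin0 (twderL (@wd_twder F g))) addr0 => ->.
  by rewrite ihom_ad inv (lin0 (homL ihom_algebra)).
by rewrite -[in RHS]ihom_par wd_par opprK.
Qed.

End HorizontalEmbeddings.

(* The tensor product of the enveloping and Clifford algebras of [g]. *)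
Inductive envcliff_rel (F : fieldType) (g : quadLieAlgType F) :
    pterm F (weil_gen g) -> pterm F (weil_gen g) -> Prop :=
| EnvCliffOddLinear a (x y : g) :
    envcliff_rel (PGen (WOdd (a *: x + y)%R))
                 (PConst a * PGen (WOdd x) + PGen (WOdd y))
| EnvCliffEvenLinear a (x y : g) :
    envcliff_rel (PGen (WEven (a *: x + y)%R))
                 (PConst a * PGen (WEven x) + PGen (WEven y))
| EnvCliffEvenEven (x y : g) :
    envcliff_rel (PGen (WEven x) * PGen (WEven y) - PGen (WEven y) * PGen (WEven x))
                 (PGen (WEven (lie_bracket x y)))
| EnvCliffEvenOdd (x y : g) :
    envcliff_rel (PGen (WEven x) * PGen (WOdd y) - PGen (WOdd y) * PGen (WEven x))
                 (PConst 0%R)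
| EnvCliffOddOdd (x y : g) :
    envcliff_rel (PGen (WOdd x) * PGen (WOdd y) + PGen (WOdd y) * PGen (WOdd x))
                 (PConst (quad_form x y)).

(** * A linear retraction onto the enveloping algebra *)

Section EnvCliff.
Variables (F : fieldType) (charF0 : [pchar F] =i pred0).
Variables (g : quadLieAlgType F) (e f : (\dim {:g}).-tuple g).
Hypothesis ef : dual_bases e f.
Notation W := (weilAlg g).
Notation NW := (ncWeilAlg g).
Notation U := (envAlg g).
Notation UC := (palg (@envcliff_rel F g)).

Definition uco (x : g) : UC := pgen _ (WOdd x).
Definition uce (x : g) : UC := pgen _ (WEven x).

Lemma uco_linear : linear uco.
Proof.
move=> a x y; rewrite /uco; apply: etrans; first exact/palg_rel/EnvCliffOddLinear.
by rewrite pclassD pclassM pclass_const scalarl.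
Qed.

Lemma uce_linear : linear uce.
Proof.
move=> a x y; rewrite /uce; apply: etrans; first exact/palg_rel/EnvCliffEvenLinear.
by rewrite pclassD pclassM pclass_const scalarl.
Qed.

Lemma uce_uce x y : uce x * uce y = uce y * uce x + uce (lie_bracket x y).
Proof.
apply/eqP; rewrite addrC -subr_eq -!pclassM -pclassB; apply/eqP.
exact/palg_rel/EnvCliffEvenEven.
Qed.

Lemma uce_uco x y : uce x * uco y = uco y * uce x.
Proof.
apply/eqP; rewrite -subr_eq0 -!pclassM -pclassB; apply/eqP.
exact/palg_rel/EnvCliffEvenOdd.
Qed.

Lemma uco_uco x y : uco x * uco y = (1 * quad_form x y) *: (1 : UC) - uco y * uco x.
Proof.
apply/eqP; rewrite mul1r eq_sym subr_eq eq_sym -!pclassM -pclassD -pclass_const; apply/eqP.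
exact/palg_rel/EnvCliffOddOdd.
Qed.

Notation ugam := (odd_quad e f uco).

Let ugam_uco z x : ugam z * uco x = uco x * ugam z + uco (lie_bracket z x).
Proof. by rewrite (odd_quad_odd charF0 ef uco_linear uco_uco) scale1r. Qed.

Let uce_ugam z y : uce z * ugam y = ugam y * uce z.
Proof. by apply: odd_quad_comm => t; apply: uce_uco. Qed.

Let ugam_ugam x y : ugam x * ugam y = ugam y * ugam x + ugam (lie_bracket x y).
Proof.
pose D (u : UC) := ugam x * u - u * ugam x.
have hD : twder id D := inner_twder (ugam x).
have Do t : D (uco t) = uco (lie_bracket x t) by rewrite /D ugam_uco; abel.
by rewrite -(odd_quad_der ef uco_linear _ hD Do) /D; abel.
Qed.

(** Undoes the shift by $\gamma$: hatted elements go to the even generators [uce], which commute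
    with the odd ones. *)
Definition ncweil_envcliff : NW -> UC := ncweil_hom uco (fun z => uce z + ugam z).

Let even_linear : linear (fun z => uce z + ugam z).
Proof.
by move=> a x y; rewrite uce_linear (odd_quad_linear e f uco_linear) scalerDr; abel.
Qed.

Let ee x y : (uce x + ugam x) * (uce y + ugam y) =
  (uce y + ugam y) * (uce x + ugam x) + (uce (lie_bracket x y) + ugam (lie_bracket x y)).
Proof.
by rewrite !mulrDl !mulrDr uce_uce ugam_ugam (uce_ugam x y) (uce_ugam y x); abel.
Qed.

Let eo x y : (uce x + ugam x) * uco y = uco y * (uce x + ugam x) + uco (lie_bracket x y).
Proof. by rewrite mulrDl mulrDr uce_uco ugam_uco; abel. Qed.

Let oo x y : uco x * uco y = quad_form x y *: (1 : UC) - uco y * uco x.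
Proof. by rewrite uco_uco mul1r. Qed.

Lemma ncweil_envcliff_hom : algebra_hom ncweil_envcliff.
Proof. exact: ncweil_hom_algebra uco_linear even_linear ee eo oo. Qed.
Lemma ncweil_envcliff_nco x : ncweil_envcliff (nco x) = uco x.
Proof. exact: ncweil_hom_nco uco_linear even_linear ee eo oo x. Qed.
Lemma ncweil_envcliff_nce x : ncweil_envcliff (nce x) = uce x + ugam x.
Proof. exact: ncweil_hom_nce uco_linear even_linear ee eo oo x. Qed.

(* The Clifford algebra acts on [W] by [x |-> x /\ + iota_x / 2], hence, as its
   relations are symmetric, also on maps from [W] by precomposition. *)
Definition cliff_op (x : g) (w : W) : W :=
  wo x * w + 2^-1 *: wodd (quad_form x) \0 \0 w.

Definition envcliff_op (t : weil_gen g) (m : W -> U) : W -> U :=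
  match t with
  | WOdd x => fun w => m (cliff_op x w)
  | WEven z => fun w => envGen z * m w
  end.

Let cD x := @wodd_twder F g (quad_form x) \0 \0.

Lemma cliff_op_linear x : linear (cliff_op x).
Proof.
move=> a u v; rewrite /cliff_op (linP (twderL (cD x))) mulrDr -palg_scaleAr !scalerDr.
by rewrite !scalerA [2^-1 * a]mulrC; abel.
Qed.

Lemma cliff_op_linearl w : linear (cliff_op^~ w).
Proof.
move=> a x y; rewrite /cliff_op (linP (@wo_linear _ _)) mulrDl -palg_scaleAl.
have -> : wodd (quad_form (a *: x + y)) \0 \0 w
    = a *: wodd (quad_form x) \0 \0 w + wodd (quad_form y) \0 \0 w.
  move: w; apply: (twder_ext (@wpar_hom F g)); first exact: wodd_twder.
    by apply: twderD; [apply: twderZ|]; apply: wodd_twder.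
  case=> z; rewrite -/(wo z) -/(we z) ?wodd_wo ?wodd_we.
    by rewrite /= quadPl (lin0 (@we_linear _ _)) !addr0 scalerDl scalerA.
  by rewrite (lin0 (@wo_linear _ _)) scaler0 addr0.
by rewrite !scalerDr !scalerA [2^-1 * a]mulrC; abel.
Qed.

Lemma cliff_op_op x y w :
  cliff_op x (cliff_op y w) + cliff_op y (cliff_op x w) = quad_form x y *: w.
Proof.
have anti : wodd (quad_form x) \0 \0 (wodd (quad_form y) \0 \0 w)
    + wodd (quad_form y) \0 \0 (wodd (quad_form x) \0 \0 w) = 0.
  rewrite -[RHS](weven_eq0 w); apply: wodd_wodd => z /=;
    by rewrite ?(lin0 (quad_linearr _)) addr0.
have E u v : wodd (quad_form u) \0 \0 (wo v * w)
    = quad_form u v *: w - wo v * wodd (quad_form u) \0 \0 w.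
  rewrite (twderM (cD u)) wodd_wo (lin0 (@we_linear _ _)) addr0 scalarl wpar_wo.
  by rewrite mulNr.
have H u v : cliff_op u (cliff_op v w) = wo u * wo v * w
    + 2^-1 *: (wo u * wodd (quad_form v) \0 \0 w)
    + (2^-1 *: (quad_form u v *: w) - 2^-1 *: (wo v * wodd (quad_form u) \0 \0 w))
    + 2^-1 *: (2^-1 *: wodd (quad_form u) \0 \0 (wodd (quad_form v) \0 \0 w)).
  rewrite /cliff_op (linD (twderL (cD u))) (linZ (twderL (cD u))) E.
  by rewrite mulrDr -palg_scaleAr scalerDr scalerBr -mulrA; abel.
rewrite !H [wo x * wo y]wo_wo mulNr [quad_form y x]quad_sym.
move/eqP: anti; rewrite addr_eq0 => /eqP->; rewrite !scalerN.
by rewrite -[RHS](halfF charF0) scalerDr; abel.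
Qed.

Let envcliff_op_linear t : linear (envcliff_op t).
Proof.
case: t => x a m k; apply/funext=> w //=.
by rewrite !fctE mulrDr -palg_scaleAr.
Qed.

Let lin_linear a (m k : W -> U) : linear m -> linear k -> linear (a *: m + k).
Proof.
move=> lm lk c u v; rewrite !fctE lm lk !scalerDr !scalerA [a * c]mulrC; abel.
Qed.

Let envcliff_op_stable t m : linear m -> linear (envcliff_op t m).
Proof.
move=> lm; case: t => x c u v /=; first by rewrite (linP (cliff_op_linear x)) lm.
by rewrite lm mulrDr -palg_scaleAr.
Qed.

Let envcliff_op_rel s t m : envcliff_rel s t -> linear m ->
  aeval envcliff_op s m = aeval envcliff_op t m.
Proof.
case=> [a x y|a x y|x y|x y|x y] lm; apply/funext=> w /=; rewrite !fctE.
- by rewrite (linP (cliff_op_linearl w)) lm.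
- by rewrite env_genP mulrDl -palg_scaleAl.
- by rewrite scaleN1r !mulrA -mulrBl env_genB.
- by rewrite scaleN1r subrr scale0r.
- by rewrite -(linD lm) addrC cliff_op_op (linZ lm).
Qed.

Definition envcliff_act : UC -> (W -> U) -> (W -> U) := pact envcliff_op.

Let act_gen t m : linear m -> envcliff_act (pgen _ t) m = envcliff_op t m.
Proof.
exact: (pact_gen envcliff_op_linear lin_linear envcliff_op_stable envcliff_op_rel).
Qed.
Let actM x y m : linear m -> envcliff_act (x * y) m = envcliff_act x (envcliff_act y m).
Proof.
exact: (pactM envcliff_op_linear lin_linear envcliff_op_stable envcliff_op_rel).
Qed.
Let act1 m : linear m -> envcliff_act 1 m = m.
Proof.
exact: (pact1 envcliff_op_linear lin_linear envcliff_op_stable envcliff_op_rel).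
Qed.
Let act_lin m : linear m -> linear (envcliff_act^~ m).
Proof.
exact: (pact_linearl envcliff_op_linear lin_linear envcliff_op_stable envcliff_op_rel).
Qed.
Let act_stable x m : linear m -> linear (envcliff_act x m).
Proof. exact: (pact_stable lin_linear envcliff_op_stable). Qed.

Let zl : linear (fun _ : g => 0 : U).
Proof. by move=> a x y; rewrite scaler0 addr0. Qed.
Let zc (x y : g) : (0 : U) * 0 = 0 * 0. Proof. by []. Qed.
Let za (x y : g) : (0 : U) * 0 = - (0 * 0). Proof. by rewrite mulr0 oppr0. Qed.

Definition uaug : W -> U := weil_hom (fun=> 0) (fun=> 0).

Let uaug_hom : algebra_hom uaug.
Proof. exact: (weil_hom_algebra zl zl zc zc za). Qed.

Notation ufil := (wfil (R := @env_rel F g) (fun=> 1%N)).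

Let uaug_fil w : ufil 1 (uaug w).
Proof.
elim/palg_ind: w => [x|a|x y Ex Ey|x y Ex Ey].
- have -> : uaug (weilGen x) = 0.
    by case: x => x; [exact: (weil_hom_wo zl zl zc zc za)|exact: (weil_hom_we zl zl zc zc za)].
  exact: wfil0.
- by rewrite (linZ (homL uaug_hom)) (hom1 uaug_hom); apply/wfilZ/wfil1.
- by rewrite (linD (homL uaug_hom)); apply: wfilD.
- by rewrite (homM uaug_hom); exact: (@wfilM _ _ _ _ 0 1).
Qed.

(** Takes the scalar part of the Clifford factor of $U\otimes Cl$, as seen through the action on the
    augmentation. *)
Definition jret (y : NW) : U := envcliff_act (ncweil_envcliff y) uaug 1.

Lemma jret_linear : linear jret.
Proof.
move=> a x y; rewrite /jret (linP (homL ncweil_envcliff_hom)).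
by rewrite (act_lin (homL uaug_hom)) !fctE.
Qed.

Lemma jretK : cancel (jhom e f) jret.
Proof.
move=> u; rewrite /jret; have hj := jhom_algebra charF0 ef.
have hk := ncweil_envcliff_hom.
have lU : linear uaug := homL uaug_hom.
suff -> : envcliff_act (ncweil_envcliff (jhom e f u)) uaug = fun w => u * uaug w.
  by rewrite (hom1 uaug_hom) mulr1.
(* The map acted on must be arbitrary: in a product, the second factor changes it before the first
   one acts. *)
suff h m : linear m -> envcliff_act (ncweil_envcliff (jhom e f u)) m = fun w => u * m w.
  exact: h.
elim/palg_ind: u m => [z|a|u v IHu IHv|u v IHu IHv] m lm.
- have -> : ncweil_envcliff (jhom e f (envGen z)) = uce z.
    rewrite (jhom_gen charF0 ef) ncweil_hatE (linB (homL hk)) ncweil_envcliff_nce.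
    suff -> : ncweil_envcliff (odd_quad e f (@nco F g) z) = ugam z by rewrite addrK.
    rewrite (linZ (homL hk)) (lin_sum (homL hk)); congr (_ *: _).
    by apply: eq_bigr => a _; rewrite (homM hk) !ncweil_envcliff_nco.
  by rewrite act_gen.
- rewrite (linZ (homL hj)) (hom1 hj) (linZ (homL hk)) (hom1 hk).
  rewrite (linZ (act_lin lm)) act1 //; apply/funext=> w.
  by rewrite scalarl !fctE.
- rewrite (linD (homL hj)) (linD (homL hk)) (linD (act_lin lm)) IHu // IHv //.
  by apply/funext=> w; rewrite !fctE mulrDl.
- rewrite (homM hj) (homM hk) actM // IHv // IHu; first by apply/funext=> w; rewrite mulrA.
  by move=> a x y; rewrite lm mulrDr -palg_scaleAr.
Qed.

Lemma jhom_inj : injective (jhom e f).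
Proof. exact: can_inj jretK. Qed.

(** Only [uce] raises the degree in [U g]: odd letters, and the quadratic part of even ones, act by
    precomposition. *)
Let act_word_fil s n m : linear m -> (forall w, ufil n (m w)) ->
  forall w, ufil (n + count (predC (@is_odd g)) s)
    (envcliff_act (ncweil_envcliff (word (@ncweil_rel F g) s)) m w).
Proof.
have hk := ncweil_envcliff_hom; move=> lm hm.
elim: s => [|x s IH] w; first by rewrite word_nil (hom1 hk) act1 // addn0.
rewrite word_cons (homM hk) actM //.
set m' := envcliff_act _ m in IH *; have lm' : linear m' by apply: act_stable.
case: x => x /=.
  by rewrite -/(nco x) ncweil_envcliff_nco act_gen //= add0n; apply: IH.
rewrite -/(nce x) ncweil_envcliff_nce (linD (act_lin lm')) act_gen //= !fctE.
apply: wfilD.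
  rewrite addnCA; apply: (@wfilM _ _ _ _ 1) => //.
  exact: (wfil_gen (@env_rel F g) (fun=> 1%N) x).
rewrite (linZ (act_lin lm')) (lin_sum (act_lin lm')) !fctE; apply: wfilZ.
have -> : (\sum_a envcliff_act (uco (lie_bracket x (tnth e a)) * uco (tnth f a)) m') w
  = \sum_a envcliff_act (uco (lie_bracket x (tnth e a)) * uco (tnth f a)) m' w.
  by rewrite fct_sumE.
apply: wfil_sum => a _.
rewrite actM // act_gen //=; last exact: act_stable.
by rewrite act_gen //=; apply: wfil_le (IH _); rewrite leq_add2l leqnSn.
Qed.

(** An even letter weighs two and raises the degree in [U g] by at most one, hence the factor two
    between the filtrations. *)
Lemma jret_fil k y : wfil (@wgt g) k.*2 y -> ufil k (jret y).
Proof.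
move: y; apply: (wfil_lin (P := ufil k) jret_linear);
  [exact: wfil0|exact: wfilD|exact: wfilZ|] => s sk.
have := act_word_fil s (homL uaug_hom) uaug_fil 1; apply: wfil_le.
suff : ((count (predC (@is_odd g)) s).*2 <= wsize (@wgt g) s)%N by lia.
elim: s {sk} => [//|x s IH]; rewrite wsize_cons /= doubleD leq_add //.
by case: x.
Qed.
End EnvCliff.

(** * Independence of the connection *)

Section WeilFunctor.
Variables (F : fieldType) (V V' : vectType F) (m : {linear V -> V'}).

Let mo_linear : linear (fun x => wo (m x)).
Proof. by move=> a x y; rewrite linearP wo_linear. Qed.
Let me_linear : linear (fun x => we (m x)).
Proof. by move=> a x y; rewrite linearP we_linear. Qed.
Let mee x y : we (m x) * we (m y) = we (m y) * we (m x). Proof. exact: we_we. Qed.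
Let meo x y : we (m x) * wo (m y) = wo (m y) * we (m x). Proof. exact: we_wo. Qed.
Let moo x y : wo (m x) * wo (m y) = - (wo (m y) * wo (m x)). Proof. exact: wo_wo. Qed.

Definition wmap : weilAlg V -> weilAlg V' :=
  weil_hom (fun x => wo (m x)) (fun x => we (m x)).

Lemma wmap_hom : algebra_hom wmap.
Proof. exact: weil_hom_algebra mo_linear me_linear mee meo moo. Qed.
Lemma wmap_wo x : wmap (wo x) = wo (m x).
Proof. exact: weil_hom_wo mo_linear me_linear mee meo moo x. Qed.
Lemma wmap_we x : wmap (we x) = we (m x).
Proof. exact: weil_hom_we mo_linear me_linear mee meo moo x. Qed.

Lemma wmap_par u : wmap (wpar u) = wpar (wmap u).
Proof.
move: u; apply: (@hom_ext _ _ _ _ _ (wmap \o @wpar F V) (@wpar F V' \o wmap)).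
- exact: hom_comp wmap_hom (@wpar_hom F V).
- exact: hom_comp (@wpar_hom F V') wmap_hom.
case=> x /=; rewrite -/(wo x) -/(we x) ?wpar_wo ?wpar_we ?wmap_wo ?wmap_we.
  by rewrite (linN (homL wmap_hom)) wmap_wo wpar_wo.
by rewrite wpar_we.
Qed.

Lemma wmap_twder (p D : weilAlg V -> weilAlg V) (p' D' : weilAlg V' -> weilAlg V') :
  algebra_hom p -> algebra_hom p' -> twder p D -> twder p' D' ->
  (forall u, wmap (p u) = p' (wmap u)) ->
  (forall w, wmap (D (weilGen w)) = D' (wmap (weilGen w))) ->
  forall u, wmap (D u) = D' (wmap u).
Proof.
move=> hp hp' hD hD' pE DE; have hm := wmap_hom.
elim/palg_ind=> [//|a|x y Ex Ey|x y Ex Ey].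
- rewrite (linZ (twderL hD)) (linZ (homL hm)) (linZ (homL hm)) (linZ (twderL hD')).
  by rewrite (twder1 hp hD) (hom1 hm) (twder1 hp' hD') (lin0 (homL hm)).
- by rewrite (linD (twderL hD)) !(linD (homL hm)) (linD (twderL hD')) Ex Ey.
- by rewrite (twderM hD) (linD (homL hm)) !(homM hm) (twderM hD') Ex Ey pE.
Qed.

Lemma wmap_wodd (b : {scalar V}) (k a : {linear V -> V}) (b' : {scalar V'})
    (k' a' : {linear V' -> V'}) :
  (forall v, b' (m v) = b v) -> (forall v, k' (m v) = m (k v)) ->
  (forall v, a' (m v) = m (a v)) ->
  forall u, wmap (wodd b k a u) = wodd b' k' a' (wmap u).
Proof.
move=> Eb Ek Ea; have hm := wmap_hom.
apply: (wmap_twder (@wpar_hom F V) (@wpar_hom F V') (wodd_twder _ _ _) (wodd_twder _ _ _)).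
  exact: wmap_par.
case=> x; rewrite -/(wo x) -/(we x) ?wmap_wo ?wmap_we.
  by rewrite !wodd_wo (linD (homL hm)) (linZ (homL hm)) (hom1 hm) wmap_we Eb Ek.
by rewrite !wodd_we wmap_wo Ea.
Qed.

Lemma wmap_weven (b : {scalar V}) (k a : {linear V -> V}) (b' : {scalar V'})
    (k' a' : {linear V' -> V'}) :
  (forall v, b' (m v) = b v) -> (forall v, k' (m v) = m (k v)) ->
  (forall v, a' (m v) = m (a v)) ->
  forall u, wmap (weven b k a u) = weven b' k' a' (wmap u).
Proof.
move=> Eb Ek Ea; have hm := wmap_hom.
apply: (wmap_twder (hom_id _) (hom_id _) (weven_twder _ _ _) (weven_twder _ _ _)) => //.
case=> x; rewrite -/(wo x) -/(we x) ?wmap_wo ?wmap_we.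
  by rewrite !weven_wo wmap_wo Ek.
by rewrite !weven_we (linD (homL hm)) (linZ (homL hm)) (hom1 hm) wmap_we Eb Ea.
Qed.
End WeilFunctor.

Lemma wmap_ext (F : fieldType) (V V' V'' : vectType F) (m : {linear V -> V'})
    (m' : {linear V' -> V''}) (n : {linear V -> V''}) :
  (forall v, m' (m v) = n v) -> forall u, wmap m' (wmap m u) = wmap n u.
Proof.
move=> E; apply: (@hom_ext _ _ _ _ _ (wmap m' \o wmap m) (wmap n)).
- exact: hom_comp (wmap_hom m') (wmap_hom m).
- exact: wmap_hom.
by case=> x /=; rewrite -/(wo x) -/(we x) ?wmap_wo ?wmap_we E.
Qed.

Lemma wmap_id (F : fieldType) (V : vectType F) (m : {linear V -> V}) :
  (forall v, m v = v) -> forall u, wmap m u = u.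
Proof.
move=> E; apply: (@hom_ext _ _ _ _ _ (wmap m) id (wmap_hom m) (hom_id _)).
by case=> x /=; rewrite -/(wo x) -/(we x) ?wmap_wo ?wmap_we E.
Qed.

(** * Number operators of a projector *)

Section NumberOperator.
Variables (F : fieldType) (V : vectType F) (k c : {linear V -> V}).
Hypotheses (kk : forall v, k (k v) = k v) (cE : forall v, c v = v - k v).
Notation W := (weilAlg V).

Definition wnum : W -> W := weven \0 k k.

Let hT : twder id wnum. Proof. exact: weven_twder. Qed.

(** The second clause records that [wmap c] is the projection to eigenvalue zero: [c] kills exactly
    the letters that [wnum] counts. *)
Definition is_wnum_eigen (n : nat) (x : W) : Prop :=
  wnum x = n%:R *: x /\ wmap c x = if n == 0%N then x else 0.

Inductive wnum_span : W -> Prop :=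
| wnum_span_eigen n x : is_wnum_eigen n x -> wnum_span x
| wnum_spanD x y : wnum_span x -> wnum_span y -> wnum_span (x + y).

Lemma wnum_eigenM n l x y :
  is_wnum_eigen n x -> is_wnum_eigen l y -> is_wnum_eigen (n + l) (x * y).
Proof.
move=> [Tx cx] [Ty cy]; split.
  by rewrite (twderM hT) Tx Ty -palg_scaleAl -palg_scaleAr -scalerDl natrD.
rewrite (homM (wmap_hom c)) cx cy addn_eq0.
by case: eqP => //= _; [case: eqP => // _; rewrite mulr0|rewrite mul0r].
Qed.

Lemma wnum_spanM x y : wnum_span x -> wnum_span y -> wnum_span (x * y).
Proof.
move=> hx hy; elim: hx => [n u hu|u v _ IHu _ IHv]; last by rewrite mulrDl; apply: wnum_spanD.
elim: hy => [l v hv|v w _ IHv _ IHw]; last by rewrite mulrDr; apply: wnum_spanD.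
exact: wnum_span_eigen (wnum_eigenM hu hv).
Qed.

Let ck v : c (k v) = 0. Proof. by rewrite cE kk subrr. Qed.
Let kc v : k (c v) = 0. Proof. by rewrite cE linearB /= kk subrr. Qed.
Let cc v : c (c v) = c v. Proof. by rewrite [LHS]cE kc subr0. Qed.

Lemma wnum_span_all x : wnum_span x.
Proof.
elim/palg_ind: x => [x|a|x y|x y]; last 2 first.
- exact: wnum_spanD.
- exact: wnum_spanM.
- case: x => v; rewrite -/(wo v) -/(we v).
    have -> : wo v = wo (k v) + wo (c v) by rewrite -(linD (@wo_linear _ _)) cE addrC subrK.
    apply: wnum_spanD; [apply: (@wnum_span_eigen 1)|apply: (@wnum_span_eigen 0)].
      by split; rewrite ?wmap_wo /wnum ?weven_wo ?kk ?ck ?scale1r //= (lin0 (@wo_linear _ _)).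
    by split; rewrite ?wmap_wo /wnum ?weven_wo ?kc ?cc ?scale0r //= (lin0 (@wo_linear _ _)).
  have -> : we v = we (k v) + we (c v) by rewrite -(linD (@we_linear _ _)) cE addrC subrK.
  apply: wnum_spanD; [apply: (@wnum_span_eigen 1)|apply: (@wnum_span_eigen 0)].
    split; first by rewrite /wnum weven_we scale0r add0r kk scale1r.
    by rewrite wmap_we ck (lin0 (@we_linear _ _)).
  split; first by rewrite /wnum weven_we scale0r add0r kc scale0r (lin0 (@we_linear _ _)).
  by rewrite wmap_we cc.
- apply: (@wnum_span_eigen 0); split; rewrite ?scale0r.
    by rewrite (linZ (twderL hT)) (twder1 (hom_id _) hT) scaler0.
  by rewrite (linZ (homL (wmap_hom c))) (hom1 (wmap_hom c)).
Qed.

Fixpoint wnum_kill (l : seq nat) (x : W) : W :=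
  if l is n :: l' then wnum_kill l' (wnum x - n%:R *: x) else x.

Lemma wnum_kill_linear l : linear (wnum_kill l).
Proof.
elim: l => [//|n l IH] a x y /=.
rewrite (linP (twderL hT)) -IH; congr (wnum_kill l _).
by rewrite scalerDr scalerBr !scalerA [n%:R * a]mulrC; abel.
Qed.

Lemma wnum_kill_cat l l' x : wnum_kill (l ++ l') x = wnum_kill l' (wnum_kill l x).
Proof. by elim: l x => [//|n l IH] x /=. Qed.

Lemma wnum_kill_wnum l x : wnum_kill l (wnum x) = wnum (wnum_kill l x).
Proof.
elim: l x => [//|n l IH] x /=; rewrite -IH; congr (wnum_kill l _).
by rewrite (linB (twderL hT)) (linZ (twderL hT)).
Qed.

Lemma wnum_killC l l' x : wnum_kill l (wnum_kill l' x) = wnum_kill l' (wnum_kill l x).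
Proof.
elim: l x => [//|n l IH] x /=; rewrite -IH; congr (wnum_kill l _).
by rewrite (linB (wnum_kill_linear l')) (linZ (wnum_kill_linear l')) wnum_kill_wnum.
Qed.

(** Subtracting [wmap c x] removes the part of eigenvalue zero; the finitely many other eigenvalues
    are positive integers. *)
Lemma wnum_kill_exists x : exists2 l, 0%N \notin l & wnum_kill l (x - wmap c x) = 0.
Proof.
elim: (wnum_span_all x) => [n u [Tu cu]|u v _ [l l0 El] _ [l' l0' El']].
  exists (if n == 0%N then [::] else [:: n]).
    by case: eqP => // /eqP n0; rewrite inE eq_sym.
  rewrite cu; case: eqP => [_|_] /=; first by rewrite subrr.
  by rewrite subr0 Tu subrr.
exists (l ++ l'); first by rewrite mem_cat negb_or l0.
rewrite wnum_kill_cat (linD (homL (wmap_hom c))).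
have -> : u + v - (wmap c u + wmap c v) = (u - wmap c u) + (v - wmap c v) by abel.
rewrite (linD (wnum_kill_linear l)) (linD (wnum_kill_linear l')) El (lin0 (wnum_kill_linear _)) add0r.
by rewrite wnum_killC El' (lin0 (wnum_kill_linear _)).
Qed.
End NumberOperator.

Section DoubleMaps.
Variables (F : fieldType) (g : quadLieAlgType F).
Notation g2 := (g * g)%type.

Definition pair_l (x : g) : g2 := (x, 0).
Definition pair_r (x : g) : g2 := (0, x).
(* [weilAlg (g * g)] is the tensor square of [weilAlg g]; [pair_diff v] is a
   difference of its two tautological connections. *)
Definition pair_diff (v : g2) : g2 := (v.1, - v.1).
(** The projector complementary to [pair_diff]; it identifies the two copies of [g]. *)
Definition pair_sum (v : g2) : g2 := (0, v.1 + v.2).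
Definition pair_ad (z : g) (v : g2) : g2 := (lie_bracket z v.1, lie_bracket z v.2).
Definition pair_quad (z : g) (v : g2) : F := quad_form z (v.1 + v.2).

Fact pair_l_linear : linear pair_l.
Proof. by move=> a x y; rewrite /pair_l; congr (_, _); rewrite /= scaler0 addr0. Qed.
Fact pair_r_linear : linear pair_r.
Proof. by move=> a x y; rewrite /pair_r; congr (_, _); rewrite /= scaler0 addr0. Qed.
Fact pair_diff_linear : linear pair_diff.
Proof. by move=> a x y; rewrite /pair_diff; congr (_, _); rewrite /= opprD scalerN. Qed.
Fact pair_sum_linear : linear pair_sum.
Proof.
move=> a x y; rewrite /pair_sum; congr (_, _); rewrite /= ?scaler0 ?addr0 //.
by rewrite scalerDr; abel.
Qed.
Fact pair_ad_linear z : linear (pair_ad z).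
Proof. by move=> a x y; rewrite /pair_ad; congr (_, _); rewrite linearPr. Qed.
Fact pair_quad_linear z : scalar (pair_quad z).
Proof.
move=> a x y; rewrite /pair_quad /= -quadPr; congr (quad_form _ _).
by rewrite scalerDr; abel.
Qed.

HB.instance Definition _ := GRing.isLinear.Build F g g2 *:%R pair_l pair_l_linear.
HB.instance Definition _ := GRing.isLinear.Build F g g2 *:%R pair_r pair_r_linear.
HB.instance Definition _ := GRing.isLinear.Build F g2 g2 *:%R pair_diff pair_diff_linear.
HB.instance Definition _ := GRing.isLinear.Build F g2 g2 *:%R pair_sum pair_sum_linear.
HB.instance Definition _ z :=
  GRing.isLinear.Build F g2 g2 *:%R (pair_ad z) (pair_ad_linear z).
HB.instance Definition _ z :=
  GRing.isLinear.Build F g2 F *%R (pair_quad z) (pair_quad_linear z).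
End DoubleMaps.

Section Transgression.
Variables (F : fieldType) (charF0 : [pchar F] =i pred0).
Variables (g : quadLieAlgType F) (e f : (\dim {:g}).-tuple g).
Hypothesis ef : dual_bases e f.
Notation W := (weilAlg g).
Notation W2 := (weilAlg (g * g)%type).
Notation NW := (ncWeilAlg g).
Notation p1 := (fst : {linear (g * g)%type -> g}).
Notation p2 := (snd : {linear (g * g)%type -> g}).

Variables (Q : W -> NW) (hQ : is_expsum e f idfun (@waug F g) Q).
Variable y : W.
Hypotheses (yd : wd y = 0) (yi : forall z, wiota z y = 0) (yp : wpar y = y).

Let Qp : forall u, Q (wpar u) = npar (Q u). Proof. by case: (quant_intertwines charF0 ef hQ). Qed.
Let Qd : forall u, Q (wd u) = nd (Q u). Proof. by case: (quant_intertwines charF0 ef hQ). Qed.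
Let Qi : forall z u, Q (wiota z u) = niota z (Q u).
Proof. by case: (quant_intertwines charF0 ef hQ). Qed.

(* The exponential sum starting from [psi0] is [a (x) b |-> Q a Q (b y)]. *)
Let psi0 (u : W2) : NW := Q (wmap p2 u * y).

Let psi0_linear : linear psi0.
Proof. by move=> a u v; rewrite /psi0 (linP (homL (wmap_hom _))) mulrDl -palg_scaleAl hQ.1. Qed.

Let psi0_par u : psi0 (wpar u) = npar (psi0 u).
Proof. by rewrite /psi0 wmap_par -Qp (homM (@wpar_hom F g)) yp. Qed.

Let psi0_d u : psi0 (wd u) = nd (psi0 u).
Proof.
rewrite /psi0 -Qd (twderM (@wd_twder F g)) yd mulr0 addr0.
by rewrite (@wmap_wodd _ _ _ p2 _ _ _ \0 idfun \0) // => v; rewrite linear0.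
Qed.

Let psi0_iota z u :
  niota z (psi0 u) = psi0 (wodd (quad_form z \o p2) \0 (pair_ad z) u).
Proof.
rewrite /psi0 -Qi (twderM (wiota_twder z)) yi mulr0 addr0.
by rewrite (@wmap_wodd _ _ _ p2 _ _ _ (quad_form z) \0 (lie_bracket z)) // => v; rewrite linear0.
Qed.

Variables (Psi : W2 -> NW) (hPsi : is_expsum e f p1 psi0 Psi).

Let iota2 z : W2 -> W2 := wodd (pair_quad z) \0 (pair_ad z).
Let transg : W2 -> W2 := wodd \0 \0 (@pair_diff F g).
Notation T := (wnum (@pair_diff F g)).

Let lPsi : linear Psi := hPsi.1.

Let Psi_par u : Psi (wpar u) = npar (Psi u).
Proof. exact: (expsum_par psi0_linear hPsi psi0_par). Qed.
Let Psi_d u : Psi (wd u) = nd (Psi u).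
Proof. exact: (expsum_d psi0_linear hPsi psi0_d). Qed.
Let Psi_iota z u : Psi (iota2 z u) = niota z (Psi u).
Proof.
apply/esym; apply: (expsum_iota charF0 ef psi0_linear hPsi) (psi0_iota z) u => [//|v /=].
by rewrite /pair_quad (linD (quad_linearr z)) addrC.
Qed.

Let ht : twder (@wpar F _) transg := wodd_twder _ _ _.
Let hi2 z : twder (@wpar F _) (iota2 z) := wodd_twder _ _ _.

Let transg_d u : wd (transg u) + transg (wd u) = T u.
Proof. by apply: wodd_wodd => v /=; rewrite ?linear0 ?add0r ?addr0. Qed.

(** A difference of connections is horizontal: [pair_quad z] vanishes on the image of
    [pair_diff]. *)
Let transg_iota z u : iota2 z (transg u) + transg (iota2 z u) = 0.
Proof.
rewrite -[RHS](weven_eq0 u); apply: wodd_wodd => v /=; rewrite ?linear0 ?addr0 //.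
by rewrite /pair_quad /= subrr (lin0 (quad_linearr z)).
Qed.

Let T_iota z u : T (iota2 z u) = iota2 z (T u).
Proof.
apply/eqP; rewrite -subr_eq0 -[X in _ == X](wodd_eq0 u); apply/eqP.
apply: weven_wodd => v /=; rewrite ?linear0 ?addr0 //.
  by rewrite /pair_quad /= subrr (lin0 (quad_linearr z)) subr0.
by rewrite /pair_diff /pair_ad /= linearNr subrr.
Qed.

Let T_d u : T (wd u) = wd (T u).
Proof.
apply/eqP; rewrite -subr_eq0 -[X in _ == X](wodd_eq0 u); apply/eqP.
by apply: weven_wodd => v /=; rewrite ?linear0 ?subr0 ?subrr ?addr0.
Qed.

Definition closed_basic2 (u : W2) : Prop :=
  [/\ forall z, iota2 z u = 0, wd u = 0 & wpar u = u].

(* [T = [d, s]] for the transgression [s], which anticommutes with contractions: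
   [Psi (s u)] is odd and horizontal, hence zero. *)
Lemma Psi_num u : closed_basic2 u -> Psi (T u) = 0.
Proof.
move=> [ui ud up]; rewrite -transg_d ud.
have -> : transg 0 = 0 by rewrite (lin0 (twderL ht)).
rewrite addr0 Psi_d.
suff -> : Psi (transg u) = 0 by rewrite (lin0 (twderL (@nd_twder F g))).
apply: (ncweil_odd_horizontal charF0 ef) => [z|].
  rewrite -Psi_iota; have /eqP := transg_iota z u.
  rewrite ui (lin0 (twderL ht)) addr0 => /eqP->.
  exact: (lin0 lPsi).
rewrite -Psi_par; have := wodd_par \0 \0 (@pair_diff F g) u; rewrite up => E.
by rewrite -[wpar _]opprK -E (linN lPsi).
Qed.

Lemma closed_basic2_num n u : closed_basic2 u -> closed_basic2 (T u - n%:R *: u).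
Proof.
have hT : twder id T := weven_twder _ _ _.
move=> [ui ud up]; split=> [z||].
- rewrite (linB (twderL (hi2 z))) -T_iota ui (lin0 (twderL hT)).
  by rewrite (linZ (twderL (hi2 z))) ui scaler0 subr0.
- rewrite (linB (twderL (@wd_twder _ _))) -T_d ud (lin0 (twderL hT)).
  by rewrite (linZ (twderL (@wd_twder _ _))) ud scaler0 subr0.
- rewrite (linB (homL (@wpar_hom _ _))) (linZ (homL (@wpar_hom _ _))) up.
  by rewrite -weven_par up.
Qed.

(** By [Psi_num], applying [Psi] after $T-n$ gives $-n$ times [Psi]; no factor vanishes, so the
    product of the $T-n$ can only kill [u] if [Psi u = 0]. *)
Lemma Psi_kill l u : 0%N \notin l -> closed_basic2 u ->
  wnum_kill (@pair_diff F g) l u = 0 -> Psi u = 0.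
Proof.
elim: l u => [|n l IH] u /=; first by move=> _ _ ->; apply: lin0 lPsi.
rewrite inE negb_or => /andP[n0 l0] hu /(IH _ l0 (closed_basic2_num n hu)) /eqP.
rewrite (linB lPsi) Psi_num // sub0r oppr_eq0 (linZ lPsi) => /eqP E.
have nz : n%:R != 0 :> F by case: n n0 {hu E} => // n _; apply: natF_neq0.
by rewrite -[LHS]scale1r -(mulVf nz) -scalerA E scaler0.
Qed.

Let psiE k u : ephi e f p1 psi0 k (wmap (@pair_l F g) u) = ephi e f idfun (@waug F g) k u * Q y.
Proof.
elim: k u => [|k IH] u /=.
  have [c [E1 E2]] : exists c, wmap p2 (wmap (@pair_l F g) u) = c *: (1 : W)
      /\ waug u = c *: (1 : NW).
    have h2 := wmap_hom p2; have hl := wmap_hom (@pair_l F g); have ha := @waug_hom F g.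
    elim/palg_ind: u => [x|a|u v [c [E1 E2]] [c' [E1' E2']]|u v [c [E1 E2]] [c' [E1' E2']]].
    - exists 0; rewrite !scale0r waug_gen; split=> //.
      case: x => x; rewrite -/(wo x) -/(we x) ?wmap_wo ?wmap_we /=.
        exact: (lin0 (@wo_linear _ _)).
      exact: (lin0 (@we_linear _ _)).
    - exists a; rewrite (linZ (homL hl)) (linZ (homL h2)) (linZ (homL ha)).
      by rewrite (hom1 hl) (hom1 h2) (hom1 ha).
    - exists (c + c'); rewrite (linD (homL hl)) (linD (homL h2)) (linD (homL ha)).
      by rewrite E1 E2 E1' E2' !scalerDl.
    - exists (c * c'); rewrite (homM hl) (homM h2) (homM ha).
      by rewrite E1 E2 E1' E2' !scalarl !scalerA.
  by rewrite /psi0 E1 E2 !scalarl (linZ hQ.1).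
have Eo a : odel f p1 a (wmap (@pair_l F g) u) = wmap (@pair_l F g) (odel f idfun a u).
  by apply/esym/wmap_wodd => v //=; rewrite linear0.
have Ee a : edel f p1 a (wmap (@pair_l F g) u) = wmap (@pair_l F g) (edel f idfun a u).
  by apply/esym/wmap_weven => v //=; rewrite linear0.
rewrite mulr_suml; apply: eq_bigr => a _.
by rewrite Eo Ee !IH mulrDl -!mulrA.
Qed.

Let Psi_l u : Psi (wmap (@pair_l F g) u) = Q u * Q y.
Proof.
have [n hn] := ephi_locfin e f idfun (homL (@waug_hom F g)) u.
rewrite (hQ.2 u n hn) (hPsi.2 _ n) => [|k nk]; last by rewrite psiE hn // mul0r.
rewrite mulr_suml; apply: eq_bigr => k _.
by rewrite psiE palg_scaleAl.
Qed.

(** The derivations for the first projection do not see letters of the second copy, so only the term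
    [psi0] remains. *)
Let Psi_r u : Psi (wmap (@pair_r F g) u) = Q (u * y).
Proof.
have lphi := ephi_linear e f p1 psi0_linear.
have Eo a : odel f p1 a (wmap (@pair_r F g) u) = 0.
  rewrite -(lin0 (homL (wmap_hom (@pair_r F g)))) -[X in _ = wmap _ X](wodd_eq0 u).
  by apply/esym/wmap_wodd => v /=; rewrite ?linear0 // (lin0 (quad_linearr _)).
have Ee a : edel f p1 a (wmap (@pair_r F g) u) = 0.
  rewrite -(lin0 (homL (wmap_hom (@pair_r F g)))) -[X in _ = wmap _ X](weven_eq0 u).
  by apply/esym/wmap_weven => v /=; rewrite ?linear0 // (lin0 (quad_linearr _)).
rewrite (hPsi.2 _ 1%N) => [|[//|k] _]; last first.
  by rewrite /= big1 // => a _; rewrite Eo Ee (lin0 (lphi k)) !mulr0 addr0.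
rewrite big_ord1 fact0 invr1 scale1r /= /psi0 (wmap_ext (n := idfun)) //.
by rewrite wmap_id.
Qed.

Lemma quant_mul_closed x : wd x = 0 -> (forall z, wiota z x = 0) -> wpar x = x ->
  Q (x * y) = Q x * Q y.
Proof.
move=> xd xi xp; apply/esym/eqP; rewrite -Psi_l -Psi_r -subr_eq0 -(linB lPsi).
set u := _ - _; apply/eqP.
have cE (v : g * g) : pair_sum v = v - pair_diff v.
  case: v => a b; rewrite /pair_sum /pair_diff /=; congr (_, _); first by rewrite subrr.
  by rewrite /= opprK addrC.
have kk (v : g * g) : pair_diff (pair_diff v) = pair_diff v by [].
have [l l0] := wnum_kill_exists kk cE u.
(* Both copies of [x] have the same image under [pair_sum], so their difference has no part of
   eigenvalue zero. *)
have -> : wmap (@pair_sum F g) u = 0.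
  rewrite /u (linB (homL (wmap_hom _))) !(wmap_ext (n := @pair_r F g)) ?subrr // => v.
    by congr (_, _); apply: add0r.
  by congr (_, _); apply: addr0.
rewrite subr0; apply: Psi_kill l0 _; split=> [z||].
- rewrite (linB (twderL (hi2 z))).
  have El : iota2 z (wmap (@pair_l F g) x) = wmap (@pair_l F g) (wiota z x).
    apply/esym/wmap_wodd => v; rewrite ?linear0 //.
      by rewrite /= /pair_quad /= addr0.
    by rewrite /= /pair_ad /= linear0r.
  have Er : iota2 z (wmap (@pair_r F g) x) = wmap (@pair_r F g) (wiota z x).
    apply/esym/wmap_wodd => v; rewrite ?linear0 //.
      by rewrite /= /pair_quad /= add0r.
    by rewrite /= /pair_ad /= linear0r.
  by rewrite El Er xi !(lin0 (homL (wmap_hom _))) subrr.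
- rewrite (linB (twderL (@wd_twder _ _))).
  have Ed (k : {linear g -> (g * g)%type}) : wd (wmap k x) = wmap k (wd x).
    by apply/esym/wmap_wodd => v; rewrite ?linear0.
  by rewrite !Ed xd !(lin0 (homL (wmap_hom _))) subrr.
- by rewrite (linB (homL (@wpar_hom _ _))) -!wmap_par xp.
Qed.

End Transgression.

Lemma quant_mul_basic (F : fieldType) (charF0 : [pchar F] =i pred0)
    (g : quadLieAlgType F) (e f : (\dim {:g}).-tuple g) (ef : dual_bases e f)
    (Q : weilAlg g -> ncWeilAlg g) (x y : symAlg g) :
  is_expsum e f idfun (@waug F g) Q -> sym_inv g x -> sym_inv g y ->
  Q (ihom e f (x * y)) = Q (ihom e f x) * Q (ihom e f y).
Proof.
move=> hQ xinv yinv; rewrite (homM (ihom_algebra charF0 ef)).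
pose p2 := (snd : {linear (g * g)%type -> g}).
pose psi0 (u : weilAlg (g * g)%type) := Q (wmap p2 u * ihom e f y).
have lpsi0 : linear psi0.
  by move=> a u v; rewrite /psi0 (linP (homL (wmap_hom _))) mulrDl -palg_scaleAl hQ.1.
have [Psi hPsi] := expsum_exists e f (fst : {linear (g * g)%type -> g}) lpsi0.
apply: (quant_mul_closed charF0 ef hQ _ _ _ hPsi).
- exact: basic_closed.
- by move=> z; apply: ihom_iota.
- exact: ihom_par.
- exact: basic_closed.
- by move=> z; apply: ihom_iota.
- exact: ihom_par.
Qed.

(** * Bijectivity and the main theorem *)

Section QuantizationBijective.
Variables (F : fieldType) (charF0 : [pchar F] =i pred0).
Variables (g : quadLieAlgType F) (e f : (\dim {:g}).-tuple g).
Hypothesis ef : dual_bases e f.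
Notation W := (weilAlg g).
Notation NW := (ncWeilAlg g).
Notation ufil := (wfil (R := @env_rel F g) (fun=> 1%N)).
Notation sfil := (wfil (R := @sym_rel F g) (fun=> 1%N)).
Notation wfilt := (wfil (R := @weil_rel F g) (@wgt g)).
Notation nfil := (wfil (R := @ncweil_rel F g) (@wgt g)).
Variables (Q : W -> NW) (hQ : is_expsum e f idfun (@waug F g) Q).

Let lQ : linear Q := hQ.1.
Let hi := ihom_algebra charF0 ef.
Let hj := jhom_algebra charF0 ef.
Let Qi : forall z u, Q (wiota z u) = niota z (Q u).
Proof. by case: (quant_intertwines charF0 ef hQ). Qed.
Let symbol := quant_symbol charF0 ef hQ.

Lemma quant1 : Q 1 = 1.
Proof.
have := symbol [::]; rewrite /wsize big_nil !word_nil => /wfil0_eq0 /eqP.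
by rewrite subr_eq0 => /eqP.
Qed.

Lemma quant_hat z : nfil 2 (Q (weil_hat e f z) - ncweil_hat e f z).
Proof.
rewrite weil_hatE ncweil_hatE (linB lQ) /odd_quad (linZ lQ) (lin_sum lQ).
have -> (a b c d : NW) : a - b - (c - d) = (a - c) - (b - d) by abel.
rewrite -scalerBr -sumrB; apply: wfilB.
  have := symbol [:: WEven z].
  by rewrite !word_cons !word_nil !mulr1 wsize_cons /wsize big_nil.
apply/wfilZ/wfil_sum => a _.
have := symbol [:: WOdd (lie_bracket z (tnth e a)); WOdd (tnth f a)].
by rewrite !word_cons !word_nil !mulr1 !wsize_cons /wsize big_nil.
Qed.

Lemma weil_hat_fil z : wfilt 3 (weil_hat e f z).
Proof.
rewrite weil_hatE; apply: wfilB; first exact: (wfil_gen _ (@wgt g) (WEven z)).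
apply/wfilZ/wfil_sum => a _; apply: (@wfilM _ _ _ _ 1 2).
  exact: (wfil_gen _ (@wgt g) (WOdd _)).
exact: (wfil_gen _ (@wgt g) (WOdd _)).
Qed.

Lemma ncweil_hat_fil z : nfil 3 (ncweil_hat e f z).
Proof.
rewrite ncweil_hatE; apply: wfilB; first exact: (wfil_gen _ (@wgt g) (WEven z)).
apply/wfilZ/wfil_sum => a _; apply: (@wfilM _ _ _ _ 1 2).
  exact: (wfil_gen _ (@wgt g) (WOdd _)).
exact: (wfil_gen _ (@wgt g) (WOdd _)).
Qed.

(** To leading order [Q] is multiplicative and matches the hatted elements of both algebras. Each of
    these weighs two, hence the doubled bound. *)
Lemma quant_ihom_symbol (s : seq g) :
  nfil (size s).*2 (Q (ihom e f (word _ s)) - jhom e f (word _ s)).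
Proof.
elim: s => [|z s IH].
  by rewrite !word_nil (hom1 hi) (hom1 hj) quant1 subrr; apply: wfil0.
rewrite !word_cons (homM hi) (homM hj) (ihom_gen charF0 ef) (jhom_gen charF0 ef) /=.
have hX : wfilt (size s).*2.+1 (ihom e f (word (@sym_rel F g) s)).
  elim: s {IH} => [|x s IH]; first by rewrite word_nil (hom1 hi); apply: wfil1.
  rewrite word_cons (homM hi) (ihom_gen charF0 ef) /= doubleS.
  exact: (@wfilM _ _ _ _ 2) (weil_hat_fil x) IH.
move: (ihom e f _) (jhom e f _) IH hX => X Y hXY hX.
have -> : Q (weil_hat e f z * X) - ncweil_hat e f z * Y
  = (Q (weil_hat e f z * X) - Q (weil_hat e f z) * Q X)
    + (Q (weil_hat e f z) - ncweil_hat e f z) * Q X + ncweil_hat e f z * (Q X - Y).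
  move: (Q (_ * X)) (Q (weil_hat e f z)) (ncweil_hat e f z) => C A B.
  by rewrite mulrBl mulrBr; abel.
rewrite doubleS -[(_.*2).+2]/(2 + (size s).*2)%N.
apply: wfilD; first apply: wfilD.
- exact: (quant_mul_symbol charF0 ef hQ (weil_hat_fil z) hX).
- exact: (wfilMr (quant_hat z) (quant_fil charF0 ef hQ hX)).
- exact: (wfilM (ncweil_hat_fil z) hXY).
Qed.

Let co (a : 'I_(\dim {:g})) (z : g) : F^o := quad_form z (tnth f a).
Let co_linear a : linear (co a). Proof. exact: quad_linearl. Qed.
Let co_expand z : z = \sum_a (co a z : F) *: tnth e a. Proof. exact: dual_expandl. Qed.
Notation tau := (pbw (tnth e) co).

Let size1 (s : seq g) : wsize (fun=> 1%N) s = size s.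
Proof. exact: sum1_size. Qed.

Let tau_linear : linear tau. Proof. exact: pbw_linear. Qed.
Let tau_symbol s : sfil (size s) (tau (word _ s) - word _ s).
Proof. exact: (pbw_symbol co_linear co_expand). Qed.

Lemma pbw_fil k u : ufil k u -> sfil k (tau u).
Proof.
move: u; apply: (wfil_lin (P := sfil k) tau_linear);
  [exact: wfil0|exact: wfilD|exact: wfilZ|] => s sk.
rewrite -[tau _](subrK (word _ s)); apply: wfilD; last exact: wfil_word.
by apply: wfil_le (tau_symbol s); rewrite -size1 ltnW.
Qed.

(* If [Q (ihom p) = 0] then the lift [u] of [p] to the enveloping algebra drops in
   degree, and so does its image [p] modulo lower terms under [pbw]. *)
Lemma quant_ihom_inj0 p : Q (ihom e f p) = 0 -> p = 0.
Proof.
have [k] := wfil_exhaustive (fun=> 1%N) p; elim: k p => [|k IH] p hp Qp.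
  exact: wfil0_eq0 hp.
apply: (IH p _ Qp).
have [u [uQ up]] : exists u, nfil k.*2 (Q (ihom e f p) - jhom e f u) /\ sfil k (tau u - p).
  clear Qp; move: p hp.
  pose P p := exists u, nfil k.*2 (Q (ihom e f p) - jhom e f u) /\ sfil k (tau u - p).
  have lid : linear (@id (symAlg g)) by [].
  apply: (wfil_lin (P := P) lid).
  - exists 0; rewrite (lin0 (homL hi)) (lin0 (homL hj)) (lin0 lQ) (lin0 tau_linear) !subr0.
    by split; apply: wfil0.
  - move=> p1 p2 [u1 [Qu1 tu1]] [u2 [Qu2 tu2]]; exists (u1 + u2).
    rewrite (linD (homL hi)) (linD (homL hj)) (linD lQ) (linD tau_linear) !opprD.
    by rewrite addrACA [X in sfil _ X]addrACA; split; apply: wfilD.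
  - move=> a p1 [u1 [Qu1 tu1]]; exists (a *: u1).
    rewrite (linZ (homL hi)) (linZ (homL hj)) (linZ lQ) (linZ tau_linear) -!scalerBr.
    by split; apply: wfilZ.
  move=> s; rewrite size1 ltnS => sk; exists (word _ s); split.
    by apply: wfil_le (quant_ihom_symbol s); rewrite leq_double.
  exact: wfil_le (tau_symbol s).
move: uQ; rewrite Qp sub0r => /wfilN; rewrite opprK => /(jret_fil charF0 ef).
rewrite (jretK charF0 ef) => /pbw_fil hu.
have -> : p = tau u - (tau u - p) by abel.
exact: wfilB.
Qed.

(* Contractions lower weights and preserve the kernel of [Q], so an element of
   the kernel is horizontal by induction on its weight. *)
Lemma quant_inj : injective Q.
Proof.
suff h x : Q x = 0 -> x = 0.
  by move=> x x' /eqP; rewrite -subr_eq0 -(linB lQ) => /eqP /h /eqP; rewrite subr_eq0 => /eqP.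
have [k] := wfil_exhaustive (@wgt g) x; elim: k x => [|k IH] x hx Qx.
  exact: wfil0_eq0 hx.
have ix z : wiota z x = 0.
  apply: IH; last by rewrite Qi Qx (lin0 (twderL (@niota_twder F g z))).
  apply: (wfil_twder (@wpar_hom F g) (wiota_twder z)) hx.
    case=> y; rewrite -/(wo y) -/(we y) ?wpar_wo ?wpar_we.
      exact/wfilN/(wfil_gen _ (@wgt g) (WOdd y)).
    exact: (wfil_gen _ (@wgt g) (WEven y)).
  case=> y; rewrite -/(wo y) -/(we y) ?wiota_wo ?wiota_we.
    exact/wfilZ/wfil1.
  exact: (wfil_gen _ (@wgt g) (WOdd _)).
have [p xE] := weil_horizontal charF0 ef ix.
by move: Qx; rewrite xE => /quant_ihom_inj0 ->; exact: lin0 (homL hi).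
Qed.

Lemma inj_surj_bij (A B : Type) (h : A -> B) :
  injective h -> (forall y, exists x, h x = y) -> bijective h.
Proof.
move=> hinj /choice[k hk]; exists k; last exact: hk.
by move=> x; apply: hinj; rewrite hk.
Qed.

Lemma quant_bij : bijective Q.
Proof. exact: inj_surj_bij quant_inj (quant_surj charF0 ef hQ). Qed.

Lemma quant_lie z x : Q (wlie z x) = nlie z (Q x).
Proof.
have [_ Qd _] := quant_intertwines charF0 ef hQ.
by rewrite -wcartan -ncartan (linD lQ) Qi !Qd Qi.
Qed.

(** The map exists because [Q] preserves horizontal elements. It is onto because the inverse of [Q]
    does so too: if [Q x] is horizontal, then [Q (wiota z x) = 0], and injectivity of [Q]
    applies. *)
Lemma duflo_exists : exists q : symAlg g -> envAlg g,
  [/\ linear q, bijective q, forall x, Q (ihom e f x) = jhom e f (q x)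
    & forall z x, q (sym_ad z x) = env_ad z (q x)].
Proof.
have jinj := jhom_inj charF0 ef.
have /choice[q qE] x : exists u, Q (ihom e f x) = jhom e f u.
  apply: (ncweil_horizontal charF0 ef) => z.
  by rewrite -Qi (ihom_iota charF0 ef) (lin0 lQ).
exists q; split=> //.
- by move=> a x y; apply: jinj; rewrite -qE !(linP (homL hi), linP (homL hj)) lQ !qE.
- apply: inj_surj_bij => [x y qxy|u].
    apply: (ihom_inj charF0 ef); apply: quant_inj.
    by rewrite !qE qxy.
  have [x xE] := quant_surj charF0 ef hQ (jhom e f u).
  have [z|p pE] := weil_horizontal charF0 ef (x := x).
    apply: quant_inj; rewrite Qi xE (lin0 lQ); exact: jhom_iota.
  by exists p; apply: jinj; rewrite -qE -pE.
- move=> z x; apply: jinj; rewrite -qE -(jhom_ad charF0 ef) -qE -quant_lie.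
  by rewrite (ihom_ad charF0 ef).
Qed.
End QuantizationBijective.

Local Open Scope classical_set_scope.

Theorem theoremB (F : fieldType) (charF0 : [pchar F] =i pred0)
    (g : quadLieAlgType F) (e f : (\dim {:g}).-tuple g)
    (ef_dual : dual_bases e f) :
  exists (Q : weilAlg g -> ncWeilAlg g) (q : symAlg g -> envAlg g)
         (i : symAlg g -> weilAlg g) (j : envAlg g -> ncWeilAlg g),
    [/\ is_symmetrization Q /\ bijective Q,
        [/\ algebra_hom i, injective i
          & forall z : g, i (symGen z) = weil_hat e f z],
        [/\ algebra_hom j, injective j
          & forall z : g, j (envGen z) = ncweil_hat e f z],
        linear q /\ bijective q
      & (forall x, Q (i x) = j (q x)) /\
        [/\ set_bij (sym_inv g) (env_inv g) q,
            q 1 = 1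
          & forall x y, sym_inv g x -> sym_inv g y -> q (x * y) = q x * q y]].
Proof.
have [Q hQ] := expsum_exists e f (idfun : {linear g -> g}) (homL (@waug_hom F g)).
have [q [lq bq qE qad]] := duflo_exists charF0 ef_dual hQ.
have jinj := jhom_inj charF0 ef_dual.
have hi := ihom_algebra charF0 ef_dual; have hj := jhom_algebra charF0 ef_dual.
exists Q, q, (ihom e f), (jhom e f); split.
- by split; [exact: quant_symmetrization hQ|exact: quant_bij hQ].
- by split; [|exact: ihom_inj|exact: ihom_gen].
- by split; [|exact: jhom_inj|exact: jhom_gen].
- by [].
split=> //; split.
- split=> [x hx z|x y _ _|u hu].
  + by rewrite -qad hx (lin0 lq).
  + exact: (bij_inj bq).
  + case: bq => k qK kK; exists (k u); last exact: kK.
    move=> z; apply: (can_inj qK); rewrite qad kK (hu z).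
    by rewrite (lin0 lq).
- by apply: jinj; rewrite -qE (hom1 hi) (hom1 hj) (quant1 charF0 ef_dual hQ).
- move=> x y hx hy; apply: jinj; rewrite -qE (homM hj) -!qE.
  exact: quant_mul_basic.
Qed.
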